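(* Let $2<\lambda\le 3$ and let $u\in C^\infty(\overline{\mathbb D})$ be a real-valued solution of $$-\Delta u=e^{2u}\ \text{ in }\mathbb D,\qquad \frac{\partial u}{\partial \nu}+\lambda=e^{u}\ \text{ on }\mathbb S^1.$$ Then exactly one of the following holds. (i) $u$ is radially symmetric and has the form $$u(z)=\log\frac{2R}{1+R^2|z|^2},$$ where $R>0$ satisfies $(\lambda-2)R^2-2R+\lambda=0$. (ii) $u$ is nonradial and $$u_z(0)^2-u_{zz}(0)\neq 0.$$ Moreover, if $1+\sqrt2<\lambda\le 3$, then every solution $u\in C^\infty(\overline{\mathbb D})$, if one exists, satisfies alternative (ii).
   Context: $\mathbb D=\{z=x_1+ix_2\in\mathbb C:|z|<1\}$ is the open unit disk, $\mathbb S^1=\partial\mathbb D$, $\nu$ is the outer unit normal on $\mathbb S^1$, and $\Delta$ is the Euclidean Laplacian. $C^\infty(\overline{\mathbb D})$ denotes functions smooth up to the boundary. Subscript $z$ denotes the Wirtinger derivative $\partial_z=\frac12(\partial_{x_1}-i\partial_{x_2})$, so $u_z=\partial_z u$, $u_{zz}=\partial_z^2u$. Radially symmetric (radial) means $u(e^{i\alpha}z)=u(z)$ for all $\alpha\in\mathbb R$. *)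

(* Defs.v *)
From Stdlib Require Export Reals.
From Coquelicot Require Export Coquelicot.

Open Scope R_scope.

Definition unit_disk (z : C) : Prop := Cmod z < 1.
Definition closed_disk (z : C) : Prop := Cmod z <= 1.
Definition unit_circle (z : C) : Prop := Cmod z = 1.

(* Partial derivatives in x1 and x2, where z = x1 + i x2 = (x1, x2). *)
Definition d1 (f : C -> R) (z : C) : R := Derive (fun s => f (s, Im z)) (Re z).
Definition d2 (f : C -> R) (z : C) : R := Derive (fun t => f (Re z, t)) (Im z).

Definition ex_d1 (f : C -> R) (z : C) : Prop :=
  ex_derive (fun s => f (s, Im z)) (Re z).
Definition ex_d2 (f : C -> R) (z : C) : Prop :=
  ex_derive (fun t => f (Re z, t)) (Im z).

Definition laplacian (f : C -> R) (z : C) : R := d1 (d1 f) z + d2 (d2 f) z.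

Definition extends_continuously (f : C -> R) : Prop :=
  exists g : C -> R,
    (forall z, unit_disk z -> g z = f z) /\ continuous_on closed_disk g.

(* All partial derivatives of order at most k exist in the open disk and extend
   continuously to the closed disk. *)
Fixpoint Ck_up_to_boundary (k : nat) (f : C -> R) : Prop :=
  extends_continuously f /\
  match k with
  | O => True
  | S k' =>
      (forall z, unit_disk z -> ex_d1 f z /\ ex_d2 f z) /\
      Ck_up_to_boundary k' (d1 f) /\ Ck_up_to_boundary k' (d2 f)
  end.

(* A function on the closed disk is represented by a total function on C, whose
   values outside the closed disk are irrelevant. The first conjunct says that
   the values of f on the unit circle are those of its continuous extension. *)
Definition smooth_up_to_boundary (f : C -> R) : Prop :=
  continuous_on closed_disk f /\ forall k : nat, Ck_up_to_boundary k f.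

(* The outer unit normal at z on the unit circle is z itself; the derivative is
   one-sided, since f is only meaningful on the closed disk. *)
Definition is_outer_normal_derive (f : C -> R) (z : C) (l : R) : Prop :=
  filterlim (fun t : R => (f z - f (z - RtoC t * z)%C) / t)
    (at_right 0) (locally l).

Definition is_solution (lambda : R) (u : C -> R) : Prop :=
  (forall z, unit_disk z -> - laplacian u z = exp (2 * u z)) /\
  (forall z, unit_circle z ->
     exists l, is_outer_normal_derive u z l /\ l + lambda = exp (u z)).

Definition d1C (f : C -> C) (z : C) : C :=
  (d1 (fun w => Re (f w)) z, d1 (fun w => Im (f w)) z).
Definition d2C (f : C -> C) (z : C) : C :=
  (d2 (fun w => Re (f w)) z, d2 (fun w => Im (f w)) z).

Definition wirtinger (f : C -> C) (z : C) : C :=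
  (RtoC (1 / 2) * (d1C f z - Ci * d2C f z))%C.

Definition radial (u : C -> R) : Prop :=
  forall (alpha : R) (z : C), closed_disk z ->
    u ((cos alpha, sin alpha) * z)%C = u z.

Definition radial_alternative (lambda : R) (u : C -> R) : Prop :=
  radial u /\
  exists r : R,
    0 < r /\ (lambda - 2) * r ^ 2 - 2 * r + lambda = 0 /\
    forall z, closed_disk z ->
      u z = ln (2 * r / (1 + r ^ 2 * Cmod z ^ 2)).

Definition nonradial_alternative (u : C -> R) : Prop :=
  ~ radial u /\
  let uC := fun z : C => RtoC (u z) in
  (wirtinger uC (RtoC 0) ^ 2 - wirtinger (wirtinger uC) (RtoC 0))%C <> RtoC 0.

Definition exactly_one (P Q : Prop) : Prop := (P /\ ~ Q) \/ (~ P /\ Q).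

(* Main.v *)
Require Import Defs.
From Stdlib Require Import Lra Psatz Classical.

(** No Fourier series is used: each circle integral is a function of [t], differentiated under the
    integral sign, where every exact [h]-derivative drops out. Its limit as [t] tends to minus
    infinity replaces regularity at the origin. The function [H] exists because of [v_h = 2 y] on
    the circle: the tangential derivative that [p] prescribes for [H] is then that of [v]. This is
    also why [phi] vanishes on the circle and its gradient there is normal. The bound [lambda <= 3]
    comes from comparing the factor [lambda] in [J] with the order 3 to which [p] vanishes. The
    final step is a comparison of Chebyshev type. For [n > 0], [Z] is a positive multiple of
    [1 / s - level n], so its product with [cut (1 / s) - cut (level n)] is nonnegative for any
    increasing [cut]. Only the moments of [Z] and [Z s] are controlled, so [cut (1 / s)] has to be
    affine in [s] on the circle; this dictates [cut]. *)

(** In the coordinates [z = exp (t + i h)], [t <= 0], the function [v = u + t] solves [- Lap v = exp (2 v)] and, with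
    [m = lambda - 1], [v_t = exp v - m] on [t = 0]. The function [z^2 (u_zz - u_z^2)] is holomorphic, and the boundary
    condition says that its imaginary part on the circle is [- m u_h / 2]. Write it as [- m p], [p = x + i y], and let
    [H] be the harmonic function with [z H_z = - p] and [H = u] on the circle. If [u_zz(0) = u_z(0)^2], then [p]
    vanishes to order 3 at the origin.

    Put [J = lambda p - p' - p^2], [s = exp v / 2] and [Z = Re J / s] on the circle. Three facts are combined.
    - As [exp (- H) = |C|^2] with [C] holomorphic, [z C' = p C] and [C - C(0) = O(z^3)], comparing Fourier coefficients
      gives [oint |p|^2 exp (- H) >= 3 oint x exp (- H)], hence [oint Z <= 0] because [lambda <= 3].
    - [oint Z s = oint Re J = 0] by the mean value property.
    - With [phi = v - t - H >= 0], the function [X = exp phi (1 + exp (- 2 v) |grad phi|^2)] is subharmonic, even in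
      the stronger sense that [div (k (X - 1) grad X) >= 0] whenever [k >= 0] and [E k(E)] is nondecreasing. On the
      circle [X = 1 + n^2] and [X_t = 2 n Z], where [2 s n = - phi_t], so that [oint Z chi(n) >= 0] for every
      nonnegative nondecreasing [chi].

    The boundary condition gives [Z = m n - s (n^2 + 2 n - 1)], which is positive exactly when [s < s*(n)] for a
    decreasing function [s*]. Choosing [chi = const - s*] on the relevant range makes [Z (const - s - chi(n))]
    nonnegative with integral [<= 0], so [Z] vanishes. Then [J = 0], and [n], [s] are constant on the circle, whence
    [p = 0] and [u] is radial. *)

(** * Functions on the closed half-cylinder *)

Lemma is_derive_eq (f : R -> R) (x l l' : R) : is_derive f x l -> l = l' -> is_derive f x l'.
Proof. now intros D <-. Qed.

Definition cont2 (f : R -> R -> R) : Prop := forall t h, continuity_2d_pt f t h.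

(* [f] is a C^1 function on the half-cylinder [t <= 0], [h] modulo [2 PI], with partial derivatives [ft] and [fh];
   the derivative in [t] is only required for [t < 0]. Values at [t > 0] are junk, apart from continuity. *)
Record cyl (f ft fh : R -> R -> R) : Prop := Cyl {
  cyl_cont : cont2 f;
  cyl_cont_t : cont2 ft;
  cyl_cont_h : cont2 fh;
  cyl_per : forall t h, f t (h + 2 * PI) = f t h;
  cyl_dt : forall t h, t < 0 -> is_derive (fun s => f s h) t (ft t h);
  cyl_dh : forall t h, t <= 0 -> is_derive (fun s => f t s) h (fh t h) }.

Lemma cont2_ext (f g : R -> R -> R) :
  (forall t h, f t h = g t h) -> cont2 f -> cont2 g.
Proof. intros E H t h. apply continuity_2d_pt_ext with f; auto. Qed.

Lemma cont2_const (c : R) : cont2 (fun _ _ => c).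
Proof. intros t h. apply continuity_2d_pt_const. Qed.

Lemma cont2_fst : cont2 (fun t _ => t).
Proof. intros t h. apply continuity_2d_pt_id1. Qed.

Lemma cont2_snd : cont2 (fun _ h => h).
Proof. intros t h. apply continuity_2d_pt_id2. Qed.

Lemma cont2_plus (f g : R -> R -> R) :
  cont2 f -> cont2 g -> cont2 (fun t h => f t h + g t h).
Proof. intros Hf Hg t h. apply continuity_2d_pt_plus; auto. Qed.

Lemma cont2_mult (f g : R -> R -> R) :
  cont2 f -> cont2 g -> cont2 (fun t h => f t h * g t h).
Proof. intros Hf Hg t h. apply continuity_2d_pt_mult; auto. Qed.

Lemma cont2_opp (f : R -> R -> R) : cont2 f -> cont2 (fun t h => - f t h).
Proof. intros Hf t h. apply continuity_2d_pt_opp; auto. Qed.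

Lemma cont2_minus (f g : R -> R -> R) :
  cont2 f -> cont2 g -> cont2 (fun t h => f t h - g t h).
Proof. intros Hf Hg t h. apply continuity_2d_pt_minus; auto. Qed.

Lemma cont2_pow (f : R -> R -> R) (n : nat) : cont2 f -> cont2 (fun t h => f t h ^ n).
Proof.
  intros Hf; induction n as [|n IH].
  - apply (cont2_ext (fun _ _ => 1)); [reflexivity | apply cont2_const].
  - apply (cont2_ext (fun t h => f t h * f t h ^ n)); [reflexivity |].
    now apply cont2_mult.
Qed.

Lemma cont2_comp (k : R -> R) (f : R -> R -> R) :
  (forall x, continuous k x) -> cont2 f -> cont2 (fun t h => k (f t h)).
Proof.
  intros Hk Hf t h. apply continuity_1d_2d_pt_comp; auto.
  apply continuity_pt_filterlim, Hk.
Qed.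

Lemma continuous_exp (x : R) : continuous exp x.
Proof. apply continuity_pt_filterlim, derivable_continuous_pt, derivable_pt_exp. Qed.

Lemma cont2_exp (f : R -> R -> R) : cont2 f -> cont2 (fun t h => exp (f t h)).
Proof. intros Hf. apply cont2_comp; auto. apply continuous_exp. Qed.

Lemma cont2_line_h (f : R -> R -> R) (t h : R) : cont2 f -> continuous (fun s => f t s) h.
Proof.
  intros Hf. apply continuity_pt_filterlim. intros eps He.
  destruct (Hf t h (mkposreal eps He)) as [d Hd].
  exists d; split; [apply cond_pos|]. intros x [_ Hx].
  unfold dist in *; simpl in *; unfold R_dist in *.
  apply Hd; auto. rewrite Rminus_diag, Rabs_R0. apply cond_pos.
Qed.

Lemma cont2_line_t (f : R -> R -> R) (t h : R) : cont2 f -> continuous (fun s => f s h) t.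
Proof.
  intros Hf. apply continuity_pt_filterlim. intros eps He.
  destruct (Hf t h (mkposreal eps He)) as [d Hd].
  exists d; split; [apply cond_pos|]. intros x [_ Hx].
  unfold dist in *; simpl in *; unfold R_dist in *.
  apply Hd; auto. rewrite Rminus_diag, Rabs_R0. apply cond_pos.
Qed.

Ltac cont2 := repeat first
  [ assumption | apply cont2_const | apply cont2_fst | apply cont2_snd | apply cont2_plus | apply cont2_minus
  | apply cont2_mult | apply cont2_opp | apply cont2_pow | apply cont2_exp ].

Lemma cyl_ext (f g ft gt fh gh : R -> R -> R) :
  (forall t h, f t h = g t h) -> (forall t h, ft t h = gt t h) ->
  (forall t h, fh t h = gh t h) -> cyl f ft fh -> cyl g gt gh.
Proof.
  intros E Et Eh [Hc Ht Hh Hp Hdt Hdh]; split.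
  - now apply (cont2_ext f).
  - now apply (cont2_ext ft).
  - now apply (cont2_ext fh).
  - intros; rewrite <- !E; apply Hp.
  - intros; rewrite <- Et. apply is_derive_ext with (fun s => f s h); auto.
  - intros; rewrite <- Eh. apply is_derive_ext with (fun s => f t s); auto.
Qed.

Lemma cyl_const (c : R) : cyl (fun _ _ => c) (fun _ _ => 0) (fun _ _ => 0).
Proof.
  split; try apply cont2_const; auto; intros; apply (is_derive_const c).
Qed.

Lemma cyl_fst : cyl (fun t _ => t) (fun _ _ => 1) (fun _ _ => 0).
Proof.
  split; try apply cont2_const; try apply cont2_fst; auto; intros.
  - apply (is_derive_id t).
  - apply (is_derive_const t).
Qed.

Lemma cyl_plus (f g ft gt fh gh : R -> R -> R) :
  cyl f ft fh -> cyl g gt gh ->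
  cyl (fun t h => f t h + g t h) (fun t h => ft t h + gt t h) (fun t h => fh t h + gh t h).
Proof.
  intros [Hc Ht Hh Hp Hdt Hdh] [Gc Gt Gh Gp Gdt Gdh]; split; try apply cont2_plus; auto.
  - intros; now rewrite Hp, Gp.
  - intros. apply (is_derive_plus (fun s => f s h) (fun s => g s h)); auto.
  - intros. apply (is_derive_plus (f t) (g t)); auto.
Qed.

Lemma cyl_opp (f ft fh : R -> R -> R) :
  cyl f ft fh ->
  cyl (fun t h => - f t h) (fun t h => - ft t h) (fun t h => - fh t h).
Proof.
  intros [Hc Ht Hh Hp Hdt Hdh]; split; try apply cont2_opp; auto.
  - intros; now rewrite Hp.
  - intros. apply (is_derive_opp (fun s => f s h)); auto.
  - intros. apply (is_derive_opp (f t)); auto.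
Qed.

Lemma cyl_minus (f g ft gt fh gh : R -> R -> R) :
  cyl f ft fh -> cyl g gt gh ->
  cyl (fun t h => f t h - g t h) (fun t h => ft t h - gt t h) (fun t h => fh t h - gh t h).
Proof. intros Hf Hg. apply (cyl_plus _ _ _ _ _ _ Hf (cyl_opp _ _ _ Hg)). Qed.

Lemma cyl_mult (f g ft gt fh gh : R -> R -> R) :
  cyl f ft fh -> cyl g gt gh ->
  cyl (fun t h => f t h * g t h) (fun t h => ft t h * g t h + f t h * gt t h)
    (fun t h => fh t h * g t h + f t h * gh t h).
Proof.
  intros [Hc Ht Hh Hp Hdt Hdh] [Gc Gt Gh Gp Gdt Gdh]; split; cont2.
  - intros; now rewrite Hp, Gp.
  - intros. apply (is_derive_mult (fun s => f s h) (fun s => g s h)); auto.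
    intros; apply Rmult_comm.
  - intros. apply (is_derive_mult (f t) (g t)); auto. intros; apply Rmult_comm.
Qed.

Lemma cyl_comp (k dk : R -> R) (f ft fh : R -> R -> R) :
  (forall x, is_derive k x (dk x)) -> (forall x, continuous dk x) -> cyl f ft fh ->
  cyl (fun t h => k (f t h)) (fun t h => dk (f t h) * ft t h) (fun t h => dk (f t h) * fh t h).
Proof.
  intros Hk Hdk [Hc Ht Hh Hp Hdt Hdh].
  assert (Hdk2 : cont2 (fun t h => dk (f t h))) by now apply cont2_comp.
  split; cont2.
  - apply cont2_comp; auto. intros y. apply (ex_derive_continuous (V := R_NormedModule) k y). exists (dk y); apply Hk.
  - intros; now rewrite Hp.
  - intros. rewrite Rmult_comm. apply (is_derive_comp k (fun s => f s h)); auto.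
  - intros. rewrite Rmult_comm. apply (is_derive_comp k (f t)); auto.
Qed.

Lemma cyl_exp (f ft fh : R -> R -> R) :
  cyl f ft fh ->
  cyl (fun t h => exp (f t h)) (fun t h => exp (f t h) * ft t h) (fun t h => exp (f t h) * fh t h).
Proof. apply (cyl_comp exp exp). apply is_derive_exp. apply continuous_exp. Qed.

Lemma cyl_pow2 (f ft fh : R -> R -> R) :
  cyl f ft fh ->
  cyl (fun t h => f t h ^ 2) (fun t h => 2 * f t h * ft t h) (fun t h => 2 * f t h * fh t h).
Proof.
  intros Hf. apply cyl_ext with (4 := cyl_mult _ _ _ _ _ _ Hf Hf); intros; ring.
Qed.

(** Typical use: the tactic [cyl] synthesizes the partial derivatives, and [ring] or [field] then
    matches them with the intended ones. *)
Lemma cyl_eq (f ft gt fh gh : R -> R -> R) :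
  cyl f ft fh -> (forall t h, ft t h = gt t h) -> (forall t h, fh t h = gh t h) -> cyl f gt gh.
Proof. intros Hf Et Eh. now apply cyl_ext with (4 := Hf). Qed.

Ltac cyl := repeat first
  [ eassumption | apply cyl_pow2 | apply cyl_const | apply cyl_fst | apply cyl_plus | apply cyl_minus
  | apply cyl_opp | apply cyl_mult | apply cyl_exp ].

(** * Integrals over the circles [t = const] *)

Definition circ (f : R -> R -> R) (t : R) : R := RInt (f t) 0 (2 * PI).

Lemma two_PI_pos : 0 < 2 * PI.
Proof. pose proof PI_RGT_0; lra. Qed.

Lemma ex_RInt_line (f : R -> R -> R) (t a b : R) : cont2 f -> ex_RInt (f t) a b.
Proof.
  intros Hf. apply (ex_RInt_continuous (V := R_CompleteNormedModule)).
  intros; now apply (cont2_line_h f).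
Qed.

Lemma circ_ext (f g : R -> R -> R) (t : R) : (forall h, f t h = g t h) -> circ f t = circ g t.
Proof. intros E. apply RInt_ext; auto. Qed.

Lemma circ_plus (f g : R -> R -> R) (t : R) :
  cont2 f -> cont2 g -> circ (fun t h => f t h + g t h) t = circ f t + circ g t.
Proof. intros. apply (RInt_plus (f t) (g t)); now apply ex_RInt_line. Qed.

Lemma circ_minus (f g : R -> R -> R) (t : R) :
  cont2 f -> cont2 g -> circ (fun t h => f t h - g t h) t = circ f t - circ g t.
Proof. intros. apply (RInt_minus (f t) (g t)); now apply ex_RInt_line. Qed.

Lemma circ_scal (c : R) (f : R -> R -> R) (t : R) :
  cont2 f -> circ (fun t h => c * f t h) t = c * circ f t.
Proof. intros. apply (RInt_scal (f t)); now apply ex_RInt_line. Qed.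

Lemma circ_le (f g : R -> R -> R) (t : R) :
  cont2 f -> cont2 g -> (forall h, f t h <= g t h) -> circ f t <= circ g t.
Proof.
  intros. apply RInt_le; try now apply ex_RInt_line. pose proof two_PI_pos; lra. auto.
Qed.

Lemma circ_const (c t : R) : circ (fun _ _ => c) t = 2 * PI * c.
Proof. unfold circ. rewrite (RInt_const 0 (2*PI) c). unfold scal; simpl; unfold mult; simpl. ring. Qed.

Lemma circ_ge_0 (f : R -> R -> R) (t : R) :
  cont2 f -> (forall h, 0 <= f t h) -> 0 <= circ f t.
Proof.
  intros Hf H. replace 0 with (circ (fun _ _ => 0) t) by (rewrite circ_const; ring).
  apply circ_le; auto. apply cont2_const.
Qed.

Lemma circ_abs_le (f : R -> R -> R) (t c : R) :
  cont2 f -> (forall h, Rabs (f t h) <= c) -> Rabs (circ f t) <= 2 * PI * c.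
Proof.
  intros Hf H. apply Rabs_le. split.
  - replace (- (2 * PI * c)) with (circ (fun _ _ => - c) t) by (rewrite circ_const; ring).
    apply circ_le; auto. apply cont2_const. intros h. generalize (H h). intros G; apply Rabs_le_between in G; lra.
  - rewrite <- (circ_const c t).
    apply circ_le; auto. apply cont2_const. intros h. generalize (H h). intros G; apply Rabs_le_between in G; lra.
Qed.

Lemma RInt_param_continuous (f : R -> R -> R) (a b t : R) :
  a <= b -> cont2 f -> continuous (fun t => RInt (f t) a b) t.
Proof.
  intros Hab Hf. apply continuity_pt_filterlim. intros eps He.
  assert (He' : 0 < eps / (2 * (b - a + 1))) by (apply Rdiv_lt_0_compat; lra).
  destruct (uniform_continuity_2d_1d' f a b t (fun h _ => Hf t h) (mkposreal _ He')) as [d Hd].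
  exists d; split; [apply cond_pos|]. intros v [_ Hv].
  unfold dist in *; simpl in *; unfold R_dist in *.
  apply Rle_lt_trans with ((b - a) * (eps / (2 * (b - a + 1)))).
  - rewrite <- (RInt_minus (f v) (f t)); try now apply ex_RInt_line.
    apply abs_RInt_le_const; auto.
    { apply (ex_RInt_minus (f v) (f t)); now apply ex_RInt_line. }
    intros h Hh. apply Rlt_le. unfold minus, plus, opp; simpl. pose proof (cond_pos d) as Hd0.
    apply (Hd h t h v); auto; try lra.
    + apply Rabs_lt_between in Hv. lra.
    + rewrite Rminus_diag, Rabs_R0; auto.
  - apply Rle_lt_trans with ((b - a + 1) * (eps / (2 * (b - a + 1)))).
    + apply Rmult_le_compat_r; lra.
    + replace ((b - a + 1) * (eps / (2 * (b - a + 1)))) with (eps / 2) by (field; lra). lra.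
Qed.

Lemma circ_continuous (f : R -> R -> R) (t : R) : cont2 f -> continuous (circ f) t.
Proof. apply (RInt_param_continuous f 0 (2 * PI) t), Rlt_le, two_PI_pos. Qed.

Lemma circ_derive (f ft fh : R -> R -> R) (t : R) :
  cyl f ft fh -> t < 0 -> is_derive (circ f) t (circ ft t).
Proof.
  intros [Hc Ht Hh Hp Hdt Hdh] Ht0.
  assert (Hn : locally t (fun s => s < 0)).
  { apply (open_lt 0 t Ht0). }
  replace (circ ft t) with (RInt (fun h => Derive (fun u => f u h) t) 0 (2 * PI)).
  - apply (is_derive_RInt_param f).
    + destruct Hn as [d Hd]. exists d. intros s Hs h _. exists (ft s h). apply Hdt. now apply Hd.
    + intros h _. apply continuity_2d_pt_ext_loc with ft; auto.
      destruct Hn as [d Hd]. exists d. intros u v Hu _. symmetry. apply is_derive_unique, Hdt, Hd. apply Hu.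
    + exists (mkposreal 1 Rlt_0_1). intros s _. now apply ex_RInt_line.
  - apply RInt_ext. intros h _. now apply is_derive_unique, Hdt.
Qed.

Lemma circ_dh (f ft fh : R -> R -> R) (t : R) :
  cyl f ft fh -> t <= 0 -> circ fh t = 0.
Proof.
  intros [Hc Ht Hh Hp Hdt Hdh] Ht0.
  unfold circ. rewrite (is_RInt_unique (fh t) 0 (2 * PI) (f t (2 * PI) - f t 0)).
  - rewrite <- (Rplus_0_l (2 * PI)), Hp. ring.
  - apply (is_RInt_derive (f t)); auto. intros; now apply (cont2_line_h fh).
Qed.

Lemma per_reduce (f : R -> R) :
  (forall h, f (h + 2 * PI) = f h) -> forall h, exists h', 0 <= h' <= 2 * PI /\ f h' = f h.
Proof.
  intros Hp h. pose proof two_PI_pos as H2.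
  assert (Hshift : forall n : nat, forall k, f (k + INR n * (2 * PI)) = f k).
  { induction n as [|n IH]; intros k. simpl; f_equal; ring.
    rewrite S_INR. replace (k + (INR n + 1) * (2 * PI)) with ((k + INR n * (2 * PI)) + 2 * PI) by ring.
    rewrite Hp. apply IH. }
  assert (Hpos : forall k, 0 <= k -> exists h', 0 <= h' <= 2 * PI /\ f h' = f k).
  { intros k Hk. destruct (nfloor_ex (k / (2 * PI))) as [n [Hn1 Hn2]].
    { apply Rdiv_le_0_compat; lra. }
    exists (k - INR n * (2 * PI)). split.
    - assert (k / (2 * PI) * (2 * PI) = k) by (field; lra). nra.
    - rewrite <- (Hshift n). f_equal; ring. }
  destruct (nfloor_ex (Rabs h / (2 * PI))) as [n [Hn1 Hn2]].
  { apply Rdiv_le_0_compat; [apply Rabs_pos | lra]. }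
  destruct (Hpos (h + INR (S n) * (2 * PI))) as [h' [Hh' E]].
  - rewrite S_INR.
    assert (Rabs h / (2 * PI) * (2 * PI) = Rabs h) by (field; lra).
    assert (- h <= Rabs h) by (rewrite <- Rabs_Ropp; apply Rle_abs). nra.
  - exists h'; split; auto. now rewrite E, Hshift.
Qed.

Lemma per_max (f : R -> R -> R) (t : R) :
  cont2 f -> (forall h, f t (h + 2 * PI) = f t h) -> exists h0, forall h, f t h <= f t h0.
Proof.
  intros Hf Hp. destruct (continuity_ab_maj (f t) 0 (2 * PI)) as [h0 [H0 _]].
  - left; apply two_PI_pos.
  - intros c _. apply continuity_pt_filterlim. now apply cont2_line_h.
  - exists h0. intros h. destruct (per_reduce (f t) Hp h) as [h' [Hh' E]]. rewrite <- E; auto.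
Qed.

Lemma circ_zero (f : R -> R -> R) (t : R) :
  cont2 f -> (forall h, f t (h + 2 * PI) = f t h) -> (forall h, 0 <= f t h) ->
  circ f t <= 0 -> forall h, f t h = 0.
Proof.
  intros Hf Hp H0 HI.
  assert (Hin : forall h, 0 <= h <= 2 * PI -> f t h = 0).
  { intros h Hh. destruct (Req_dec (f t h) 0) as [E|E]; auto. exfalso.
    assert (Hpos : 0 < f t h) by (specialize (H0 h); lra).
    assert (He : 0 < f t h / 2) by lra.
    destruct (Hf t h (mkposreal _ He)) as [d Hd].
    pose proof two_PI_pos as H2. pose proof (cond_pos d) as Hd0.
    set (l := Rmax 0 (h - d / 2)). set (r := Rmin (2 * PI) (h + d / 2)).
    assert (Hl : 0 <= l <= h /\ h - d / 2 <= l).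
    { unfold l, Rmax; destruct (Rle_dec 0 (h - d/2)); lra. }
    assert (Hr : h <= r <= 2 * PI /\ r <= h + d / 2).
    { unfold r, Rmin; destruct (Rle_dec (2*PI) (h + d/2)); lra. }
    assert (Hlr : l < r).
    { unfold l, r, Rmin, Rmax; destruct (Rle_dec 0 (h - d/2)); destruct (Rle_dec (2*PI) (h + d/2)); lra. }
    unfold circ in HI.
    assert (EX : forall a b, ex_RInt (f t) a b) by (intros; now apply ex_RInt_line).
    rewrite <- (RInt_Chasles (f t) 0 l (2*PI)) in HI; auto.
    rewrite <- (RInt_Chasles (f t) l r (2*PI)) in HI; auto.
    unfold plus in HI; simpl in HI.
    assert (I1 : 0 <= RInt (f t) 0 l) by (apply RInt_ge_0; auto; lra).
    assert (I2 : 0 <= RInt (f t) r (2 * PI)) by (apply RInt_ge_0; auto; lra).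
    assert (I3 : 0 < RInt (f t) l r).
    { apply RInt_gt_0; auto.
      - intros x Hx. specialize (Hd t x). simpl in Hd.
        assert (Rabs (f t x - f t h) < f t h / 2).
        { apply Hd. rewrite Rminus_diag, Rabs_R0; auto. apply Rabs_lt_between. lra. }
        apply Rabs_lt_between in H. lra.
      - intros; now apply (cont2_line_h f). }
    lra. }
  intros h. destruct (per_reduce (f t) (Hp) h) as [h' [Hh' E]]. rewrite <- E; auto.
Qed.

(** * Monotonicity in [t] and decay at the centre *)

Lemma incr_upto (T : R) (F dF : R -> R) :
  (forall t, t <= T -> continuous F t) -> (forall t, t < T -> is_derive F t (dF t)) ->
  (forall t, t < T -> 0 <= dF t) -> forall s t, s <= t <= T -> F s <= F t.
Proof.
  intros Hc Hd Hp s t [Hst Ht].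
  destruct (Rle_lt_or_eq_dec s t Hst) as [Hlt|E]; [|subst; lra].
  assert (Hmin : Rmin s t = s) by (apply Rmin_left; lra).
  assert (Hmax : Rmax s t = t) by (apply Rmax_right; lra).
  (* The intermediate point may be the endpoint [T], where [dF] is unconstrained; the default value
     0 covers that case. *)
  destruct (MVT_gen F s t (fun x => if Rlt_dec x T then dF x else 0)) as [c [Hc1 Hc2]].
  - rewrite Hmin, Hmax. intros x Hx. destruct (Rlt_dec x T); [apply Hd; auto | lra].
  - rewrite Hmin, Hmax. intros x Hx. apply continuity_pt_filterlim, Hc. lra.
  - destruct (Rlt_dec c T) as [Hc0|_]; [pose proof (Hp c Hc0); nra | lra].
Qed.

Lemma const_upto_0 (F : R -> R) :
  (forall t, t <= 0 -> continuous F t) -> (forall t, t < 0 -> is_derive F t 0) ->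
  forall s t, s <= 0 -> t <= 0 -> F s = F t.
Proof.
  intros Hc Hd.
  assert (H1 : forall s t, s <= t <= 0 -> F s <= F t).
  { apply (incr_upto 0 F (fun _ => 0)); auto; intros; lra. }
  assert (H2 : forall s t, s <= t <= 0 -> - F s <= - F t).
  { apply (incr_upto 0 (fun t => - F t) (fun _ => 0)).
    - intros t Ht. apply (continuous_opp F); auto.
    - intros t Ht. replace 0 with (- 0) by ring. apply (is_derive_opp F); auto.
    - intros; lra. }
  intros s t Hs Ht. destruct (Rle_dec s t) as [L|L].
  - specialize (H1 s t (conj L Ht)). specialize (H2 s t (conj L Ht)). lra.
  - assert (L' : t <= s) by lra. specialize (H1 t s (conj L' Hs)). specialize (H2 t s (conj L' Hs)). lra.
Qed.

Lemma exp_le (x y : R) : x <= y -> exp x <= exp y.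
Proof. intros [H|H]; [left; now apply exp_increasing | rewrite H; lra]. Qed.

(* The asymptotic regime is [t -> - infinity], that is, the centre of the disk. *)
Definition bigO (k : R) (f : R -> R -> R) : Prop :=
  exists C T : R, T <= 0 /\ 0 <= C /\ forall t h, t <= T -> Rabs (f t h) <= C * exp (k * t).

Lemma bigO_ext (k : R) (f g : R -> R -> R) :
  (forall t h, f t h = g t h) -> bigO k f -> bigO k g.
Proof.
  intros E [C [T [HT [HC H]]]]. exists C, T; repeat split; auto. intros; rewrite <- E; auto.
Qed.

Lemma bigO_weaken (k l : R) (f : R -> R -> R) : l <= k -> bigO k f -> bigO l f.
Proof.
  intros Hl [C [T [HT [HC H]]]]. exists C, T; repeat split; auto. intros t h Ht.
  apply Rle_trans with (1 := H t h Ht). apply Rmult_le_compat_l; auto.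
  apply exp_le. nra.
Qed.

Lemma bigO_plus (k : R) (f g : R -> R -> R) :
  bigO k f -> bigO k g -> bigO k (fun t h => f t h + g t h).
Proof.
  intros [C [T [HT [HC H]]]] [D [S [HS [HD K]]]].
  exists (C + D), (Rmin T S); repeat split; try lra.
  - apply Rle_trans with (2 := HT). apply Rmin_l.
  - intros t h Ht.
    apply Rle_trans with (1 := Rabs_triang _ _). rewrite Rmult_plus_distr_r.
    apply Rplus_le_compat; [apply H | apply K]; apply Rle_trans with (1 := Ht).
    apply Rmin_l. apply Rmin_r.
Qed.

Lemma bigO_opp (k : R) (f : R -> R -> R) : bigO k f -> bigO k (fun t h => - f t h).
Proof.
  intros [C [T [HT [HC H]]]]. exists C, T; repeat split; auto. intros; rewrite Rabs_Ropp; auto.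
Qed.

Lemma bigO_minus (k : R) (f g : R -> R -> R) :
  bigO k f -> bigO k g -> bigO k (fun t h => f t h - g t h).
Proof. intros Hf Hg. apply (bigO_plus k f (fun t h => - g t h)); auto. now apply bigO_opp. Qed.

Lemma bigO_mult (k l : R) (f g : R -> R -> R) :
  bigO k f -> bigO l g -> bigO (k + l) (fun t h => f t h * g t h).
Proof.
  intros [C [T [HT [HC H]]]] [D [S [HS [HD K]]]].
  exists (C * D), (Rmin T S); repeat split; try nra.
  - apply Rle_trans with (2 := HT). apply Rmin_l.
  - intros t h Ht. rewrite Rabs_mult, Rmult_plus_distr_r, exp_plus.
    replace (C * D * (exp (k * t) * exp (l * t))) with ((C * exp (k * t)) * (D * exp (l * t))) by ring.
    apply Rmult_le_compat; try apply Rabs_pos; [apply H | apply K]; apply Rle_trans with (1 := Ht).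
    apply Rmin_l. apply Rmin_r.
Qed.

Lemma bigO_const (c : R) : bigO 0 (fun _ _ => c).
Proof.
  exists (Rabs c), 0; repeat split; try lra. apply Rabs_pos. intros.
  rewrite Rmult_0_l, exp_0, Rmult_1_r. lra.
Qed.

Lemma bigO_exp (k : R) (f : R -> R -> R) :
  bigO 0 (fun t h => f t h - k * t) -> bigO k (fun t h => exp (f t h)).
Proof.
  intros [C [T [HT [HC H]]]]. exists (exp C), T; repeat split; auto.
  - left; apply exp_pos.
  - intros t h Ht. rewrite Rabs_pos_eq by (left; apply exp_pos). rewrite <- exp_plus.
    apply exp_le. specialize (H t h Ht). rewrite Rmult_0_l, exp_0, Rmult_1_r in H.
    apply Rabs_le_between in H. lra.
Qed.

Lemma bigO_small (k : R) (f : R -> R -> R) :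
  0 < k -> bigO k f ->
  forall eps, 0 < eps -> exists T, T <= 0 /\ forall t h, t <= T -> Rabs (f t h) <= eps.
Proof.
  intros Hk [C [T [HT [HC H]]]] eps He.
  exists (Rmin T (ln (eps / (C + 1)) / k)). split.
  - apply Rle_trans with (2 := HT). apply Rmin_l.
  - intros t h Ht. assert (Ht1 : t <= T) by (apply Rle_trans with (1 := Ht); apply Rmin_l).
    assert (Ht2 : t <= ln (eps / (C + 1)) / k) by (apply Rle_trans with (1 := Ht); apply Rmin_r).
    apply Rle_trans with (1 := H t h Ht1).
    assert (Hq : 0 < eps / (C + 1)) by (apply Rdiv_lt_0_compat; lra).
    apply Rle_trans with (C * (eps / (C + 1))).
    + apply Rmult_le_compat_l; auto. rewrite <- (exp_ln (eps / (C + 1))) by auto.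
      apply exp_le. apply Rmult_le_compat_l with (r := k) in Ht2; [|lra].
      replace (k * (ln (eps / (C + 1)) / k)) with (ln (eps / (C + 1))) in Ht2 by (field; lra). auto.
    + apply Rle_trans with ((C + 1) * (eps / (C + 1))).
      * apply Rmult_le_compat_r; lra.
      * right; field; lra.
Qed.

Lemma circ_small (k : R) (f : R -> R -> R) :
  0 < k -> cont2 f -> bigO k f ->
  forall eps, 0 < eps -> exists T, T <= 0 /\ forall t, t <= T -> Rabs (circ f t) <= eps.
Proof.
  intros Hk Hc Hf eps He. pose proof two_PI_pos as HP.
  destruct (bigO_small k f Hk Hf (eps / (2 * PI))) as [T [HT H]].
  { apply Rdiv_lt_0_compat; lra. }
  exists T; split; auto. intros t Ht.
  replace eps with (2 * PI * (eps / (2 * PI))) by (field; lra).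
  apply circ_abs_le; auto.
Qed.

(** The limit 0 at minus infinity plays the part of an initial value for the monotone function. *)
Lemma incr_nonneg (F dF : R -> R) :
  (forall t, t <= 0 -> continuous F t) -> (forall t, t < 0 -> is_derive F t (dF t)) ->
  (forall t, t < 0 -> 0 <= dF t) ->
  (forall eps, 0 < eps -> exists T, T <= 0 /\ forall t, t <= T -> Rabs (F t) <= eps) ->
  forall t, t <= 0 -> 0 <= F t.
Proof.
  intros Hc Hd Hp Hl t Ht. apply Rnot_lt_le. intros Hn.
  destruct (Hl (- F t / 2)) as [T [HT H]]; [lra|].
  pose proof (Rmin_l T t) as M1. pose proof (Rmin_r T t) as M2.
  specialize (H (Rmin T t) M1). apply Rabs_le_between in H.
  pose proof (incr_upto 0 F dF Hc Hd Hp (Rmin T t) t (conj M2 Ht)). lra.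
Qed.

(* Applies to the components of a holomorphic function of [t + i h] tending to 0. *)
Lemma circ_mean_zero (k : R) (f ft fh g gt : R -> R -> R) :
  0 < k -> bigO k f -> cyl f ft fh -> cyl g gt ft -> forall t, t <= 0 -> circ f t = 0.
Proof.
  intros Hk Hb Hf Hg.
  (* By the Cauchy-Riemann equation [ft] is the [h]-derivative of the conjugate [g], so its integral
     over a period is zero. *)
  assert (Hconst : forall s t, s <= 0 -> t <= 0 -> circ f s = circ f t).
  { apply const_upto_0.
    - intros; apply circ_continuous, Hf.
    - intros t Ht. rewrite <- (circ_dh g gt ft t Hg) by lra. now apply (circ_derive f ft fh). }
  intros t Ht. destruct (Req_dec (circ f t) 0) as [E|E]; auto. exfalso.
  destruct (circ_small k f Hk (cyl_cont _ _ _ Hf) Hb (Rabs (circ f t) / 2)) as [T [HT H]].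
  { apply Rabs_pos_lt in E; lra. }
  specialize (H T (Rle_refl T)). rewrite (Hconst T t HT Ht) in H. apply Rabs_pos_lt in E. lra.
Qed.

(** Integration by parts along the circle: the exact term [gh] integrates to zero over a period. *)
Lemma circ_derive_mod (f ft fh g gt gh k : R -> R -> R) (t : R) :
  cyl f ft fh -> cyl g gt gh -> cont2 k -> (forall t h, ft t h = k t h + gh t h) -> t < 0 ->
  is_derive (circ f) t (circ k t).
Proof.
  intros Hf Hg Hk E Ht. apply is_derive_eq with (1 := circ_derive _ _ _ t Hf Ht).
  rewrite <- (Rplus_0_r (circ k t)), <- (circ_dh _ _ _ t Hg (Rlt_le _ _ Ht)), <- circ_plus; auto.
  - apply circ_ext; auto.
  - apply Hg.
Qed.

Lemma circ_bigO (k : R) (f : R -> R -> R) :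
  cont2 f -> bigO k f ->
  exists C T, T <= 0 /\ 0 <= C /\ forall t, t <= T -> Rabs (circ f t) <= C * exp (k * t).
Proof.
  intros Hf [C [T [HT [HC HO]]]]. pose proof two_PI_pos. exists (2 * PI * C), T. repeat split; auto.
  - apply Rmult_le_pos; lra.
  - intros t Ht. rewrite Rmult_assoc. apply circ_abs_le; auto.
Qed.

(** Green's formula on an annulus in differentiated form: with [p = f_t] and [q = f_h], the
    derivative of the flux of [k(f) grad f] is the integral of its divergence. *)
Lemma circ_green (k dk : R -> R) (f p q pt ph qt qh : R -> R -> R) :
  (forall x, is_derive k x (dk x)) -> (forall x, continuous dk x) ->
  cyl f p q -> cyl p pt ph -> cyl q qt qh ->
  forall t, t < 0 ->
  is_derive (circ (fun t h => k (f t h) * p t h)) t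
    (circ (fun t h => dk (f t h) * (p t h ^ 2 + q t h ^ 2) + k (f t h) * (pt t h + qh t h)) t).
Proof.
  intros Hk Hdk Hf Hp Hq t Ht.
  pose proof (cyl_mult _ _ _ _ _ _ (cyl_comp k dk f p q Hk Hdk Hf) Hp) as H1.
  pose proof (cyl_mult _ _ _ _ _ _ (cyl_comp k dk f p q Hk Hdk Hf) Hq) as H2.
  pose proof (circ_derive _ _ _ t H1 Ht) as D.
  pose proof (circ_dh _ _ _ t H2 (Rlt_le _ _ Ht)) as Z.
  match goal with |- is_derive _ _ ?l => match type of D with is_derive _ _ ?l' => replace l with l'; auto end end.
  rewrite <- (Rplus_0_r (circ _ t)), <- Z, <- circ_plus.
  - apply circ_ext. intros h. ring.
  - apply H1.
  - apply H2.
Qed.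

(** * The system satisfied on the half-cylinder, and the conformal factor *)

(** Derivatives are controlled only for [t <= 0]; clipping discards the values beyond without losing
    continuity, so that integrals and neighbourhoods crossing [t = 0] cause no trouble. *)
Lemma cont2_clip (f : R -> R -> R) : cont2 f -> cont2 (fun t h => f (Rmin t 0) h).
Proof.
  intros Hf t h eps. destruct (Hf (Rmin t 0) h eps) as [d Hd].
  exists d. intros u v Hu Hv. apply Hd; auto.
  apply Rle_lt_trans with (2 := Hu). unfold Rmin.
  destruct (Rle_dec u 0); destruct (Rle_dec t 0); unfold Rabs;
    repeat destruct (Rcase_abs _); lra.
Qed.

Lemma cont2_swap (f : R -> R -> R) : cont2 f -> cont2 (fun t h => f h t).
Proof.
  intros Hf t h eps. destruct (Hf h t eps) as [d Hd]. exists d. auto.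
Qed.

(** The mean value theorem in [t], with a local bound on [k], reduces joint continuity to continuity
    in [h] at one fixed [t]. *)
Lemma cont2_partial (f k : R -> R -> R) :
  (forall t h, is_derive (fun s => f s h) t (k t h)) -> cont2 k ->
  (forall t h, continuous (f t) h) -> cont2 f.
Proof.
  intros Hd Hk Hc t h eps.
  assert (He2 : 0 < eps / 2) by (pose proof (cond_pos eps); lra).
  destruct (Hk t h (mkposreal 1 Rlt_0_1)) as [d1 H1].
  assert (Hc' : continuity_pt (f t) h) by (apply continuity_pt_filterlim, Hc).
  destruct (Hc' (eps / 2) He2) as [d2 [Hd2 H2]].
  set (M := Rabs (k t h) + 1). assert (HM : 0 < M) by (unfold M; pose proof (Rabs_pos (k t h)); lra).
  assert (Hd3 : 0 < Rmin (Rmin d1 d2) (eps / 2 / M)).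
  { apply Rmin_pos. apply Rmin_pos; auto. apply cond_pos. apply Rdiv_lt_0_compat; auto. }
  exists (mkposreal _ Hd3). simpl. intros u v Hu Hv.
  assert (Hu1 : Rabs (u - t) < d1) by (apply Rlt_le_trans with (1 := Hu), Rle_trans with (1 := Rmin_l _ _), Rmin_l).
  assert (Hu3 : Rabs (u - t) < eps / 2 / M) by (apply Rlt_le_trans with (1 := Hu), Rmin_r).
  assert (Hv1 : Rabs (v - h) < d1) by (apply Rlt_le_trans with (1 := Hv), Rle_trans with (1 := Rmin_l _ _), Rmin_l).
  assert (Hv2 : Rabs (v - h) < d2) by (apply Rlt_le_trans with (1 := Hv), Rle_trans with (1 := Rmin_l _ _), Rmin_r).
  assert (E2 : Rabs (f t v - f t h) < eps / 2).
  { destruct (Req_dec v h) as [E|E]. rewrite E, Rminus_diag, Rabs_R0; auto.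
    apply (H2 v). split; [split; [exact I | auto] | exact Hv2]. }
  assert (E1 : Rabs (f u v - f t v) < eps / 2).
  { destruct (MVT_gen (fun s => f s v) t u (fun s => k s v)) as [c [Hc1 Hc2]].
    - intros; apply Hd.
    - intros s _. apply continuity_pt_filterlim, (ex_derive_continuous (V := R_NormedModule) (fun s => f s v)). eexists; apply Hd.
    - rewrite Hc2, Rabs_mult.
      assert (Hcd : Rabs (c - t) < d1).
      { apply Rle_lt_trans with (2 := Hu1). clear -Hc1. revert Hc1. unfold Rmin, Rmax, Rabs.
        destruct (Rle_dec t u); repeat destruct (Rcase_abs _); lra. }
      specialize (H1 c v Hcd Hv1). simpl in H1.
      assert (Rabs (k c v) <= M).
      { unfold M. apply Rabs_lt_between in H1. unfold Rabs in *; repeat destruct (Rcase_abs _); lra. }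
      apply Rle_lt_trans with (M * Rabs (u - t)).
      + apply Rmult_le_compat_r; auto. apply Rabs_pos.
      + apply Rmult_lt_compat_l with (r := M) in Hu3; auto.
        replace (M * (eps / 2 / M)) with (eps / 2) in Hu3 by (field; lra). auto. }
  replace (f u v - f t h) with ((f u v - f t v) + (f t v - f t h)) by ring.
  apply Rle_lt_trans with (1 := Rabs_triang _ _). lra.
Qed.

(* In the coordinates [z = exp (t + i h)], [t <= 0], on the closed disk minus the origin, [v = u + t] again solves
   Liouville's equation, [a], [b] are its partial derivatives, and [- m (x + i y)] is the holomorphic function
   [z^2 (u_zz - u_z^2)], with successive complex derivatives [x1 + i y1] and [x2 + i y2] in the variable [t + i h];
   the equations for [a] and [b] solve for the second derivatives of [v]. *)
Record liouville (m : R) (v a b x y x1 y1 x2 y2 : R -> R -> R) : Prop := Liouville {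
  li_v : cyl v a b;
  li_a : cyl a
    (fun t h => (- exp (2 * v t h) - 4 * m * x t h + a t h ^ 2 - b t h ^ 2 - 1) / 2)
    (fun t h => 2 * m * y t h + a t h * b t h);
  li_b : cyl b
    (fun t h => 2 * m * y t h + a t h * b t h)
    (fun t h => (- exp (2 * v t h) + 4 * m * x t h - a t h ^ 2 + b t h ^ 2 + 1) / 2);
  li_x : cyl x x1 (fun t h => - y1 t h);
  li_y : cyl y y1 x1;
  li_x1 : cyl x1 x2 (fun t h => - y2 t h);
  li_y1 : cyl y1 y2 x2;
  li_bdry : forall h, a 0 h = exp (v 0 h) - m;
  li_v_O : bigO 0 (fun t h => v t h - t);
  li_a_O : bigO 1 (fun t h => a t h - 1);
  li_b_O : bigO 1 b;
  li_x_O : bigO 2 x;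
  li_y_O : bigO 2 y;
  li_x1_O : bigO 2 x1;
  li_y1_O : bigO 2 y1 }.

Section Analysis.

Variables (m : R) (v a b x y x1 y1 x2 y2 : R -> R -> R).
Hypothesis Hm : 1 < m.
Hypothesis L : liouville m v a b x y x1 y1 x2 y2.

Let Lv := li_v _ _ _ _ _ _ _ _ _ _ L.
Let La := li_a _ _ _ _ _ _ _ _ _ _ L.
Let Lb := li_b _ _ _ _ _ _ _ _ _ _ L.
Let Lx := li_x _ _ _ _ _ _ _ _ _ _ L.
Let Ly := li_y _ _ _ _ _ _ _ _ _ _ L.
Let Lx1 := li_x1 _ _ _ _ _ _ _ _ _ _ L.
Let Ly1 := li_y1 _ _ _ _ _ _ _ _ _ _ L.
Let Lbd := li_bdry _ _ _ _ _ _ _ _ _ _ L.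
Let Cv := cyl_cont _ _ _ Lv.
Let Ca := cyl_cont _ _ _ La.
Let Cb := cyl_cont _ _ _ Lb.
Let Cx := cyl_cont _ _ _ Lx.
Let Cy := cyl_cont _ _ _ Ly.
Let Cx1 := cyl_cont _ _ _ Lx1.
Let Cy1 := cyl_cont _ _ _ Ly1.
Let Cx2 := cyl_cont_t _ _ _ Lx1.
Let Cy2 := cyl_cont_t _ _ _ Ly1.

(** Differentiating the boundary condition along the circle gives [a_h = exp v * b], while the
    system gives [a_h = 2 m y + a b] with [a = exp v - m]. The difference is [m (b - 2 y) = 0]. *)
Lemma bdry_b (h : R) : b 0 h = 2 * y 0 h.
Proof.
  assert (D1 : is_derive (fun s => a 0 s) h (2 * m * y 0 h + a 0 h * b 0 h)).
  { apply (cyl_dh _ _ _ La 0 h); lra. }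
  assert (D2 : is_derive (fun s => a 0 s) h (exp (v 0 h) * b 0 h)).
  { apply is_derive_ext with (fun s => exp (v 0 s) - m). intros; now rewrite Lbd.
    pose proof (cyl_dh _ _ _ Lv 0 h (Rle_refl 0)) as D.
    auto_derive. exists (b 0 h); auto. replace (Derive (fun x : R => v 0 x) h) with (b 0 h). ring.
    symmetry; now apply is_derive_unique. }
  apply is_derive_unique in D1. apply is_derive_unique in D2. rewrite D1 in D2. rewrite Lbd in D2.
  nra.
Qed.

(** The tangential derivative of [bdry_b], since [y_h = x1]. *)
Lemma bdry_x1 (h : R) :
  x1 0 h = (- exp (2 * v 0 h) + 4 * m * x 0 h - a 0 h ^ 2 + b 0 h ^ 2 + 1) / 4.
Proof.
  pose proof (cyl_dh _ _ _ Lb 0 h (Rle_refl 0)) as D1. simpl in D1.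
  assert (D2 : is_derive (fun s => b 0 s) h (2 * x1 0 h)).
  { apply is_derive_ext with (fun s => 2 * y 0 s). intros; now rewrite bdry_b.
    apply (is_derive_scal (y 0) h 2 (x1 0 h)).
    apply (cyl_dh _ _ _ Ly 0 h (Rle_refl 0)). }
  apply is_derive_unique in D1. apply is_derive_unique in D2.
  assert (E := eq_trans (eq_sym D1) D2). simpl. lra.
Qed.

Let H (t h : R) : R := v 0 h + RInt (fun s => 2 * x (Rmin s 0) h) t 0.

(** [H] integrates [H_t = - 2 x] inwards from the value [v] on the circle. There [H_h = 2 y] is
    [bdry_b], and the Cauchy-Riemann equations carry it inside. Boundedness near the centre holds
    because [x] is [O(exp (2 t))], hence integrable. *)
Lemma conformal_factor :
  exists H : R -> R -> R,
    cyl H (fun t h => - 2 * x t h) (fun t h => 2 * y t h) /\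
    (forall h, H 0 h = v 0 h) /\ bigO 0 H.
Proof.
  assert (Cc : cont2 (fun s h => 2 * x (Rmin s 0) h)).
  { apply (cont2_mult (fun _ _ => 2) (fun s h => x (Rmin s 0) h)); [apply cont2_const | now apply cont2_clip]. }
  pose proof (cont2_swap _ Cc) as Cs.
  assert (EX : forall h p q, ex_RInt (fun s => 2 * x (Rmin s 0) h) p q).
  { intros. apply (ex_RInt_line (fun h s => 2 * x (Rmin s 0) h)); auto. }
  assert (Dt : forall t h, is_derive (fun s => H s h) t (- 2 * x (Rmin t 0) h)).
  { intros t h. unfold H.
    replace (- 2 * x (Rmin t 0) h) with (0 + opp (2 * x (Rmin t 0) h)) by (unfold opp; simpl; ring).
    apply (is_derive_plus (fun _ => v 0 h)). apply (is_derive_const (v 0 h)).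
    apply (is_derive_RInt' (fun s => 2 * x (Rmin s 0) h) _ t 0).
    - exists (mkposreal 1 Rlt_0_1). intros s _. apply (RInt_correct (V := R_CompleteNormedModule) (fun s => 2 * x (Rmin s 0) h) s 0), EX.
    - apply (cont2_line_t (fun s h => 2 * x (Rmin s 0) h)); auto. }
  assert (Hcont : forall t h, continuous (H t) h).
  { intros t h. unfold H. apply (continuous_plus (fun h => v 0 h)). now apply cont2_line_h.
    destruct (Rle_dec t 0) as [Ht|Ht].
    - apply (RInt_param_continuous (fun h s => 2 * x (Rmin s 0) h) t 0); auto.
    - apply continuous_ext with (fun h => - RInt (fun s => 2 * x (Rmin s 0) h) 0 t).
      { intros k. rewrite <- (opp_RInt_swap (fun s => 2 * x (Rmin s 0) k)). unfold opp; simpl; ring. auto. }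
      apply (continuous_opp (fun h => RInt (fun s => 2 * x (Rmin s 0) h) 0 t)).
      apply (RInt_param_continuous (fun h s => 2 * x (Rmin s 0) h) 0 t); auto. lra. }
  assert (HC : cont2 H).
  { apply (cont2_partial H (fun t h => - 2 * x (Rmin t 0) h)); auto.
    apply (cont2_mult (fun _ _ => - 2) (fun s h => x (Rmin s 0) h)); [apply cont2_const | now apply cont2_clip]. }
  assert (H0 : forall h, H 0 h = v 0 h).
  { intros h. unfold H. rewrite RInt_point. unfold zero; simpl; ring. }
  assert (Dt' : forall t h, t < 0 -> is_derive (fun s => H s h) t (- 2 * x t h)).
  { intros t h Ht. generalize (Dt t h). rewrite Rmin_left by lra. auto. }
  assert (Hy : forall t h, t <= 0 -> RInt (fun s => - 2 * y1 (Rmin s 0) h) t 0 = 2 * y t h - 2 * y 0 h).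
  { intros t h Ht.
    assert (Cy' : cont2 (fun h s => - 2 * y1 (Rmin s 0) h)).
    { apply (cont2_swap (fun s h => - 2 * y1 (Rmin s 0) h)).
      apply (cont2_mult (fun _ _ => - 2) (fun s h => y1 (Rmin s 0) h)); [apply cont2_const | now apply cont2_clip]. }
    assert (E : RInt (fun s => - 2 * y1 (Rmin s 0) h) t 0 - 2 * y t h
             = RInt (fun s => - 2 * y1 (Rmin s 0) h) 0 0 - 2 * y 0 h).
    { assert (DD : forall t, is_derive (fun t => RInt (fun s => - 2 * y1 (Rmin s 0) h) t 0) t (- (- 2 * y1 (Rmin t 0) h))).
      { intros s. apply (is_derive_RInt' (fun s => - 2 * y1 (Rmin s 0) h) _ s 0).
        - exists (mkposreal 1 Rlt_0_1). intros p _. apply (RInt_correct (V := R_CompleteNormedModule) (fun s => - 2 * y1 (Rmin s 0) h) p 0). apply (ex_RInt_line (fun h s => - 2 * y1 (Rmin s 0) h)); auto.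
        - apply (cont2_line_h (fun h s => - 2 * y1 (Rmin s 0) h)); auto. }
      apply (const_upto_0 (fun t => RInt (fun s => - 2 * y1 (Rmin s 0) h) t 0 - 2 * y t h)); auto; try lra.
      - intros s Hs. apply (continuous_minus (fun t => RInt (fun s => - 2 * y1 (Rmin s 0) h) t 0)).
        + apply (ex_derive_continuous (V := R_NormedModule) (fun t => RInt (fun s => - 2 * y1 (Rmin s 0) h) t 0)). eexists; apply DD.
        + apply (cont2_line_t (fun t h => 2 * y t h)); cont2.
      - intros s Hs. specialize (DD s). rewrite Rmin_left in DD by lra.
        apply is_derive_eq with (- (- 2 * y1 s h) - 2 * y1 s h); [|ring].
        apply (is_derive_minus _ (fun t => 2 * y t h) s _ (2 * y1 s h) DD).
        apply (is_derive_scal (fun s => y s h) s 2 (y1 s h)).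
        now apply (cyl_dt _ _ _ Ly). }
    rewrite RInt_point in E. unfold zero in E; simpl in E. lra. }
  assert (Dh : forall t h, t <= 0 -> is_derive (fun s => H t s) h (2 * y t h)).
  { intros t h Ht. unfold H.
    assert (HyE := Hy t h Ht).
    assert (Hbd := bdry_b h).
    replace (2 * y t h) with (b 0 h + RInt (fun s => - 2 * y1 (Rmin s 0) h) t 0) by lra.
    apply (is_derive_plus (fun s => v 0 s)). apply (cyl_dh _ _ _ Lv); lra.
    assert (Der : forall h s, is_derive (fun u => 2 * x (Rmin s 0) u) h (- 2 * y1 (Rmin s 0) h)).
    { intros k s. replace (- 2 * y1 (Rmin s 0) k) with (2 * (- y1 (Rmin s 0) k)) by ring.
      apply (is_derive_scal (x (Rmin s 0)) k 2).
      apply (cyl_dh _ _ _ Lx). apply Rmin_r. }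
    replace (RInt (fun s => - 2 * y1 (Rmin s 0) h) t 0) with
      (RInt (fun s => Derive (fun u => 2 * x (Rmin s 0) u) h) t 0).
    2:{ apply RInt_ext. intros s _. now apply is_derive_unique. }
    apply (is_derive_RInt_param (fun u s => 2 * x (Rmin s 0) u) t 0 h).
    - exists (mkposreal 1 Rlt_0_1). intros k _ s _. eexists; apply Der.
    - intros s _. apply continuity_2d_pt_ext with (fun u s => - 2 * y1 (Rmin s 0) u).
      + intros u w. symmetry. now apply is_derive_unique.
      + apply (cont2_swap (fun s h => - 2 * y1 (Rmin s 0) h)).
        apply (cont2_mult (fun _ _ => - 2) (fun s h => y1 (Rmin s 0) h)); [apply cont2_const | now apply cont2_clip].
    - exists (mkposreal 1 Rlt_0_1). intros; apply EX. }
  exists H. split; [|split; auto].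
  - split; auto; cont2.
    intros t h. unfold H. f_equal. apply (cyl_per _ _ _ Lv).
    apply RInt_ext. intros; now rewrite (cyl_per _ _ _ Lx).
  - destruct (li_x_O _ _ _ _ _ _ _ _ _ _ L) as [C [T [HT [HC0 HO]]]].
    assert (Hper : forall h, H T (h + 2 * PI) = H T h).
    { intros h. unfold H. f_equal. apply (cyl_per _ _ _ Lv).
      apply RInt_ext. intros; now rewrite (cyl_per _ _ _ Lx). }
    destruct (per_max (fun t h => Rabs (H t h)) T) as [h0 Hmax].
    { apply cont2_comp; auto. intros; apply continuous_Rabs. }
    { intros; now rewrite Hper. }
    exists (Rabs (H T h0) + C), T. repeat split; auto.
    { pose proof (Rabs_pos (H T h0)); lra. }
    intros t h Ht. rewrite Rmult_0_l, exp_0, Rmult_1_r.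
    assert (De : forall s, is_derive (fun s => C * exp (2 * s)) s (2 * C * exp (2 * s))).
    { intros. auto_derive; auto. ring. }
    (* As [|x| <= C exp (2 t)] below [T], both [H + C exp (2 t)] and [- H + C exp (2 t)] are
       nondecreasing, so [|H|] exceeds its maximum at level [T] by at most [C]. *)
    assert (M1 : H t h + C * exp (2 * t) <= H T h + C * exp (2 * T)).
    { apply (incr_upto T (fun t => H t h + C * exp (2 * t)) (fun t => - 2 * x t h + 2 * C * exp (2 * t))); try lra.
      - intros s _. apply (continuous_plus (fun s => H s h)). now apply (cont2_line_t H).
        apply (ex_derive_continuous (V := R_NormedModule) (fun s => C * exp (2 * s))). eexists; apply De.
      - intros s Hs. apply (is_derive_plus (fun s => H s h)); auto. apply Dt'; lra.
      - intros s Hs. specialize (HO s h (Rlt_le _ _ Hs)). apply Rabs_le_between in HO. lra. }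
    assert (M2 : - H t h + C * exp (2 * t) <= - H T h + C * exp (2 * T)).
    { apply (incr_upto T (fun t => - H t h + C * exp (2 * t)) (fun t => - (- 2 * x t h) + 2 * C * exp (2 * t))); try lra.
      - intros s _. apply (continuous_plus (fun s => - H s h)). apply (continuous_opp (fun s => H s h)). now apply (cont2_line_t H).
        apply (ex_derive_continuous (V := R_NormedModule) (fun s => C * exp (2 * s))). eexists; apply De.
      - intros s Hs. apply (is_derive_plus (fun s => - H s h)); auto. apply (is_derive_opp (fun s => H s h)). apply Dt'; lra.
      - intros s Hs. specialize (HO s h (Rlt_le _ _ Hs)). apply Rabs_le_between in HO. lra. }
    pose proof (exp_pos (2 * t)).
    assert (exp (2 * T) <= 1) by (rewrite <- exp_0; apply exp_le; lra).
    specialize (Hmax h). simpl in Hmax. revert Hmax.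
    assert (0 <= C * exp (2 * t)) by nra. assert (C * exp (2 * T) <= C) by nra.
    pose proof (Rle_abs (H T h)). pose proof (Rle_abs (- H T h)). rewrite Rabs_Ropp in *.
    intros. apply Rabs_le. lra.
Qed.

End Analysis.

(** * The weighted spectral gap *)

Ltac circ_pos := apply circ_ge_0; [cont2 | intros].

Section Weighted.

Variables (x y x1 y1 x2 y2 H : R -> R -> R).
Hypothesis Lx : cyl x x1 (fun t h => - y1 t h).
Hypothesis Ly : cyl y y1 x1.
Hypothesis Lx1 : cyl x1 x2 (fun t h => - y2 t h).
Hypothesis Ly1 : cyl y1 y2 x2.
Hypothesis LH : cyl H (fun t h => - 2 * x t h) (fun t h => 2 * y t h).
Hypothesis HO : bigO 0 H.
Hypothesis HxO : bigO 3 x.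
Hypothesis HyO : bigO 3 y.

Let w (t h : R) : R := exp (- H t h).
Let Cx := cyl_cont _ _ _ Lx.
Let Cy := cyl_cont _ _ _ Ly.
Let Cx1 := cyl_cont _ _ _ Lx1.
Let Cy1 := cyl_cont _ _ _ Ly1.
Let CH := cyl_cont _ _ _ LH.
Let Cw : cont2 w.
Proof. unfold w; cont2. Qed.
Let Lw : cyl w (fun t h => 2 * x t h * w t h) (fun t h => - 2 * y t h * w t h).
Proof. unfold w. eapply cyl_eq; [cyl | intros; cbv beta; ring | intros; cbv beta; ring]. Qed.
Let w_pos (t h : R) : 0 < w t h.
Proof. apply exp_pos. Qed.
Let Ow : bigO 0 w.
Proof.
  apply bigO_exp. apply bigO_ext with (fun t h => - H t h). intros; ring. now apply bigO_opp.
Qed.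

(** If the holomorphic [C] with [|C|^2 = w] has coefficients [c_n], then [I0], [B0] and [G] are
    [2 PI] times the sums of [n], [n^2] and [(n - 3) n^2] times [|c_n|^2 exp (2 n t)]. Nonnegativity
    of [G] thus encodes the absence of the modes 1 and 2. *)
Let I0 := circ (fun t h => x t h * w t h).
Let B0 := circ (fun t h => (x t h ^ 2 + y t h ^ 2) * w t h).
Let G := circ (fun t h => (x t h * x1 t h + y t h * y1 t h
  + (x t h - 3) * (x t h ^ 2 + y t h ^ 2)) * w t h).

Let DI0 (t : R) : t < 0 -> is_derive I0 t (2 * B0 t).
Proof.
  intros Ht. unfold B0. rewrite <- circ_scal by cont2.
  eapply circ_derive_mod with (g := fun t h => y t h * w t h); auto; try cyl; cont2.
  intros; simpl. ring.
Qed.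

Let DB0 (t : R) : t < 0 -> is_derive B0 t (2 * G t + 6 * B0 t).
Proof.
  intros Ht. unfold G, B0. rewrite <- !circ_scal, <- circ_plus by cont2.
  eapply circ_derive_mod with (g := fun _ _ => 0); auto; try cyl; cont2.
  intros; simpl. ring.
Qed.

(** Twice [|p' + p^2 - 3 p|^2 w], that is [2 |D (D C) - 3 D C|^2] for [D = z d/dz], because
    [D C = p C] and [D (p C) = (p' + p^2) C]. *)
Let r2 (t h : R) : R :=
  2 * ((x1 t h + x t h ^ 2 - y t h ^ 2 - 3 * x t h) ^ 2
     + (y1 t h + 2 * x t h * y t h - 3 * y t h) ^ 2) * w t h.

Let DG (t : R) : t < 0 -> is_derive G t (circ r2 t + 6 * G t).
Proof.
  intros Ht. unfold G, r2. rewrite <- !circ_scal, <- circ_plus by cont2.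
  eapply circ_derive_mod with (g := fun t h =>
    ((y1 t h + 2 * x t h * y t h) * x t h - (x1 t h + x t h ^ 2 - y t h ^ 2) * y t h) * w t h);
    auto; try cyl; cont2.
  intros; simpl. ring.
Qed.

(* If [G] were negative at [t0], then [B0 e^{-6t}] would be unbounded at minus infinity, because
   [(G e^{-6t})' >= 0] and [(B0 e^{-6t})' = 2 G e^{-6t}]. *)
Let G_ge_0 (t0 : R) : t0 < 0 -> 0 <= G t0.
Proof.
  intros Ht0. apply Rnot_lt_le. intros HG.
  assert (De : forall t, is_derive (fun t => exp (- 6 * t)) t (- 6 * exp (- 6 * t))).
  { intros t. auto_derive; auto. ring. }
  assert (Ce : forall t, continuous (fun t => exp (- 6 * t)) t).
  { intros t. apply (ex_derive_continuous (V := R_NormedModule) (fun t => exp (- 6 * t))). eexists; apply De. }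
  set (d := - (G t0 * exp (- 6 * t0))).
  assert (Hd : 0 < d) by (unfold d; pose proof (exp_pos (- 6 * t0)); nra).
  assert (CG : forall t, continuous G t) by (intros; apply circ_continuous; cont2).
  assert (CB : forall t, continuous B0 t) by (intros; apply circ_continuous; cont2).
  assert (HGt : forall t, t <= t0 -> G t * exp (- 6 * t) <= - d).
  { intros t Ht. unfold d. rewrite Ropp_involutive.
    apply (incr_upto 0 (fun t => G t * exp (- 6 * t)) (fun t => circ r2 t * exp (- 6 * t))); try lra.
    - intros s _. apply (continuous_mult G); auto.
    - intros s Hs. eapply is_derive_eq.
      + apply (is_derive_mult G); [now apply DG | apply De | intros; apply Rmult_comm].
      + unfold plus, mult; simpl. ring.
    - intros s _. apply Rmult_le_pos; [|left; apply exp_pos]. unfold r2. circ_pos.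
      apply Rmult_le_pos; [|left; apply w_pos]. apply Rmult_le_pos; [lra | apply Rplus_le_le_0_compat; apply pow2_ge_0]. }
  set (K := - (B0 t0 * exp (- 6 * t0)) - 2 * d * t0).
  assert (HB : forall t, t <= t0 -> - (B0 t * exp (- 6 * t)) - 2 * d * t <= K).
  { intros t Ht. unfold K.
    apply (incr_upto t0 (fun t => - (B0 t * exp (- 6 * t)) - 2 * d * t)
      (fun t => - (2 * (G t * exp (- 6 * t))) - 2 * d)); try lra.
    - intros s _. apply (continuous_minus (fun t => - (B0 t * exp (- 6 * t)))).
      + apply (continuous_opp (fun t => B0 t * exp (- 6 * t))), (continuous_mult B0); auto.
      + apply (continuous_mult (fun _ => 2 * d)). apply continuous_const. apply continuous_id.
    - intros s Hs. apply (is_derive_minus (fun t => - (B0 t * exp (- 6 * t)))).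
      + apply (is_derive_opp (fun t => B0 t * exp (- 6 * t))). eapply is_derive_eq.
        * apply (is_derive_mult B0); [apply DB0; lra | apply De | intros; apply Rmult_comm].
        * unfold plus, mult; simpl. ring.
      + auto_derive; auto. ring.
    - intros s Hs. specialize (HGt s). lra. }
  destruct (circ_bigO 6 (fun t h => (x t h ^ 2 + y t h ^ 2) * w t h)) as [C [T [HT [HC HBO]]]].
  { cont2. }
  { replace 6 with (3 + 3 + 0) by ring. apply (bigO_mult (3 + 3) 0 (fun t h => x t h ^ 2 + y t h ^ 2)); auto.
    apply bigO_ext with (fun t h => x t h * x t h + y t h * y t h). intros; ring.
    apply bigO_plus; now apply bigO_mult. }
  fold B0 in HBO.
  (* At this level [HB] forces [B0 exp (- 6 t) >= C + 1], whereas the decay of order 6 allows at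
     most [C]. *)
  set (t := Rmin (Rmin T t0) (- (C + K + 1) / (2 * d))).
  assert (Ht1 : t <= T) by (apply Rle_trans with (1 := Rmin_l _ _), Rmin_l).
  assert (Ht2 : t <= t0) by (apply Rle_trans with (1 := Rmin_l _ _), Rmin_r).
  assert (Ht3 : t <= - (C + K + 1) / (2 * d)) by apply Rmin_r.
  specialize (HB t Ht2). specialize (HBO t Ht1). apply Rabs_le_between in HBO.
  assert (B0 t * exp (- 6 * t) <= C).
  { replace C with (C * exp (6 * t) * exp (- 6 * t)).
    - apply Rmult_le_compat_r; [left; apply exp_pos | lra].
    - rewrite Rmult_assoc, <- exp_plus. replace (6 * t + - 6 * t) with 0 by ring. rewrite exp_0; ring. }
  apply Rmult_le_compat_l with (r := 2 * d) in Ht3; [|lra].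
  replace (2 * d * (- (C + K + 1) / (2 * d))) with (- (C + K + 1)) in Ht3 by (field; lra). lra.
Qed.

Let Oxw : bigO 3 (fun t h => x t h * w t h).
Proof. replace 3 with (3 + 0) by ring. now apply bigO_mult. Qed.

Let Oppw : bigO 6 (fun t h => (x t h ^ 2 + y t h ^ 2) * w t h).
Proof.
  replace 6 with (3 + 3 + 0) by ring. apply (bigO_mult (3 + 3) 0 (fun t h => x t h ^ 2 + y t h ^ 2)); auto.
  apply bigO_ext with (fun t h => x t h * x t h + y t h * y t h). intros; ring.
  apply bigO_plus; now apply bigO_mult.
Qed.

(** The moment starts from 0 at the centre and has derivative [2 B0 >= 0]. *)
Lemma weighted_first_moment_nonneg (t : R) : t <= 0 -> 0 <= circ (fun t h => x t h * exp (- H t h)) t.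
Proof.
  apply (incr_nonneg I0 (fun t => 2 * B0 t)).
  - intros; apply circ_continuous; cont2.
  - apply DI0.
  - intros s _. apply Rmult_le_pos; [lra|]. unfold B0. circ_pos.
    apply Rmult_le_pos; [nra | left; apply w_pos].
  - apply (circ_small 3); auto; [lra | cont2].
Qed.

(** The terms [6 B0] cancel in [(B0 - 3 I0)' = 2 G], so that [G_ge_0] and decay at the centre
    suffice. *)
Lemma weighted_spectral_gap (t : R) :
  t <= 0 ->
  3 * circ (fun t h => x t h * exp (- H t h)) t
  <= circ (fun t h => (x t h ^ 2 + y t h ^ 2) * exp (- H t h)) t.
Proof.
  intros Ht. apply Rminus_le_0. revert t Ht.
  apply (incr_nonneg (fun t => B0 t - 3 * I0 t) (fun t => 2 * G t)).
  - intros t _. apply (continuous_minus B0). apply circ_continuous; cont2.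
    apply (continuous_mult (fun _ => 3)). apply continuous_const. apply circ_continuous; cont2.
  - intros t Ht. eapply is_derive_eq.
    + apply (is_derive_minus B0 (fun t => 3 * I0 t)). now apply DB0.
      apply (is_derive_scal I0). now apply DI0.
    + unfold minus, plus, opp; simpl. ring.
  - intros t Ht. specialize (G_ge_0 t Ht). lra.
  - intros eps He.
    assert (Hd : cont2 (fun t h => (x t h ^ 2 + y t h ^ 2) * w t h - 3 * (x t h * w t h))) by cont2.
    destruct (circ_small 3 (fun t h => (x t h ^ 2 + y t h ^ 2) * w t h - 3 * (x t h * w t h))
      ltac:(lra) Hd) with (eps := eps) as [T [HT HT2]]; auto.
    + apply bigO_minus. apply bigO_weaken with (2 := Oppw); lra.
      replace 3 with (0 + 3) at 1 by ring. apply (bigO_mult 0 3 (fun _ _ => 3)); auto. apply bigO_const.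
    + exists T; split; auto. intros t Ht. specialize (HT2 t Ht).
      unfold B0, I0. rewrite circ_minus, circ_scal in HT2 by cont2. auto.
Qed.

(* [I0] is nonnegative, nondecreasing in [t] and zero at [t = 0], so that [B0 = I0' / 2 = 0]. *)
Lemma weighted_rigidity :
  (forall h, x 0 h = 0 /\ y 0 h = 0) -> forall t h, t < 0 -> x t h = 0 /\ y t h = 0.
Proof.
  intros Hb.
  assert (HI : forall t, t <= 0 -> I0 t = 0).
  { intros t Ht. apply Rle_antisym.
    - replace 0 with (I0 0).
      + apply (incr_upto 0 I0 (fun t => 2 * B0 t)); try lra.
        * intros; apply circ_continuous; cont2.
        * apply DI0.
        * intros s _. apply Rmult_le_pos; [lra|]. unfold B0. circ_pos.
          apply Rmult_le_pos; [nra | left; apply w_pos].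
      + unfold I0. rewrite (circ_ext _ (fun _ _ => 0)). rewrite circ_const; ring.
        intros h; destruct (Hb h) as [-> _]; ring.
    - now apply weighted_first_moment_nonneg. }
  intros t h Ht.
  assert (HB : B0 t = 0).
  { assert (D : is_derive I0 t 0).
    { apply is_derive_ext_loc with (fun _ => 0).
      - destruct (open_lt 0 t Ht) as [d Hd]. exists d. intros s Hs. symmetry. apply HI. left; now apply Hd.
      - apply (is_derive_const 0). }
    pose proof (DI0 t Ht) as D2. apply is_derive_unique in D. apply is_derive_unique in D2. lra. }
  assert (Z := circ_zero (fun t h => (x t h ^ 2 + y t h ^ 2) * w t h) t).
  assert (E : (x t h ^ 2 + y t h ^ 2) * w t h = 0).
  { apply Z.
    - cont2.
    - intros k. unfold w. now rewrite (cyl_per _ _ _ Lx), (cyl_per _ _ _ Ly), (cyl_per _ _ _ LH).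
    - intros k. apply Rmult_le_pos; [nra | left; apply w_pos].
    - fold B0. lra. }
  pose proof (w_pos t h). apply Rmult_integral in E. destruct E; [split; nra | lra].
Qed.

End Weighted.

(** * Subharmonicity of the P-function *)

Definition pos_part (x : R) : R := Rmax 0 x.

Lemma pos_part_ge_0 (x : R) : 0 <= pos_part x.
Proof. apply Rmax_l. Qed.

Lemma pos_part_le_abs (x : R) : pos_part x <= Rabs x.
Proof. apply Rmax_lub; [apply Rabs_pos | apply Rle_abs]. Qed.

Lemma continuous_pos_part (x : R) : continuous pos_part x.
Proof.
  apply continuous_ext with (fun x => (x + Rabs x) / 2).
  - intros u. unfold pos_part, Rmax, Rabs. destruct (Rle_dec 0 u); destruct (Rcase_abs u); lra.
  - apply (continuous_mult (fun x : R => x + Rabs x) (fun _ => / 2)); [|apply continuous_const].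
    apply (continuous_plus (V := R_NormedModule) (fun x : R => x) Rabs); [apply continuous_id | apply continuous_Rabs].
Qed.

Lemma is_derive_pos_part_sq (x : R) : is_derive (fun u => pos_part u ^ 2) x (2 * pos_part x).
Proof.
  destruct (total_order_T x 0) as [[Hx|Hx]|Hx].
  - apply is_derive_ext_loc with (fun _ => 0).
    + destruct (open_lt 0 x Hx) as [d Hd]. exists d. intros u Hu. specialize (Hd u Hu).
      unfold pos_part. rewrite Rmax_left by lra. change (@eq R 0 (0 ^ 2)). ring.
    + unfold pos_part. rewrite Rmax_left by lra. rewrite Rmult_0_r. apply (is_derive_const 0).
  - subst. apply is_derive_Reals. intros eps He. exists (mkposreal eps He). intros u Hu Hu2. simpl in Hu2.
    rewrite Rplus_0_l. unfold pos_part at 2 3. rewrite (Rmax_left 0 0) by lra.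
    apply Rle_lt_trans with (2 := Hu2).
    replace ((pos_part u ^ 2 - 0 ^ 2) / u - 2 * 0) with (pos_part u * (pos_part u / u)) by (field; auto).
    unfold pos_part, Rmax. destruct (Rle_dec 0 u).
    + replace (u / u) with 1 by (field; auto). rewrite Rmult_1_r; lra.
    + rewrite Rmult_0_l, Rabs_R0. apply Rabs_pos.
  - apply is_derive_ext_loc with (fun u => u ^ 2).
    + destruct (open_gt 0 x Hx) as [d Hd]. exists d. intros u Hu. specialize (Hd u Hu).
      unfold pos_part. rewrite Rmax_right by lra. reflexivity.
    + unfold pos_part. rewrite Rmax_right by lra. auto_derive; auto. ring.
Qed.

Lemma is_derive_pos_part_cube (x : R) : is_derive (fun u => pos_part u ^ 3) x (3 * pos_part x ^ 2).
Proof.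
  assert (E : forall u : R, u * pos_part u = pos_part u ^ 2).
  { intros u. unfold pos_part, Rmax. simpl. destruct (Rle_dec 0 u); ring. }
  apply is_derive_ext with (fun u => u * pos_part u ^ 2).
  - intros u. replace (u * pos_part u ^ 2) with (u * pos_part u * pos_part u) by ring. rewrite E.
    change (@eq R (pos_part u ^ 2 * pos_part u) (pos_part u ^ 3)). ring.
  - apply is_derive_eq with (1 * pos_part x ^ 2 + x * (2 * pos_part x)).
    + apply (is_derive_mult (fun u : R => u) (fun u => pos_part u ^ 2) x 1 (2 * pos_part x)).
      apply (is_derive_id x). apply is_derive_pos_part_sq. intros; apply Rmult_comm.
    + rewrite <- (E x) at 2. rewrite <- (E x). ring.
Qed.

Lemma bigO_le (k : R) (f g : R -> R -> R) :
  (forall t h, Rabs (g t h) <= Rabs (f t h)) -> bigO k f -> bigO k g.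
Proof.
  intros E [C [T [HT [HC HO]]]]. exists C, T; repeat split; auto.
  intros. apply Rle_trans with (1 := E t h); auto.
Qed.

Section Interior.

Variables (m : R) (v a b x y x1 y1 x2 y2 H : R -> R -> R).
Hypothesis Hm : 1 < m.
Hypothesis L : liouville m v a b x y x1 y1 x2 y2.
Hypothesis LH : cyl H (fun t h => - 2 * x t h) (fun t h => 2 * y t h).
Hypothesis H0 : forall h, H 0 h = v 0 h.
Hypothesis HO : bigO 0 H.

Let Lv := li_v _ _ _ _ _ _ _ _ _ _ L.
Let La := li_a _ _ _ _ _ _ _ _ _ _ L.
Let Lb := li_b _ _ _ _ _ _ _ _ _ _ L.
Let Lx := li_x _ _ _ _ _ _ _ _ _ _ L.
Let Ly := li_y _ _ _ _ _ _ _ _ _ _ L.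
Let Lx1 := li_x1 _ _ _ _ _ _ _ _ _ _ L.
Let Ly1 := li_y1 _ _ _ _ _ _ _ _ _ _ L.
Let Cv := cyl_cont _ _ _ Lv.
Let Ca := cyl_cont _ _ _ La.
Let Cb := cyl_cont _ _ _ Lb.
Let Cx := cyl_cont _ _ _ Lx.
Let Cy := cyl_cont _ _ _ Ly.
Let Cx1 := cyl_cont _ _ _ Lx1.
Let Cy1 := cyl_cont _ _ _ Ly1.
Let Cx2 := cyl_cont_t _ _ _ Lx1.
Let Cy2 := cyl_cont_t _ _ _ Ly1.
Let CH := cyl_cont _ _ _ LH.

Let phi (t h : R) : R := v t h - t - H t h.
Let A (t h : R) : R := a t h - 1 + 2 * x t h.
Let B (t h : R) : R := b t h - 2 * y t h.
Let At (t h : R) : R :=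
  (- exp (2 * v t h) - 4 * m * x t h + a t h ^ 2 - b t h ^ 2 - 1) / 2 + 2 * x1 t h.
Let Ah (t h : R) : R := 2 * m * y t h + a t h * b t h - 2 * y1 t h.
Let Bh (t h : R) : R :=
  (- exp (2 * v t h) + 4 * m * x t h - a t h ^ 2 + b t h ^ 2 + 1) / 2 - 2 * x1 t h.

Let Lphi : cyl phi A B.
Proof. eapply cyl_eq; [unfold phi; cyl | |]; intros; unfold A, B; ring. Qed.
Let LA : cyl A At Ah.
Proof. eapply cyl_eq; [unfold A; cyl | |]; intros; unfold At, Ah; cbv beta; field. Qed.
Let LB : cyl B Ah Bh.
Proof. eapply cyl_eq; [unfold B; cyl | |]; intros; unfold Ah, Bh; cbv beta; field. Qed.
Let Cphi := cyl_cont _ _ _ Lphi.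
Let CA := cyl_cont _ _ _ LA.
Let CB := cyl_cont _ _ _ LB.

Let Ophi : bigO 0 phi.
Proof. apply (bigO_minus 0 (fun t h => v t h - t)); auto. apply L. Qed.
Let OA : bigO 1 A.
Proof.
  apply (bigO_plus 1 (fun t h => a t h - 1)). apply L.
  apply bigO_weaken with (0 + 2); [lra|]. apply (bigO_mult 0 2 (fun _ _ => 2)). apply bigO_const. apply L.
Qed.
Let OB : bigO 1 B.
Proof.
  apply (bigO_minus 1 b). apply L.
  apply bigO_weaken with (0 + 2); [lra|]. apply (bigO_mult 0 2 (fun _ _ => 2)). apply bigO_const. apply L.
Qed.

Let neg (u : R) : R := pos_part (- u).
Let neg_cont (u : R) : continuous neg u.
Proof.
  apply (continuous_comp Ropp pos_part).
  apply (continuous_opp (V := R_NormedModule) (fun u : R => u)). apply continuous_id.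
  apply continuous_pos_part.
Qed.
Let neg_O : bigO 0 (fun t h => neg (phi t h)).
Proof.
  apply bigO_le with (2 := Ophi). intros. unfold neg. rewrite Rabs_pos_eq by apply pos_part_ge_0.
  rewrite <- (Rabs_Ropp (phi t h)). apply pos_part_le_abs.
Qed.
Let dneg2 (u : R) : is_derive (fun u => - neg u ^ 2) u (2 * neg u).
Proof.
  apply is_derive_eq with (- (- 1 * (2 * neg u))); [|ring].
  apply (is_derive_opp (fun u => neg u ^ 2)).
  apply (is_derive_comp (fun u => pos_part u ^ 2) Ropp). apply is_derive_pos_part_sq.
  auto_derive; auto; ring.
Qed.
Let dneg3 (u : R) : is_derive (fun u => neg u ^ 3) u (- 3 * neg u ^ 2).
Proof.
  apply is_derive_eq with (- 1 * (3 * neg u ^ 2)); [|ring].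
  apply (is_derive_comp (fun u => pos_part u ^ 3) Ropp). apply is_derive_pos_part_cube.
  auto_derive; auto; ring.
Qed.

(* Superharmonicity of [phi], in integrated form: the third moment of its negative part is nondecreasing in [t]. *)
Lemma phi_nonneg (t h : R) : t <= 0 -> 0 <= v t h - t - H t h.
Proof.
  assert (Cneg : cont2 (fun t h => neg (phi t h))) by now apply cont2_comp.
  (* One third of the derivative of the third moment. The third power is chosen because its
     derivative is still C^1 in [phi], as [circ_green] requires. *)
  set (K := circ (fun t h => - neg (phi t h) ^ 2 * A t h)).
  assert (HK : forall t, t <= 0 -> 0 <= K t).
  { apply (incr_nonneg K (circ (fun t h => 2 * neg (phi t h) * (A t h ^ 2 + B t h ^ 2)
       + - neg (phi t h) ^ 2 * (At t h + Bh t h)))).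
    - intros; apply circ_continuous; cont2.
    - intros s Hs. apply (circ_green (fun u => - neg u ^ 2) (fun u => 2 * neg u) phi A B At Ah Ah Bh); auto.
      intros u. apply (continuous_mult (fun _ => 2) neg). apply continuous_const. apply neg_cont.
    - intros s _. apply circ_ge_0.
      + apply cont2_plus; cont2; try apply (cyl_cont_t _ _ _ LA); try apply (cyl_cont_h _ _ _ LB).
      + intros k. pose proof (pos_part_ge_0 (- phi s k)) as N. fold (neg (phi s k)) in N.
        apply Rplus_le_le_0_compat.
        * apply Rmult_le_pos; [lra|]. apply Rplus_le_le_0_compat; apply pow2_ge_0.
        * replace (At s k + Bh s k) with (- exp (2 * v s k)) by (unfold At, Bh; field).
          pose proof (exp_pos (2 * v s k)). pose proof (pow2_ge_0 (neg (phi s k))). nra.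
    - apply (circ_small 1); [lra | cont2 |].
      replace 1 with (0 + 0 + 1) by ring. apply (bigO_mult (0 + 0) 1 (fun t h => - neg (phi t h) ^ 2)); auto.
      apply bigO_opp. apply bigO_ext with (fun t h => neg (phi t h) * neg (phi t h)). intros; ring.
      now apply bigO_mult. }
  intros Ht. change (0 <= phi t h).
  assert (Cneg3 : cont2 (fun t h => neg (phi t h) ^ 3)) by cont2.
  assert (Z : neg (phi t h) ^ 3 = 0).
  { apply (circ_zero (fun t h => neg (phi t h) ^ 3) t); auto.
    - intros k. unfold phi. now rewrite (cyl_per _ _ _ Lv), (cyl_per _ _ _ LH).
    - intros k. apply pow_le, pos_part_ge_0.
    - replace 0 with (circ (fun t h => neg (phi t h) ^ 3) 0).
      + apply (incr_upto 0 (circ (fun t h => neg (phi t h) ^ 3)) (fun t => 3 * K t)); try lra.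
        * intros; now apply circ_continuous.
        * intros s Hs. unfold K. rewrite <- circ_scal by cont2.
          eapply is_derive_eq. apply (circ_derive _ _ _ s (cyl_comp (fun u => neg u ^ 3) (fun u => - 3 * neg u ^ 2) phi A B
            dneg3 ltac:(intros u; apply (continuous_mult (fun _ => - 3)); [apply continuous_const |
              apply continuous_ext with (fun u => neg u * neg u); [intros; simpl; now rewrite Rmult_1_r | apply (continuous_mult neg neg); apply neg_cont]]) Lphi) Hs).
          apply circ_ext. intros; ring.
        * intros s Hs. apply Rmult_le_pos; [lra | apply HK; lra].
      + rewrite (circ_ext _ (fun _ _ => 0)). rewrite circ_const; ring.
        intros k. unfold neg, phi, pos_part. rewrite H0. rewrite Rmax_left; [ring | lra]. }
  apply Rnot_lt_le. intros N. assert (Hn : neg (phi t h) = - phi t h).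
  { unfold neg, pos_part. apply Rmax_right. lra. }
  rewrite Hn in Z. assert (0 < (- phi t h) ^ 3) by (apply pow_lt; lra). lra.
Qed.

(** The left side is [phi_t]. Since [phi] vanishes on the circle, a positive slope there would make
    it negative just inside, against [phi_nonneg]. *)
Lemma bdry_flux_nonpos (h : R) : a 0 h - 1 + 2 * x 0 h <= 0.
Proof.
  apply Rnot_lt_le. intros N. change (0 < A 0 h) in N.
  destruct (CA 0 h (mkposreal _ N)) as [d Hd]. simpl in Hd. pose proof (cond_pos d) as Hd0.
  assert (Hn0 : - (d / 2) < 0) by lra.
  destruct (MVT_gen (fun s => phi s h) (- (d / 2)) 0 (fun s => A s h)) as [c [Hc1 Hc2]].
  - rewrite Rmin_left, Rmax_right by lra. intros s Hs. apply (cyl_dt _ _ _ Lphi); lra.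
  - intros s _. apply continuity_pt_filterlim. now apply (cont2_line_t phi).
  - rewrite Rmin_left, Rmax_right in Hc1 by lra.
    assert (0 < A c h).
    { assert (Rabs (A c h - A 0 h) < A 0 h).
      { apply Hd; rewrite ?Rminus_diag, ?Rabs_R0; auto. apply Rabs_lt_between. lra. }
      apply Rabs_lt_between in H1. lra. }
    pose proof (phi_nonneg (- (d / 2)) h ltac:(lra)) as P. change (0 <= phi (- (d / 2)) h) in P.
    assert (phi 0 h = 0) by (unfold phi; rewrite H0; ring). nra.
Qed.

Let j1 (t h : R) : R := (m + 1) * x t h - x1 t h - x t h ^ 2 + y t h ^ 2.
Let j2 (t h : R) : R := (m + 1) * y t h - y1 t h - 2 * x t h * y t h.
Let j1t (t h : R) : R := (m + 1) * x1 t h - x2 t h - 2 * x t h * x1 t h + 2 * y t h * y1 t h.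
Let j2t (t h : R) : R := (m + 1) * y1 t h - y2 t h - 2 * x1 t h * y t h - 2 * x t h * y1 t h.

Let Lj1 : cyl j1 j1t (fun t h => - j2t t h).
Proof. eapply cyl_eq; [unfold j1; cyl | |]; intros; unfold j1t, j2t; cbv beta; ring. Qed.
Let Lj2 : cyl j2 j2t j1t.
Proof. eapply cyl_eq; [unfold j2; cyl | |]; intros; unfold j1t, j2t; cbv beta; ring. Qed.
Let Cj1 := cyl_cont _ _ _ Lj1.
Let Cj2 := cyl_cont _ _ _ Lj2.

Let Oscal (c : R) (f : R -> R -> R) : bigO 2 f -> bigO 2 (fun t h => c * f t h).
Proof. intros Hf. replace 2 with (0 + 2) by ring. apply (bigO_mult 0 2 (fun _ _ => c)); auto. apply bigO_const. Qed.

Let Oj1 : bigO 2 j1.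
Proof.
  pose proof (li_x_O _ _ _ _ _ _ _ _ _ _ L). pose proof (li_y_O _ _ _ _ _ _ _ _ _ _ L).
  apply (bigO_plus 2 (fun t h => (m + 1) * x t h - x1 t h - x t h ^ 2)).
  apply (bigO_minus 2 (fun t h => (m + 1) * x t h - x1 t h)).
  apply (bigO_minus 2 (fun t h => (m + 1) * x t h)); [now apply Oscal | apply L].
  all: apply bigO_weaken with (2 + 2); [lra|].
  apply bigO_ext with (fun t h => x t h * x t h); [intros; ring | now apply bigO_mult].
  apply bigO_ext with (fun t h => y t h * y t h); [intros; ring | now apply bigO_mult].
Qed.

Let Oj2 : bigO 2 j2.
Proof.
  pose proof (li_x_O _ _ _ _ _ _ _ _ _ _ L). pose proof (li_y_O _ _ _ _ _ _ _ _ _ _ L).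
  apply (bigO_minus 2 (fun t h => (m + 1) * y t h - y1 t h)).
  apply (bigO_minus 2 (fun t h => (m + 1) * y t h)); [now apply Oscal | apply L].
  apply bigO_weaken with (2 + 2); [lra|]. apply (bigO_mult 2 2 (fun t h => 2 * x t h)); auto.
Qed.

Lemma mean_x (t : R) : t <= 0 -> circ x t = 0.
Proof.
  apply (circ_mean_zero 2 x x1 (fun t h => - y1 t h) y y1); auto; [lra | apply L].
Qed.

Lemma mean_x2y2 (t : R) : t <= 0 -> circ (fun t h => x t h ^ 2 - y t h ^ 2) t = 0.
Proof.
  pose proof (li_x_O _ _ _ _ _ _ _ _ _ _ L). pose proof (li_y_O _ _ _ _ _ _ _ _ _ _ L).
  eapply (circ_mean_zero 2 _ _ _ (fun t h => 2 * (x t h * y t h))); [lra | | cyl |].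
  - apply (bigO_minus 2); (apply bigO_weaken with (2 + 2); [lra|]).
    apply bigO_ext with (fun t h => x t h * x t h); [intros; ring | now apply bigO_mult].
    apply bigO_ext with (fun t h => y t h * y t h); [intros; ring | now apply bigO_mult].
  - eapply cyl_eq; [cyl | intros; reflexivity | intros; cbv beta; ring].
Qed.

Lemma mean_x1 (t : R) : t <= 0 -> circ x1 t = 0.
Proof. intros Ht. now apply (circ_dh y y1 x1). Qed.

(** The integrand is the real part of the holomorphic [J^2], which vanishes at the centre. Hence
    [j1 = 0] on the circle will force [j2 = 0]. *)
Lemma mean_j2 (t : R) :
  t <= 0 ->
  circ (fun t h => ((m + 1) * x t h - x1 t h - x t h ^ 2 + y t h ^ 2) ^ 2
    - ((m + 1) * y t h - y1 t h - 2 * x t h * y t h) ^ 2) t = 0.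
Proof.
  change (t <= 0 -> circ (fun t h => j1 t h ^ 2 - j2 t h ^ 2) t = 0).
  eapply (circ_mean_zero 2 _ _ _ (fun t h => 2 * (j1 t h * j2 t h))); [lra | | cyl |].
  - apply (bigO_minus 2); (apply bigO_weaken with (2 + 2); [lra|]).
    apply bigO_ext with (fun t h => j1 t h * j1 t h); [intros; ring | now apply bigO_mult].
    apply bigO_ext with (fun t h => j2 t h * j2 t h); [intros; ring | now apply bigO_mult].
  - eapply cyl_eq; [cyl | intros; reflexivity | intros; cbv beta; ring].
Qed.

(** This is [exp phi * exp (- 2 v)], kept as a single exponential so that it factors out of every
    derivative of [X]. *)
Let E (t h : R) : R := exp (v t h - t - H t h - 2 * v t h).
Let X (t h : R) : R := exp (phi t h) + E t h * (A t h ^ 2 + B t h ^ 2).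
(** [P] and [Q] are the partial derivatives of [X], and [P - i Q = - 4 E J (A + i B)]. Consequently
    [|grad X|^2 = 16 |J|^2 E r] with [r = E |grad phi|^2]. *)
Let P (t h : R) : R := - 4 * E t h * (j1 t h * A t h - j2 t h * B t h).
Let Q (t h : R) : R := 4 * E t h * (j1 t h * B t h + j2 t h * A t h).

Let E_exp (t h : R) : exp (phi t h) = exp (2 * v t h) * E t h.
Proof. unfold E, phi. rewrite <- exp_plus. f_equal. ring. Qed.

Let LE : cyl E (fun t h => E t h * (A t h - 2 * a t h)) (fun t h => E t h * (B t h - 2 * b t h)).
Proof. eapply cyl_eq; [unfold E; cyl | |]; intros; unfold E, A, B; cbv beta; ring. Qed.

Let LX : cyl X P Q.
Proof.
  eapply cyl_eq; [unfold X; cyl | |]; intros; cbv beta; rewrite E_exp;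
    unfold P, Q, At, Ah, Bh, j1, j2, A, B; field.
Qed.

Let CE := cyl_cont _ _ _ LE.
Let CX := cyl_cont _ _ _ LX.

(* [X] is the Laplacian of [exp (- phi)], up to a constant, in the flat metric [exp (2 (H + t))]. *)
Lemma subharmonic_flux (k dk : R -> R) (M : R) :
  (forall u, is_derive k u (dk u)) -> (forall u, continuous dk u) ->
  (forall u, 0 <= k u <= M) -> (forall u, 0 <= u -> 0 <= k u + u * dk u) ->
  0 <= circ (fun t h => k (exp (- 2 * v t h) * (a t h - 1 + 2 * x t h) ^ 2)
    * (- 4 * exp (- 2 * v t h)
       * (((m + 1) * x t h - x1 t h - x t h ^ 2 + y t h ^ 2) * (a t h - 1 + 2 * x t h)))) 0.
Proof.
  intros Hk Hdk HM Hsub.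
  assert (Hk1 : forall u, is_derive (fun u => k (u - 1)) u (dk (u - 1))).
  { intros u. apply is_derive_eq with (1 * dk (u - 1)); [|ring].
    apply (is_derive_comp k (fun u => u - 1)); auto. auto_derive; auto; ring. }
  assert (Hdk1 : forall u, continuous (fun u => dk (u - 1)) u).
  { intros u. apply (continuous_comp (fun u : R => u - 1) dk); auto.
    apply (continuous_minus (V := R_NormedModule) (fun u : R => u)). apply continuous_id. apply continuous_const. }
  assert (Ck1 : cont2 (fun t h => k (X t h - 1))).
  { apply (cont2_comp (fun u => k (u - 1))); auto. intros u.
    apply (ex_derive_continuous (V := R_NormedModule) (fun u => k (u - 1))). eexists; apply Hk1. }
  assert (Cdk1 : cont2 (fun t h => dk (X t h - 1))) by now apply (cont2_comp (fun u => dk (u - 1))).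
  assert (LP : cyl P
    (fun t h => - 4 * E t h * ((A t h - 2 * a t h) * (j1 t h * A t h - j2 t h * B t h)
       + (j1t t h * A t h + j1 t h * At t h - j2t t h * B t h - j2 t h * Ah t h)))
    (fun t h => - 4 * E t h * ((B t h - 2 * b t h) * (j1 t h * A t h - j2 t h * B t h)
       + (- j2t t h * A t h + j1 t h * Ah t h - j1t t h * B t h - j2 t h * Bh t h)))).
  { eapply cyl_eq; [unfold P; cyl | |]; intros; cbv beta; ring. }
  assert (LQ : cyl Q
    (fun t h => 4 * E t h * ((A t h - 2 * a t h) * (j1 t h * B t h + j2 t h * A t h)
       + (j1t t h * B t h + j1 t h * Ah t h + j2t t h * A t h + j2 t h * At t h)))
    (fun t h => 4 * E t h * ((B t h - 2 * b t h) * (j1 t h * B t h + j2 t h * A t h)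
       + (- j2t t h * B t h + j1 t h * Bh t h + j1t t h * A t h + j2 t h * Ah t h)))).
  { eapply cyl_eq; [unfold Q; cyl | |]; intros; cbv beta; ring. }
  set (Y := circ (fun t h => k (X t h - 1) * P t h)).
  assert (HY : 0 <= Y 0).
  { eapply (incr_nonneg Y); [| | | | apply Rle_refl].
    - intros; apply circ_continuous, cont2_mult; auto. apply (cyl_cont _ _ _ LP).
    - intros t Ht. apply (circ_green (fun u => k (u - 1)) (fun u => dk (u - 1)) X P Q _ _ _ _ Hk1 Hdk1 LX LP LQ t Ht).
    - intros t Ht. apply circ_ge_0.
      + apply cont2_plus; apply cont2_mult; auto.
        * apply cont2_plus; apply cont2_pow; [apply (cyl_cont _ _ _ LP) | apply (cyl_cont _ _ _ LQ)].
        * apply cont2_plus; [apply (cyl_cont_t _ _ _ LP) | apply (cyl_cont_h _ _ _ LQ)].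
      + intros h.
        (* The Laplacian of [X] is [16 |J|^2 E], the same factor as in [|grad X|^2]. *)
        match goal with |- 0 <= _ + _ * ?l => replace l with (16 * (j1 t h ^ 2 + j2 t h ^ 2) * E t h) end.
        2:{ unfold At, Ah, Bh, j1, j2, j1t, j2t, A, B. field. }
        set (u := X t h - 1).
        set (r := E t h * (A t h ^ 2 + B t h ^ 2)).
        replace (P t h ^ 2 + Q t h ^ 2) with (16 * (j1 t h ^ 2 + j2 t h ^ 2) * E t h * r) by (unfold P, Q, r; ring).
        replace (dk u * (16 * (j1 t h ^ 2 + j2 t h ^ 2) * E t h * r) + k u * (16 * (j1 t h ^ 2 + j2 t h ^ 2) * E t h))
          with (16 * (j1 t h ^ 2 + j2 t h ^ 2) * E t h * (k u + r * dk u)) by ring.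
        assert (HE : 0 < E t h) by apply exp_pos.
        apply Rmult_le_pos.
        { apply Rmult_le_pos; [|lra]. apply Rmult_le_pos; [lra|]. apply Rplus_le_le_0_compat; apply pow2_ge_0. }
        (* Here [u - r = exp phi - 1 >= 0]. If [dk u < 0], then
           [k u + r * dk u >= k u + u * dk u >= 0]; otherwise both terms are nonnegative. *)
        assert (Hr : 0 <= r <= u).
        { split. apply Rmult_le_pos; [lra|]. apply Rplus_le_le_0_compat; apply pow2_ge_0.
          unfold u, X. fold r. pose proof (phi_nonneg t h (Rlt_le _ _ Ht)) as Hp.
          apply exp_le in Hp. rewrite exp_0 in Hp. unfold phi. lra. }
        specialize (HM u). specialize (Hsub u ltac:(lra)). destruct (Rle_dec 0 (dk u)); nra.
    - assert (CP := cyl_cont _ _ _ LP). apply (circ_small 1); [lra | cont2 |].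
      (* Near the centre [k] is bounded, [E] is [O(exp (- 2 t))], [J] is [O(exp (2 t))] and
         [grad phi] is [O(exp t)], so the flux is [O(exp t)]. *)
      apply bigO_weaken with (0 + (0 + - 2 + (2 + 1))); [lra|].
      apply (bigO_mult 0 _ (fun t h => k (X t h - 1)) P).
      { exists M, 0. repeat split; try lra. specialize (HM 0); lra.
        intros t h _. rewrite Rmult_0_l, exp_0, Rmult_1_r, Rabs_pos_eq; apply HM. }
      apply (bigO_mult (0 + - 2) _ (fun t h => - 4 * E t h)).
      + apply (bigO_mult 0 (- 2) (fun _ _ => - 4)). apply bigO_const.
        apply bigO_exp. apply bigO_ext with (fun t h => phi t h + - 2 * (v t h - t)). intros; unfold phi; ring.
        apply bigO_plus; auto. replace 0 with (0 + 0) by ring.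
        apply (bigO_mult 0 0 (fun _ _ => - 2)). apply bigO_const. apply L.
      + apply bigO_minus; now apply bigO_mult. }
  match goal with |- 0 <= ?c => replace c with (Y 0); auto end.
  apply circ_ext. intros h.
  assert (HB0 : B 0 h = 0).
  { unfold B. rewrite (bdry_b m v a b x y x1 y1 x2 y2 Hm L). ring. }
  assert (HE0 : E 0 h = exp (- 2 * v 0 h)) by (unfold E; rewrite H0; f_equal; ring).
  assert (HX0 : X 0 h - 1 = exp (- 2 * v 0 h) * A 0 h ^ 2).
  { unfold X, phi. rewrite HE0, HB0, H0. replace (v 0 h - 0 - v 0 h) with 0 by ring. rewrite exp_0; ring. }
  rewrite HX0. unfold P. rewrite HE0, HB0. unfold A, j1. ring.
Qed.

End Interior.

(** * The boundary argument *)

Section Cutoff.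

Variables (m e0 : R).
Hypothesis Hm : 0 < m.
Hypothesis He0 : 0 < e0.

(* The point of [cut] is that [cut (1 / s) = cut_max - s] as long as [1 / s >= e0], while [cut] is C^1 and vanishes on
   the negative axis. *)
Definition cut_density (e : R) : R := pos_part e * / Rmax e0 e ^ 3.
Definition cut (e : R) : R := RInt cut_density 0 e.
Definition cut_max : R := cut e0 + / e0.

Let max_pos (e : R) : 0 < Rmax e0 e.
Proof. apply Rlt_le_trans with (1 := He0). apply Rmax_l. Qed.

Lemma continuous_Rmax_l (c x : R) : continuous (fun u => Rmax c u) x.
Proof.
  apply continuous_ext with (fun u => c + pos_part (u - c)).
  - intros u. unfold pos_part, Rmax. destruct (Rle_dec 0 (u - c)); destruct (Rle_dec c u); lra.
  - apply (continuous_plus (V := R_NormedModule) (fun _ : R => c)). apply continuous_const.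
    apply (continuous_comp (fun u : R => u - c) pos_part); [|apply continuous_pos_part].
    apply (continuous_minus (V := R_NormedModule) (fun u : R => u)). apply continuous_id. apply continuous_const.
Qed.

Lemma cut_density_continuous (e : R) : continuous cut_density e.
Proof.
  apply (continuous_mult pos_part (fun e => / Rmax e0 e ^ 3)). apply continuous_pos_part.
  apply (continuous_comp (fun e => Rmax e0 e) (fun u => / u ^ 3)). apply continuous_Rmax_l.
  apply (ex_derive_continuous (V := R_NormedModule) (fun u => / u ^ 3)).
  auto_derive. pose proof (max_pos e). assert (0 < Rmax e0 e ^ 3) by now apply pow_lt.
  simpl in *. lra.
Qed.

Lemma cut_density_ge_0 (e : R) : 0 <= cut_density e.
Proof.
  apply Rmult_le_pos. apply pos_part_ge_0. left. apply Rinv_0_lt_compat, pow_lt, max_pos.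
Qed.

Let ex_cut (p q : R) : ex_RInt cut_density p q.
Proof.
  apply (ex_RInt_continuous (V := R_CompleteNormedModule)). intros; apply cut_density_continuous.
Qed.

Lemma cut_is_derive (e : R) : is_derive cut e (cut_density e).
Proof.
  apply (is_derive_RInt cut_density cut 0).
  - exists (mkposreal 1 Rlt_0_1). intros u _.
    apply (RInt_correct (V := R_CompleteNormedModule) cut_density), ex_cut.
  - apply cut_density_continuous.
Qed.

Lemma cut_neg (e : R) : e <= 0 -> cut e = 0.
Proof.
  intros He. unfold cut.
  rewrite (RInt_ext _ (fun _ => 0)).
  - rewrite RInt_const. unfold scal; simpl; unfold mult; simpl. ring.
  - intros u Hu. rewrite Rmin_right, Rmax_left in Hu by lra.
    unfold cut_density, pos_part. rewrite Rmax_left by lra. change (@eq R (0 * / Rmax e0 u ^ 3) 0). ring.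
Qed.

Lemma cut_chasles (p q : R) : cut q = cut p + RInt cut_density p q.
Proof. symmetry. apply (RInt_Chasles cut_density 0 p q); apply ex_cut. Qed.

Lemma cut_le (p q : R) : p <= q -> cut p <= cut q.
Proof.
  intros Hpq. rewrite (cut_chasles p q). assert (0 <= RInt cut_density p q); [|lra].
  apply RInt_ge_0; auto. intros; apply cut_density_ge_0.
Qed.

Lemma cut_lt (p q : R) : p < q -> 0 < q -> cut p < cut q.
Proof.
  intros Hpq Hq. apply Rle_lt_trans with (cut (Rmax 0 p)). apply cut_le, Rmax_r.
  assert (Hr : 0 <= Rmax 0 p < q) by (split; [apply Rmax_l | now apply Rmax_lub_lt]).
  rewrite (cut_chasles (Rmax 0 p) q). assert (0 < RInt cut_density (Rmax 0 p) q); [|lra].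
  apply RInt_gt_0; [lra | | intros; apply cut_density_continuous].
  intros u Hu. unfold cut_density. apply Rmult_lt_0_compat.
  - unfold pos_part. rewrite Rmax_right; lra.
  - apply Rinv_0_lt_compat, pow_lt, max_pos.
Qed.

Lemma cut_ge_0 (e : R) : 0 <= cut e.
Proof. rewrite <- (cut_neg (Rmin 0 e)) by apply Rmin_l. apply cut_le, Rmin_r. Qed.

Lemma cut_tail (e : R) : e0 <= e -> cut e = cut_max - / e.
Proof.
  intros He. rewrite (cut_chasles e0 e). unfold cut_max.
  rewrite (is_RInt_unique cut_density e0 e (- / e - - / e0)); [ring|].
  apply (is_RInt_derive (fun u => - / u)).
  - intros u Hu. rewrite Rmin_left in Hu by lra. unfold cut_density, pos_part.
    rewrite !Rmax_right by lra. auto_derive. lra. field. lra.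
  - intros; apply cut_density_continuous.
Qed.

Lemma cut_le_max (e : R) : cut e <= cut_max.
Proof.
  apply Rle_trans with (cut (Rmax e0 e)). apply cut_le, Rmax_r.
  rewrite cut_tail by apply Rmax_l. pose proof (Rinv_0_lt_compat _ (max_pos e)). lra.
Qed.

(** On the circle [Z = m n s (1 / s - level n)] for [n > 0]; where [level n] is positive, its
    inverse is the threshold [s*(n)]. *)
Definition level (n : R) : R := (n - / n + 2) / m.

Let root (u : R) : R := sqrt (Rmax (1 / 10) u).

Let root_bound (u : R) : 3 / 10 <= root u.
Proof.
  unfold root. apply Rle_trans with (sqrt (1 / 10)).
  - rewrite <- (sqrt_pow2 (3 / 10)) by lra. apply sqrt_le_1_alt. lra.
  - apply sqrt_le_1_alt, Rmax_l.
Qed.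

(* [n * flux_weight (n ^ 2) = cut (level n)]; clamping [u] at [1 / 10] avoids the singularity at 0 without changing
   anything, since [level] is negative there. *)
Definition flux_weight (u : R) : R := cut (level (root u)) * / root u.

Definition flux_weight' (u : R) : R :=
  cut_density (level (root u)) * ((1 + / root u ^ 2) / m) * / (2 * root u ^ 2)
  - cut (level (root u)) * / (2 * root u ^ 3).

(** The positive zero of [level] is [sqrt 2 - 1], slightly above [4 / 10]. *)
Lemma level_neg (n : R) : 0 < n <= 4 / 10 -> level n <= 0.
Proof.
  intros Hn. unfold level. apply Rmult_le_reg_r with m; auto.
  replace ((n - / n + 2) / m * m) with (n - / n + 2) by (field; lra).
  assert (10 / 4 <= / n). { replace (10 / 4) with (/ (4 / 10)) by field. apply Rinv_le_contravar; lra. }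
  lra.
Qed.

Let root_small (u : R) : u <= 16 / 100 -> 0 < root u <= 4 / 10.
Proof.
  intros Hu. split; [pose proof (root_bound u); lra|]. unfold root.
  rewrite <- (sqrt_pow2 (4 / 10)) by lra. apply sqrt_le_1_alt. apply Rmax_lub; lra.
Qed.

Lemma flux_weight_small (u : R) : u <= 16 / 100 -> flux_weight u = 0.
Proof.
  intros Hu. unfold flux_weight. rewrite cut_neg. ring. apply level_neg. now apply root_small.
Qed.

Let flux_weight'_small (u : R) : u <= 16 / 100 -> flux_weight' u = 0.
Proof.
  intros Hu. unfold flux_weight'. pose proof (level_neg _ (root_small u Hu)) as N.
  rewrite cut_neg by auto. unfold cut_density, pos_part. rewrite (Rmax_left 0) by auto. ring.
Qed.

Let level_derive (n : R) : 0 < n -> is_derive level n ((1 + / n ^ 2) / m).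
Proof. intros Hn. unfold level. auto_derive. lra. field. lra. Qed.

Lemma flux_weight_derive (u : R) : is_derive flux_weight u (flux_weight' u).
Proof.
  (* The clamping ends at [1 / 10] and the weight vanishes up to [16 / 100]; a split strictly in
     between leaves a full neighbourhood of [u] in either case. *)
  destruct (Rlt_le_dec u (15 / 100)) as [Hu|Hu].
  - rewrite flux_weight'_small by lra. apply is_derive_ext_loc with (fun _ => 0).
    + destruct (open_lt _ u Hu) as [d Hd]. exists d. intros s Hs. specialize (Hd s Hs).
      symmetry. apply flux_weight_small. lra.
    + apply (is_derive_const 0).
  - assert (Hu1 : 1 / 10 < u) by lra.
    apply is_derive_ext_loc with (fun u => cut (level (sqrt u)) * / sqrt u).
    + destruct (open_gt _ u Hu1) as [d Hd]. exists d. intros s Hs. specialize (Hd s Hs).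
      unfold flux_weight, root. now rewrite Rmax_right by lra.
    + pose proof (root_bound u) as Hr. unfold flux_weight'.
      assert (Er : root u = sqrt u) by (unfold root; now rewrite Rmax_right by lra).
      rewrite Er in *. set (n := sqrt u) in *.
      assert (Dn : is_derive sqrt u (/ (2 * n))).
      { unfold n. auto_derive. lra. field. fold n. lra. }
      assert (Dc : is_derive (fun n => cut (level n) * / n) n
        (cut_density (level n) * ((1 + / n ^ 2) / m) * / n - cut (level n) * / n ^ 2)).
      { apply is_derive_eq with (((1 + / n ^ 2) / m * cut_density (level n)) * / n + cut (level n) * (- / n ^ 2)).
        2: ring.
        apply (is_derive_mult (fun n => cut (level n)) Rinv).
        - apply (is_derive_comp cut level). apply cut_is_derive. apply level_derive; lra.
        - auto_derive. lra. field. lra.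
        - intros; apply Rmult_comm. }
      eapply is_derive_eq. apply (is_derive_comp (fun n => cut (level n) * / n) sqrt u _ _ Dc Dn).
      unfold scal; simpl; unfold mult; simpl. field. lra.
Qed.

Lemma flux_weight'_continuous (u : R) : continuous flux_weight' u.
Proof.
  assert (Cr : continuous root u).
  { apply (continuous_comp (fun u => Rmax (1 / 10) u) sqrt). apply continuous_Rmax_l. apply continuous_sqrt. }
  pose proof (root_bound u) as Hr.
  apply (continuous_comp root (fun n => cut_density (level n) * ((1 + / n ^ 2) / m) * / (2 * n ^ 2)
     - cut (level n) * / (2 * n ^ 3))); auto.
  set (n := root u) in *. assert (Hn : 0 < n) by lra.
  assert (Cl : continuous level n).
  { apply (ex_derive_continuous (V := R_NormedModule) level). eexists; now apply level_derive. }
  assert (P2 : 0 < n ^ 2) by now apply pow_lt. assert (P3 : 0 < n ^ 3) by now apply pow_lt.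
  assert (Cd : forall f : R -> R, ex_derive f n -> continuous f n).
  { intros f. apply (ex_derive_continuous (V := R_NormedModule) f). }
  apply (continuous_minus (fun n => cut_density (level n) * ((1 + / n ^ 2) / m) * / (2 * n ^ 2))).
  - apply (continuous_mult (fun n => cut_density (level n) * ((1 + / n ^ 2) / m))).
    + apply (continuous_mult (fun n => cut_density (level n))).
      * apply (continuous_comp level cut_density); auto. apply cut_density_continuous.
      * apply Cd. auto_derive. simpl in *; repeat split; lra.
    + apply Cd. auto_derive. simpl in *; repeat split; lra.
  - apply (continuous_mult (fun n => cut (level n))).
    + apply (continuous_comp level cut); auto.
      apply (ex_derive_continuous (V := R_NormedModule) cut). eexists; apply cut_is_derive.
    + apply Cd. auto_derive. simpl in *; repeat split; lra.
Qed.

Lemma flux_weight_bound (u : R) : 0 <= flux_weight u <= cut_max * (10 / 3).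
Proof.
  pose proof (root_bound u) as Hr. unfold flux_weight.
  assert (0 < / root u) by (apply Rinv_0_lt_compat; lra).
  assert (/ root u <= 10 / 3).
  { replace (10 / 3) with (/ (3 / 10)) by field. apply Rinv_le_contravar; lra. }
  pose proof (cut_ge_0 (level (root u))). pose proof (cut_le_max (level (root u))).
  split. apply Rmult_le_pos; lra. apply Rmult_le_compat; lra.
Qed.

(** This is the derivative of [u * flux_weight u]. With [n = sqrt u] above the clamped range, that
    product is [n * cut (level n)], built from nonnegative nondecreasing factors. *)
Lemma flux_weight_subharmonic (u : R) : 0 <= u -> 0 <= flux_weight u + u * flux_weight' u.
Proof.
  intros Hu. destruct (Rle_dec u (16 / 100)) as [H|H].
  - rewrite flux_weight_small, flux_weight'_small by auto. lra.
  - pose proof (root_bound u) as Hr. unfold flux_weight, flux_weight'.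
    assert (Er : root u ^ 2 = u).
    { unfold root. rewrite Rmax_right by lra. apply pow2_sqrt; lra. }
    set (n := root u) in *. rewrite <- Er. pose proof (cut_ge_0 (level n)). pose proof (cut_density_ge_0 (level n)).
    assert (Hi : 0 < / n) by (apply Rinv_0_lt_compat; lra).
    replace (cut (level n) * / n + n ^ 2 * (cut_density (level n) * ((1 + / n ^ 2) / m) * / (2 * n ^ 2) - cut (level n) * / (2 * n ^ 3)))
      with (cut (level n) * (/ n * / 2) + cut_density (level n) * ((1 + (/ n) ^ 2) * / m * / 2)) by (field; lra).
    apply Rplus_le_le_0_compat; apply Rmult_le_pos; auto; [lra|].
    pose proof (Rinv_0_lt_compat m Hm). pose proof (pow2_ge_0 (/ n)).
    apply Rmult_le_pos; [|lra]. apply Rmult_le_pos; lra.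
Qed.

Lemma flux_weight_sq (n : R) : 0 < n -> n * flux_weight (n ^ 2) = cut (level n).
Proof.
  intros Hn. destruct (Rle_dec n (4 / 10)) as [H|H].
  - rewrite flux_weight_small by nra. rewrite cut_neg. ring. apply level_neg; lra.
  - unfold flux_weight, root. rewrite Rmax_right by nra. rewrite sqrt_pow2 by lra. field. lra.
Qed.

End Cutoff.

(** * Vanishing of [p] on the circle *)

Section Boundary.

Variables (m : R) (v a b x y x1 y1 x2 y2 : R -> R -> R).
Hypothesis Hm : 1 < m <= 2.
Hypothesis L : liouville m v a b x y x1 y1 x2 y2.
Hypothesis HxO : bigO 3 x.
Hypothesis HyO : bigO 3 y.

Let Lv := li_v _ _ _ _ _ _ _ _ _ _ L.
Let La := li_a _ _ _ _ _ _ _ _ _ _ L.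
Let Lx := li_x _ _ _ _ _ _ _ _ _ _ L.
Let Ly := li_y _ _ _ _ _ _ _ _ _ _ L.
Let Lx1 := li_x1 _ _ _ _ _ _ _ _ _ _ L.
Let Ly1 := li_y1 _ _ _ _ _ _ _ _ _ _ L.
Let Cv := cyl_cont _ _ _ Lv.
Let Ca := cyl_cont _ _ _ La.
Let Cx := cyl_cont _ _ _ Lx.
Let Cy := cyl_cont _ _ _ Ly.
Let Cx1 := cyl_cont _ _ _ Lx1.
Let Cy1 := cyl_cont _ _ _ Ly1.

Let Hm1 : 1 < m.
Proof. lra. Qed.

Let j1 (t h : R) : R := (m + 1) * x t h - x1 t h - x t h ^ 2 + y t h ^ 2.
Let j2 (t h : R) : R := (m + 1) * y t h - y1 t h - 2 * x t h * y t h.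
(** The boundary condition has been used to eliminate [a] from [- phi_t / (2 s)], so that the
    [h]-derivative of [n] involves only [x], [y1], [b] and [v]. *)
Let n (t h : R) : R := (m + 1 - 2 * x t h) * exp (- v t h) - 1.
Let s (t h : R) : R := exp (v t h) / 2.
Let Cj1 : cont2 j1.
Proof. unfold j1; cont2. Qed.
Let Cj2 : cont2 j2.
Proof. unfold j2; cont2. Qed.

Let s_pos (t h : R) : 0 < s t h.
Proof. unfold s. pose proof (exp_pos (v t h)); lra. Qed.

Let exp_opp_v (t h : R) : exp (- v t h) = / (2 * s t h).
Proof. unfold s. rewrite exp_Ropp. f_equal. field. Qed.

Let n_s (h : R) : a 0 h - 1 + 2 * x 0 h = - 2 * s 0 h * n 0 h.
Proof.
  unfold n. rewrite exp_opp_v, (li_bdry _ _ _ _ _ _ _ _ _ _ L).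
  replace (exp (v 0 h)) with (2 * s 0 h) by (unfold s; field). pose proof (s_pos 0 h). field. lra.
Qed.

Let j1_bdry (h : R) : j1 0 h = s 0 h * (m * n 0 h - s 0 h * (n 0 h ^ 2 + 2 * n 0 h - 1)).
Proof.
  unfold j1. rewrite (bdry_x1 m v a b x y x1 y1 x2 y2 Hm1 L), (bdry_b m v a b x y x1 y1 x2 y2 Hm1 L),
    (li_bdry _ _ _ _ _ _ _ _ _ _ L).
  replace (exp (2 * v 0 h)) with (4 * s 0 h ^ 2).
  2:{ unfold s. replace (2 * v 0 h) with (v 0 h + v 0 h) by ring. rewrite exp_plus. field. }
  replace (exp (v 0 h)) with (2 * s 0 h) by (unfold s; field).
  unfold n. rewrite exp_opp_v. pose proof (s_pos 0 h). field. lra.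
Qed.

(** On the circle [K = v], and modulo the [h]-derivative of [y exp (- K)] the integrand is
    [((m + 1) x - |p|^2) exp (- K)]. The spectral gap bounds its integral by [m - 2] times the
    nonnegative first moment. *)
Let bdry_j1_weighted : circ (fun t h => j1 t h * exp (- v t h)) 0 <= 0.
Proof.
  destruct (conformal_factor m v a b x y x1 y1 x2 y2 Hm1 L) as [K [LK [K0 KO]]].
  pose proof (weighted_spectral_gap x y x1 y1 x2 y2 K Lx Ly Lx1 Ly1 LK KO HxO HyO 0 (Rle_refl 0)) as G.
  pose proof (weighted_first_moment_nonneg x y x1 y1 K Lx Ly LK KO HxO 0 (Rle_refl 0)) as N.
  pose proof (cyl_cont _ _ _ LK) as CK.
  assert (Lyw : cyl (fun t h => y t h * exp (- K t h))
    (fun t h => (y1 t h + 2 * x t h * y t h) * exp (- K t h))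
    (fun t h => (x1 t h - 2 * y t h ^ 2) * exp (- K t h))).
  { eapply cyl_eq; [cyl | |]; intros; cbv beta; ring. }
  pose proof (circ_dh _ _ _ 0 Lyw (Rle_refl 0)) as Z.
  rewrite (circ_ext _ (fun t h => (m + 1) * (x t h * exp (- K t h))
    - (x t h ^ 2 + y t h ^ 2) * exp (- K t h) - (x1 t h - 2 * y t h ^ 2) * exp (- K t h)))
    by (intros h; unfold j1; rewrite K0; ring).
  rewrite !circ_minus, circ_scal by cont2. rewrite Z. nra.
Qed.

Let bdry_j1 : circ j1 0 = 0.
Proof.
  rewrite (circ_ext _ (fun t h => (m + 1) * x t h - x1 t h - (x t h ^ 2 - y t h ^ 2)))
    by (intros h; unfold j1; ring).
  rewrite !circ_minus, circ_scal by cont2.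
  rewrite (mean_x m v a b x y x1 y1 x2 y2 L) by lra.
  rewrite (mean_x1 m v a b x y x1 y1 x2 y2 L) by lra.
  pose proof (mean_x2y2 m v a b x y x1 y1 x2 y2 L 0 (Rle_refl 0)) as Z.
  rewrite circ_minus in Z by cont2. lra.
Qed.

(* With [Z = j1 / s] and [s <= sigma], the integral of [Z (cut (1/s) - cut (level n))] is nonpositive: on the range
   of [1/s] the function [cut] is [cut_max - s], [Z] and [Z s] have mean [<= 0] and [= 0], and
   [Z cut (level n)] is the flux of a subharmonic function. But [Z] has the sign of [1/s - level n]. *)
Let j1_bdry_zero (h : R) : j1 0 h = 0 /\ / s 0 h = level m (n 0 h) /\ 0 < n 0 h.
Proof.
  destruct (conformal_factor m v a b x y x1 y1 x2 y2 Hm1 L) as [K [LK [K0 KO]]].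
  assert (Cs : cont2 s).
  { unfold s. apply (cont2_mult (fun t h => exp (v t h)) (fun _ _ => / 2)); cont2. }
  destruct (per_max s 0 Cs) as [h0 Hmax].
  { intros k. unfold s. now rewrite (cyl_per _ _ _ Lv). }
  (* The minimum of [1 / s] on the circle, so that [cut_tail] applies at every [1 / s]. *)
  set (e0 := / s 0 h0). assert (He0 : 0 < e0) by apply Rinv_0_lt_compat, s_pos.
  assert (Hm0 : 0 < m) by lra.
  assert (Hle : forall k, e0 <= / s 0 k).
  { intros k. apply Rinv_le_contravar; auto. }
  assert (F := subharmonic_flux m v a b x y x1 y1 x2 y2 K Hm1 L LK K0 KO (flux_weight m e0) (flux_weight' m e0)
    (cut_max e0 * (10 / 3)) (flux_weight_derive m e0 Hm0 He0) (flux_weight'_continuous m e0 Hm0 He0)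
    (flux_weight_bound m e0 He0) (flux_weight_subharmonic m e0 Hm0 He0)).
  set (flux := fun t h => flux_weight m e0 (exp (- 2 * v t h) * (a t h - 1 + 2 * x t h) ^ 2)
    * (- 4 * exp (- 2 * v t h) * (j1 t h * (a t h - 1 + 2 * x t h)))).
  change (0 <= circ flux 0) in F.
  assert (Cflux : cont2 flux).
  { unfold flux. apply cont2_mult; [|cont2]. apply cont2_comp; [|cont2].
    intros u. apply (ex_derive_continuous (V := R_NormedModule) (flux_weight m e0)).
    eexists; now apply flux_weight_derive. }
  (* On the circle the three terms are [cut_max Z], [Z s] and [Z n flux_weight (n^2)]; their
     integrals are respectively nonpositive, zero and nonnegative. *)
  set (W := fun t h => cut_max e0 * 2 * (j1 t h * exp (- v t h)) - j1 t h - / 2 * flux t h).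
  assert (HN : forall k, 0 <= n 0 k).
  { intros k. pose proof (bdry_flux_nonpos m v a b x y x1 y1 x2 y2 K L LK K0 KO k) as B.
    rewrite n_s in B. pose proof (s_pos 0 k). nra. }
  assert (HW : forall k, W 0 k = (m * n 0 k - s 0 k * (n 0 k ^ 2 + 2 * n 0 k - 1))
     * (cut e0 (/ s 0 k) - n 0 k * flux_weight m e0 (n 0 k ^ 2))).
  { intros k. pose proof (s_pos 0 k) as Sp. rewrite cut_tail by auto. rewrite Rinv_inv. unfold W, flux.
    rewrite n_s, j1_bdry, exp_opp_v.
    replace (exp (- 2 * v 0 k)) with (/ (2 * s 0 k) ^ 2).
    2:{ rewrite <- pow_inv, <- exp_opp_v. replace (- 2 * v 0 k) with (- v 0 k + - v 0 k) by ring. rewrite exp_plus; ring. }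
    replace (/ (2 * s 0 k) ^ 2 * (- 2 * s 0 k * n 0 k) ^ 2) with (n 0 k ^ 2) by (field; lra).
    field. lra. }
  assert (Hsign : forall k, 0 <= W 0 k /\ (W 0 k = 0 -> / s 0 k = level m (n 0 k) /\ 0 < n 0 k)).
  { intros k. pose proof (s_pos 0 k) as Sp. rewrite HW.
    assert (Si : 0 < / s 0 k) by now apply Rinv_0_lt_compat.
    destruct (Rle_lt_or_eq_dec _ _ (HN k)) as [Np|Nz].
    - rewrite flux_weight_sq by auto.
      replace (m * n 0 k - s 0 k * (n 0 k ^ 2 + 2 * n 0 k - 1)) with (m * n 0 k * s 0 k * (/ s 0 k - level m (n 0 k)))
        by (unfold level; field; lra).
      assert (Pp : 0 < m * n 0 k * s 0 k) by (apply Rmult_lt_0_compat; [apply Rmult_lt_0_compat|]; auto).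
      set (q := m * n 0 k * s 0 k) in *.
      destruct (total_order_T (/ s 0 k) (level m (n 0 k))) as [[O|O]|O].
      + assert (Ol := cut_lt e0 He0 _ _ O (Rlt_trans _ _ _ Si O)).
        assert (0 < q * (level m (n 0 k) - / s 0 k)) by (apply Rmult_lt_0_compat; lra). split; nra.
      + rewrite O. split; [lra | split; auto].
      + assert (Ol := cut_lt e0 He0 _ _ O Si).
        assert (0 < q * (/ s 0 k - level m (n 0 k))) by (apply Rmult_lt_0_compat; lra). split; nra.
    (* At [n = 0], where [level] is singular, [W = s * cut (1 / s)] is positive, so this case cannot
       occur when [W] vanishes. *)
    - rewrite <- Nz. pose proof (cut_lt e0 He0 _ _ Si Si) as Cp. rewrite (cut_neg e0 0) in Cp by lra. split; nra. }
  assert (HI : circ W 0 <= 0).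
  { unfold W. rewrite !circ_minus, !circ_scal by cont2. rewrite bdry_j1.
    pose proof bdry_j1_weighted as B1.
    assert (0 <= cut_max e0).
    { apply Rle_trans with (cut e0 0). rewrite cut_neg by lra. lra. now apply cut_le_max. }
    nra. }
  assert (HZ : W 0 h = 0).
  { apply (circ_zero W 0); auto.
    - unfold W; cont2.
    - intros k. unfold W, flux, j1.
      now rewrite (cyl_per _ _ _ Lv), (cyl_per _ _ _ Lx), (cyl_per _ _ _ Ly), (cyl_per _ _ _ Lx1), (cyl_per _ _ _ La).
    - intros k. apply Hsign. }
  destruct (proj2 (Hsign h) HZ) as [E1 E2]. split; auto.
  rewrite j1_bdry. pose proof (s_pos 0 h).
  replace (n 0 h ^ 2 + 2 * n 0 h - 1) with (level m (n 0 h) * (m * n 0 h)) by (unfold level; field; lra).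
  rewrite <- E1. field. lra.
Qed.

(** First [j2 = 0] by [mean_j2]. As [n_h] is a multiple of [j2], [n] is constant; then so is
    [s = 1 / level n], hence [v], hence [x] by the formula for [n]. The mean of [x] is zero, and
    [y = v_h / 2]. *)
Lemma bdry_p_zero (h : R) : x 0 h = 0 /\ y 0 h = 0.
Proof.
  assert (J2 : forall k, j2 0 k = 0).
  { intros k. assert (Z : j2 0 k ^ 2 = 0); [|nra].
    apply (circ_zero (fun t h => j2 t h ^ 2) 0).
    - cont2.
    - intros q. unfold j2. now rewrite (cyl_per _ _ _ Lx), (cyl_per _ _ _ Ly), (cyl_per _ _ _ Ly1).
    - intros; apply pow2_ge_0.
    - pose proof (mean_j2 m v a b x y x1 y1 x2 y2 L 0 (Rle_refl 0)) as Z.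
      change (circ (fun t h => j1 t h ^ 2 - j2 t h ^ 2) 0 = 0) in Z.
      rewrite circ_minus in Z by cont2. rewrite (circ_ext (fun t h => j1 t h ^ 2) (fun _ _ => 0)) in Z.
      + rewrite circ_const in Z. lra.
      + intros q. destruct (j1_bdry_zero q) as [-> _]. ring. }
  assert (Dn : forall k, is_derive (n 0) k 0).
  { intros k.
    assert (Ln : cyl n (fun t h => - 2 * x1 t h * exp (- v t h) + (m + 1 - 2 * x t h) * (exp (- v t h) * - a t h))
      (fun t h => (2 * y1 t h - (m + 1 - 2 * x t h) * b t h) * exp (- v t h))).
    { eapply cyl_eq; [unfold n; cyl | |]; intros; cbv beta; ring. }
    apply is_derive_eq with (1 := cyl_dh _ _ _ Ln 0 k (Rle_refl 0)).
    rewrite (bdry_b m v a b x y x1 y1 x2 y2 Hm1 L).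
    replace (2 * y1 0 k - (m + 1 - 2 * x 0 k) * (2 * y 0 k)) with (- 2 * j2 0 k) by (unfold j2; ring).
    rewrite J2. ring. }
  assert (Cn : forall k, n 0 k = n 0 h).
  { intros k. destruct (MVT_gen (n 0) h k (fun _ => 0)) as [c [_ Hc]].
    - intros; apply Dn.
    - intros q _. apply continuity_pt_filterlim, (ex_derive_continuous (V := R_NormedModule) (n 0)). eexists; apply Dn.
    - lra. }
  assert (Cv0 : forall k, v 0 k = v 0 h).
  { intros k. apply exp_inv. destruct (j1_bdry_zero k) as [_ [E1 _]]. destruct (j1_bdry_zero h) as [_ [E2 _]].
    rewrite Cn, <- E2 in E1. apply Rinv_eq_reg in E1. unfold s in E1. lra. }
  assert (Cx0 : forall k, x 0 k = x 0 h).
  { intros k. pose proof (Cn k) as E. unfold n in E. rewrite Cv0 in E. pose proof (exp_pos (- v 0 h)). nra. }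
  split.
  - pose proof (mean_x m v a b x y x1 y1 x2 y2 L 0 (Rle_refl 0)) as Z.
    rewrite (circ_ext x (fun _ _ => x 0 h)) in Z by auto. rewrite circ_const in Z.
    pose proof two_PI_pos. apply Rmult_integral in Z. destruct Z; lra.
  - assert (D1 : is_derive (v 0) h (b 0 h)) by (apply (cyl_dh _ _ _ Lv); lra).
    assert (D2 : is_derive (v 0) h 0).
    { apply is_derive_ext with (fun _ => v 0 h). intros q; symmetry; apply Cv0. apply (is_derive_const (v 0 h)). }
    apply is_derive_unique in D1. apply is_derive_unique in D2. rewrite D1 in D2.
    rewrite (bdry_b m v a b x y x1 y1 x2 y2 Hm1 L) in D2. lra.
Qed.

(** The derivative of [b exp (- v)] in [t] is [2 m y exp (- v)], which vanishes inside by
    [weighted_rigidity]; on the circle [b = 2 y = 0]. *)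
Lemma liouville_rigidity (t h : R) : t <= 0 -> b t h = 0.
Proof.
  intros Ht. destruct (conformal_factor m v a b x y x1 y1 x2 y2 Hm1 L) as [K [LK [K0 KO]]].
  pose proof (weighted_rigidity x y x1 y1 K Lx Ly LK KO HxO bdry_p_zero) as Z.
  pose proof (li_b _ _ _ _ _ _ _ _ _ _ L) as Lb.
  assert (Lg : cyl (fun t h => b t h * exp (- v t h))
     (fun t h => 2 * m * y t h * exp (- v t h))
     (fun t h => (- exp (2 * v t h) + 4 * m * x t h - a t h ^ 2 + b t h ^ 2 + 1) / 2 * exp (- v t h)
        + b t h * (exp (- v t h) * - b t h))).
  { eapply cyl_eq; [cyl | |]; intros; cbv beta; ring. }
  assert (E : b t h * exp (- v t h) = b 0 h * exp (- v 0 h)).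
  { apply (const_upto_0 (fun t => b t h * exp (- v t h))); try lra.
    - intros q _. apply (cont2_line_t (fun t h => b t h * exp (- v t h))). apply Lg.
    - intros q Hq. apply is_derive_eq with (1 := cyl_dt _ _ _ Lg q h Hq).
      destruct (Z q h Hq) as [_ ->]. ring. }
  rewrite (bdry_b m v a b x y x1 y1 x2 y2 Hm1 L) in E. destruct (bdry_p_zero h) as [_ E2]. rewrite E2 in E.
  pose proof (exp_pos (- v t h)). nra.
Qed.

End Boundary.

(** * Radial solutions *)

Lemma is_derive_zero_loc (f : R -> R) (x l : R) :
  locally x (fun u => f u = 0) -> is_derive f x l -> l = 0.
Proof.
  intros Hl D. assert (D0 : is_derive f x 0).
  { apply is_derive_ext_loc with (fun _ => 0). apply filter_imp with (2 := Hl). auto. apply (is_derive_const 0). }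
  apply is_derive_unique in D. apply is_derive_unique in D0. lra.
Qed.

Section RadialProfile.

Variables (m : R) (v a b x y x1 y1 x2 y2 : R -> R -> R).
Hypothesis Hm : 1 < m.
Hypothesis L : liouville m v a b x y x1 y1 x2 y2.
Hypothesis Hb : forall t h, t <= 0 -> b t h = 0.

Let Lv := li_v _ _ _ _ _ _ _ _ _ _ L.
Let La := li_a _ _ _ _ _ _ _ _ _ _ L.
Let Lb := li_b _ _ _ _ _ _ _ _ _ _ L.
Let Lx := li_x _ _ _ _ _ _ _ _ _ _ L.
Let Ly := li_y _ _ _ _ _ _ _ _ _ _ L.

Let loc_neg (t : R) : t < 0 -> locally t (fun u => u < 0).
Proof. intros Ht. apply (open_lt 0 t Ht). Qed.

Let y_zero (t h : R) : t < 0 -> y t h = 0.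
Proof.
  intros Ht. pose proof (cyl_dt _ _ _ Lb t h Ht) as D. apply is_derive_zero_loc in D.
  - rewrite Hb in D by lra. nra.
  - apply filter_imp with (2 := loc_neg t Ht). intros u Hu. apply Hb; lra.
Qed.

Let x_zero (t h : R) : t <= 0 -> x t h = 0.
Proof.
  intros Ht.
  assert (D0 : forall s, s < 0 -> x1 s h = 0).
  { intros s Hs. apply (is_derive_zero_loc (fun k => y s k) h).
    - exists (mkposreal 1 Rlt_0_1). intros k _. now apply y_zero.
    - apply (cyl_dh _ _ _ Ly); lra. }
  assert (E : forall s, s <= 0 -> x s h = x t h).
  { intros s Hs. apply (const_upto_0 (fun s => x s h)); auto.
    - intros q _. apply (cont2_line_t x). apply Lx.
    - intros q Hq. rewrite <- (D0 q Hq). now apply (cyl_dt _ _ _ Lx). }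
  destruct (Req_dec (x t h) 0) as [Z|Z]; auto. exfalso. apply Rabs_pos_lt in Z.
  destruct (bigO_small 2 x ltac:(lra) (li_x_O _ _ _ _ _ _ _ _ _ _ L) (Rabs (x t h) / 2)) as [T [HT HO]]; [lra|].
  specialize (HO T h (Rle_refl T)). rewrite E in HO by auto. lra.
Qed.

(** Read off from the equation for [b_h] once [b] and [x] vanish. *)
Let energy (t h : R) : t < 0 -> a t h ^ 2 = 1 - exp (2 * v t h).
Proof.
  intros Ht. pose proof (cyl_dh _ _ _ Lb t h (Rlt_le _ _ Ht)) as D. apply is_derive_zero_loc in D.
  - rewrite x_zero, Hb in D by lra. lra.
  - exists (mkposreal 1 Rlt_0_1). intros k _. apply Hb; lra.
Qed.

Let v_indep (t h k : R) : t <= 0 -> v t h = v t k.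
Proof.
  intros Ht. destruct (MVT_gen (v t) h k (b t)) as [c [_ Hc]].
  - intros; now apply (cyl_dh _ _ _ Lv).
  - intros q _. apply continuity_pt_filterlim. apply cont2_line_h, Lv.
  - rewrite Hb in Hc by auto. lra.
Qed.

(** In the radial case [f = exp (- v)] solves [f'' = f] in [t]. This first integral is
    [(f - f') exp t]; the next one is [(f + f') exp (- t)]. *)
Let c1 (h t : R) : t <= 0 -> (1 + a t h) * exp (t - v t h) = (1 + a 0 h) * exp (- v 0 h).
Proof.
  intros Ht.
  assert (Lc : cyl (fun t h => (1 + a t h) * exp (t - v t h))
    (fun t h => ((- exp (2 * v t h) - 4 * m * x t h + a t h ^ 2 - b t h ^ 2 - 1) / 2
        + (1 + a t h) * (1 - a t h)) * exp (t - v t h))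
    (fun t h => (2 * m * y t h + a t h * b t h - (1 + a t h) * b t h) * exp (t - v t h))).
  { eapply cyl_eq; [cyl | |]; intros; cbv beta; field. }
  rewrite (const_upto_0 (fun t => (1 + a t h) * exp (t - v t h))) with (t := 0); auto; try lra.
  - f_equal. f_equal. ring.
  - intros q _. apply (cont2_line_t (fun t h => (1 + a t h) * exp (t - v t h))). apply Lc.
  - intros q Hq. apply is_derive_eq with (1 := cyl_dt _ _ _ Lc q h Hq).
    rewrite x_zero, Hb by lra. pose proof (energy q h Hq). replace (exp (2 * v q h)) with (1 - a q h ^ 2) by lra. field.
Qed.

Let c2 (h t : R) : t <= 0 -> (1 - a t h) * exp (- t - v t h) = (1 - a 0 h) * exp (- v 0 h).
Proof.
  intros Ht.
  assert (Lc : cyl (fun t h => (1 - a t h) * exp (- t - v t h))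
    (fun t h => (- ((- exp (2 * v t h) - 4 * m * x t h + a t h ^ 2 - b t h ^ 2 - 1) / 2)
        + (1 - a t h) * (- 1 - a t h)) * exp (- t - v t h))
    (fun t h => (- (2 * m * y t h + a t h * b t h) - (1 - a t h) * b t h) * exp (- t - v t h))).
  { eapply cyl_eq; [cyl | |]; intros; cbv beta; field. }
  rewrite (const_upto_0 (fun t => (1 - a t h) * exp (- t - v t h))) with (t := 0); auto; try lra.
  - f_equal. f_equal. ring.
  - intros q _. apply (cont2_line_t (fun t h => (1 - a t h) * exp (- t - v t h))). apply Lc.
  - intros q Hq. apply is_derive_eq with (1 := cyl_dt _ _ _ Lc q h Hq).
    rewrite x_zero, Hb by lra. pose proof (energy q h Hq). replace (exp (2 * v q h)) with (1 - a q h ^ 2) by lra. field.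
Qed.

(** The first integrals give [2 exp (- v) = c exp (- t) + d exp t], and [energy] gives [c d = 1].
    Hence [r = 1 / c = d], and the boundary condition becomes the quadratic equation. *)
Lemma radial_profile :
  exists r, 0 < r /\ (m - 1) * r ^ 2 - 2 * r + (m + 1) = 0 /\
    forall t h, t <= 0 -> v t h = t + ln (2 * r / (1 + r ^ 2 * exp t ^ 2)).
Proof.
  set (c := (1 + a 0 0) * exp (- v 0 0)). set (d := (1 - a 0 0) * exp (- v 0 0)).
  assert (Ha0 : forall h, a 0 h = a 0 0).
  { intros h. rewrite !(li_bdry _ _ _ _ _ _ _ _ _ _ L). now rewrite (v_indep 0 h 0) by lra. }
  assert (E1 : forall t h, t <= 0 -> (1 + a t h) * exp (t - v t h) = c).
  { intros t h Ht. rewrite c1 by auto. unfold c. rewrite Ha0. now rewrite (v_indep 0 h 0) by lra. }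
  assert (E2 : forall t h, t <= 0 -> (1 - a t h) * exp (- t - v t h) = d).
  { intros t h Ht. rewrite c2 by auto. unfold d. rewrite Ha0. now rewrite (v_indep 0 h 0) by lra. }
  assert (Hcd : c * d = 1).
  { rewrite <- (E1 (- 1) 0), <- (E2 (- 1) 0) by lra.
    assert (En := energy (- 1) 0). specialize (En ltac:(lra)).
    replace ((1 + a (-1) 0) * exp (-1 - v (-1) 0) * ((1 - a (-1) 0) * exp (- -1 - v (-1) 0)))
      with ((1 - a (- 1) 0 ^ 2) * (exp (-1 - v (-1) 0) * exp (- -1 - v (-1) 0))) by ring.
    rewrite En. replace (1 - (1 - exp (2 * v (- 1) 0))) with (exp (2 * v (- 1) 0)) by ring.
    rewrite <- !exp_plus.
    match goal with |- exp ?e = 1 => replace e with 0 by ring end. apply exp_0. }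
  assert (Hsum : forall t h, t <= 0 -> c * exp (- t) + d * exp t = 2 * exp (- v t h)).
  { intros t h Ht. rewrite <- (E1 t h Ht), <- (E2 t h Ht).
    replace (t - v t h) with (- v t h + t) by ring. replace (- t - v t h) with (- v t h + - t) by ring.
    rewrite !exp_plus. rewrite exp_Ropp with (x := t). pose proof (exp_pos t). field. lra. }
  assert (Hc : 0 < c).
  { apply Rnot_le_lt. intros Hc. assert (d < 0) by nra.
    pose proof (Hsum 0 0 (Rle_refl 0)) as S. rewrite Ropp_0, exp_0 in S. pose proof (exp_pos (- v 0 0)). nra. }
  assert (Hd : d = / c) by (apply Rmult_eq_reg_l with c; [rewrite Hcd; field|]; lra).
  assert (Hv : forall t h, t <= 0 -> exp (v t h) = 2 * / c * exp t / (1 + (/ c) ^ 2 * exp t ^ 2)).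
  { intros t h Ht. pose proof (Hsum t h Ht) as S. rewrite Hd in S.
    rewrite !exp_Ropp in S. pose proof (exp_pos t) as Pt. pose proof (exp_pos (v t h)) as Pv.
    assert (Hden : 0 < 1 + (/ c) ^ 2 * exp t ^ 2).
    { assert (0 <= ((/ c) * exp t) ^ 2) by apply pow2_ge_0. rewrite Rpow_mult_distr in H. lra. }
    rewrite <- (Rinv_inv (exp (v t h))).
    replace (/ exp (v t h)) with ((c * / exp t + / c * exp t) / 2) by lra.
    field. repeat split; try lra; nra. }
  exists (/ c). split; [now apply Rinv_0_lt_compat | split].
  - pose proof (Hv 0 0 (Rle_refl 0)) as V0. rewrite exp_0 in V0.
    assert (Hc0 : c = (1 + a 0 0) * / exp (v 0 0)) by (unfold c; now rewrite exp_Ropp).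
    pose proof (li_bdry _ _ _ _ _ _ _ _ _ _ L 0) as B. pose proof (exp_pos (v 0 0)) as Pv.
    assert (Q : c * exp (v 0 0) = 1 + exp (v 0 0) - m) by (rewrite Hc0 at 1; rewrite B; field; lra).
    rewrite V0 in Q.
    assert (Hden : 0 < 1 + (/ c) ^ 2) by (pose proof (pow2_ge_0 (/ c)); lra).
    apply Rmult_eq_compat_r with (r := 1 + (/ c) ^ 2) in Q.
    replace (c * (2 * / c * 1 / (1 + (/ c) ^ 2 * 1 ^ 2)) * (1 + (/ c) ^ 2)) with 2 in Q.
    2:{ field. split; [lra|]. nra. }
    replace ((1 + 2 * / c * 1 / (1 + (/ c) ^ 2 * 1 ^ 2) - m) * (1 + (/ c) ^ 2))
      with ((1 - m) * (1 + (/ c) ^ 2) + 2 * / c) in Q.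
    2:{ field. split; [lra|]. nra. }
    lra.
  - intros t h Ht. rewrite <- (ln_exp (v t h)), Hv by auto.
    pose proof (exp_pos t) as Pt. pose proof (Rinv_0_lt_compat _ Hc) as Pc.
    assert (Hden : 0 < 1 + (/ c) ^ 2 * exp t ^ 2).
    { assert (0 <= ((/ c) * exp t) ^ 2) by apply pow2_ge_0. rewrite Rpow_mult_distr in H. lra. }
    replace (2 * / c * exp t / (1 + (/ c) ^ 2 * exp t ^ 2)) with
      (exp t * (2 * / c / (1 + (/ c) ^ 2 * exp t ^ 2))) by (field; split; [lra | nra]).
    rewrite ln_mult, ln_exp; auto. apply Rdiv_lt_0_compat; lra.
Qed.

End RadialProfile.

(** * Smooth functions on the disk *)

Lemma derive_plus (f g : R -> R) (x df dg : R) :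
  is_derive f x df -> is_derive g x dg -> is_derive (fun x => f x + g x) x (df + dg).
Proof. apply (is_derive_plus f g x df dg). Qed.

Lemma derive_mult (f g : R -> R) (x df dg : R) :
  is_derive f x df -> is_derive g x dg -> is_derive (fun x => f x * g x) x (df * g x + f x * dg).
Proof. intros Hf Hg. apply (is_derive_mult f g x df dg Hf Hg). intros; apply Rmult_comm. Qed.

Lemma derive_const (c x : R) : is_derive (fun _ => c) x 0.
Proof. apply (is_derive_const c). Qed.

Lemma derive_opp_exp2 (f : R -> R) (x df : R) :
  is_derive f x df -> is_derive (fun x => - exp (2 * f x)) x (- 2 * df * exp (2 * f x)).
Proof.
  intros Hf. apply is_derive_eq with (- (2 * df * exp (2 * f x))); [|ring].
  apply (is_derive_opp (fun x => exp (2 * f x))).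
  apply (is_derive_comp exp (fun x => 2 * f x)). apply is_derive_exp. now apply (is_derive_scal f).
Qed.

Lemma Cmod_lt_1 (z : C) : Cmod z < 1 <-> fst z ^ 2 + snd z ^ 2 < 1.
Proof.
  unfold Cmod. split; intros H.
  - apply Rnot_le_lt. intros N. apply sqrt_le_1_alt in N. rewrite sqrt_1 in N. lra.
  - rewrite <- sqrt_1. apply sqrt_lt_1_alt. split; auto. nra.
Qed.

Lemma Cmod_le_1 (z : C) : Cmod z <= 1 <-> fst z ^ 2 + snd z ^ 2 <= 1.
Proof.
  unfold Cmod. split; intros H.
  - apply Rnot_lt_le. intros N. assert (1 < sqrt (fst z ^ 2 + snd z ^ 2)); [|lra].
    rewrite <- sqrt_1 at 1. apply sqrt_lt_1_alt. lra.
  - rewrite <- sqrt_1. now apply sqrt_le_1_alt.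
Qed.

Lemma disk_open_2d (p q : R) : unit_disk (p, q) -> locally_2d (fun u v => unit_disk (u, v)) p q.
Proof.
  intros Hz. assert (C : continuity_2d_pt (fun u v => 1 - (u * u + v * v)) p q).
  { assert (K : cont2 (fun u v => 1 - (u * u + v * v))) by cont2. apply K. }
  apply Cmod_lt_1 in Hz. simpl in Hz. assert (Hpos : 0 < 1 - (p * p + q * q)) by lra.
  destruct (C (mkposreal _ Hpos)) as [d Hd]. exists d. intros u v Hu Hv.
  specialize (Hd u v Hu Hv). simpl in Hd. apply Rabs_lt_between in Hd.
  apply Cmod_lt_1. simpl. lra.
Qed.

Lemma disk_open_h (p q : R) : unit_disk (p, q) -> locally p (fun u => unit_disk (u, q)).
Proof.
  intros Hz. destruct (disk_open_2d p q Hz) as [d Hd]. exists d. intros u Hu. apply Hd; auto.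
  rewrite Rminus_diag, Rabs_R0. apply cond_pos.
Qed.

Lemma disk_open_v (p q : R) : unit_disk (p, q) -> locally q (fun v => unit_disk (p, v)).
Proof.
  intros Hz. destruct (disk_open_2d p q Hz) as [d Hd]. exists d. intros u Hu. apply Hd; auto.
  rewrite Rminus_diag, Rabs_R0. apply cond_pos.
Qed.

Lemma d1_ext (f g : C -> R) (z : C) :
  (forall w, unit_disk w -> f w = g w) -> unit_disk z -> d1 f z = d1 g z.
Proof.
  intros E Hz. destruct z as [p q]. apply Derive_ext_loc.
  apply filter_imp with (2 := disk_open_h p q Hz). intros u Hu. now apply E.
Qed.

Lemma d2_ext (f g : C -> R) (z : C) :
  (forall w, unit_disk w -> f w = g w) -> unit_disk z -> d2 f z = d2 g z.
Proof.
  intros E Hz. destruct z as [p q]. apply Derive_ext_loc.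
  apply filter_imp with (2 := disk_open_v p q Hz). intros u Hu. now apply E.
Qed.

Lemma ex_d1_ext (f g : C -> R) (z : C) :
  (forall w, unit_disk w -> f w = g w) -> unit_disk z -> ex_d1 f z -> ex_d1 g z.
Proof.
  intros E Hz. destruct z as [p q]. apply ex_derive_ext_loc.
  apply filter_imp with (2 := disk_open_h p q Hz). intros u Hu. now apply E.
Qed.

Lemma ex_d2_ext (f g : C -> R) (z : C) :
  (forall w, unit_disk w -> f w = g w) -> unit_disk z -> ex_d2 f z -> ex_d2 g z.
Proof.
  intros E Hz. destruct z as [p q]. apply ex_derive_ext_loc.
  apply filter_imp with (2 := disk_open_v p q Hz). intros u Hu. now apply E.
Qed.

Lemma extends_ext (f g : C -> R) :
  (forall w, unit_disk w -> f w = g w) -> extends_continuously f -> extends_continuously g.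
Proof.
  intros E [k [Hk Ck]]. exists k; split; auto. intros z Hz. rewrite <- E; auto.
Qed.

Lemma extends_plus (f g : C -> R) :
  extends_continuously f -> extends_continuously g -> extends_continuously (fun z => f z + g z).
Proof.
  intros [k [Hk Ck]] [l [Hl Cl]]. exists (fun z => k z + l z). split.
  - intros z Hz. rewrite Hk, Hl; auto.
  - intros z Hz. apply (filterlim_comp_2 (F := within closed_disk (locally z)) k l Rplus (G := locally (k z)) (H := locally (l z))).
    + now apply Ck.
    + now apply Cl.
    + apply (filterlim_plus (V := R_NormedModule)).
Qed.

Lemma extends_mult (f g : C -> R) :
  extends_continuously f -> extends_continuously g -> extends_continuously (fun z => f z * g z).
Proof.
  intros [k [Hk Ck]] [l [Hl Cl]]. exists (fun z => k z * l z). split.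
  - intros z Hz. rewrite Hk, Hl; auto.
  - intros z Hz. apply (filterlim_comp_2 (F := within closed_disk (locally z)) k l Rmult (G := locally (k z)) (H := locally (l z))).
    + now apply Ck.
    + now apply Cl.
    + apply (filterlim_mult (K := R_AbsRing)).
Qed.

Lemma extends_const (c : R) : extends_continuously (fun _ => c).
Proof. exists (fun _ => c). split; auto. intros z _. apply filterlim_const. Qed.

Lemma Ck_ext (k : nat) : forall f g : C -> R,
  (forall w, unit_disk w -> f w = g w) -> Ck_up_to_boundary k f -> Ck_up_to_boundary k g.
Proof.
  induction k as [|k IH]; intros f g E [He Hk]; split; try (now apply extends_ext with f); auto.
  destruct Hk as [Hx [H1 H2]]. split; [|split].
  - intros z Hz. destruct (Hx z Hz). split; [now apply ex_d1_ext with f | now apply ex_d2_ext with f].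
  - apply IH with (d1 f); auto. intros; now apply d1_ext.
  - apply IH with (d2 f); auto. intros; now apply d2_ext.
Qed.

Lemma Ck_pred (k : nat) : forall f : C -> R, Ck_up_to_boundary (S k) f -> Ck_up_to_boundary k f.
Proof.
  induction k as [|k IH]; intros f [He [Hx [H1 H2]]]; split; auto.
Qed.

Lemma Ck_plus (k : nat) : forall f g : C -> R,
  Ck_up_to_boundary k f -> Ck_up_to_boundary k g -> Ck_up_to_boundary k (fun z => f z + g z).
Proof.
  induction k as [|k IH]; intros f g [Fe Fk] [Ge Gk]; (split; [now apply extends_plus|]); [exact I|].
  destruct Fk as [Fx [F1 F2]]. destruct Gk as [Gx [G1 G2]]. split; [|split].
  - intros [p q] Hz. destruct (Fx _ Hz) as [[f1 Hf1] [f2 Hf2]]. destruct (Gx _ Hz) as [[g1 Hg1] [g2 Hg2]].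
    split; [exists (f1 + g1) | exists (f2 + g2)].
    + exact (derive_plus (fun s => f (s, q)) (fun s => g (s, q)) p f1 g1 Hf1 Hg1).
    + exact (derive_plus (fun s => f (p, s)) (fun s => g (p, s)) q f2 g2 Hf2 Hg2).
  - apply Ck_ext with (fun z => d1 f z + d1 g z); [|now apply IH]. intros [p q] Hz. symmetry.
    exact (Derive_plus (fun s => f (s, q)) (fun s => g (s, q)) p (proj1 (Fx _ Hz)) (proj1 (Gx _ Hz))).
  - apply Ck_ext with (fun z => d2 f z + d2 g z); [|now apply IH]. intros [p q] Hz. symmetry.
    exact (Derive_plus (fun s => f (p, s)) (fun s => g (p, s)) q (proj2 (Fx _ Hz)) (proj2 (Gx _ Hz))).
Qed.

Lemma Ck_mult (k : nat) : forall f g : C -> R,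
  Ck_up_to_boundary k f -> Ck_up_to_boundary k g -> Ck_up_to_boundary k (fun z => f z * g z).
Proof.
  induction k as [|k IH]; intros f g HF HG; pose proof HF as [Fe Fk]; pose proof HG as [Ge Gk];
    (split; [now apply extends_mult|]); [exact I|].
  destruct Fk as [Fx [F1 F2]]. destruct Gk as [Gx [G1 G2]].
  apply Ck_pred in HF. apply Ck_pred in HG. split; [|split].
  - intros [p q] Hz. destruct (Fx _ Hz) as [[f1 Hf1] [f2 Hf2]]. destruct (Gx _ Hz) as [[g1 Hg1] [g2 Hg2]].
    split; [exists (f1 * g (p, q) + f (p, q) * g1) | exists (f2 * g (p, q) + f (p, q) * g2)].
    + exact (derive_mult (fun s => f (s, q)) (fun s => g (s, q)) p f1 g1 Hf1 Hg1).
    + exact (derive_mult (fun s => f (p, s)) (fun s => g (p, s)) q f2 g2 Hf2 Hg2).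
  - apply Ck_ext with (fun z => d1 f z * g z + f z * d1 g z); [|apply Ck_plus; now apply IH]. intros [p q] Hz. symmetry.
    exact (Derive_mult (fun s => f (s, q)) (fun s => g (s, q)) p (proj1 (Fx _ Hz)) (proj1 (Gx _ Hz))).
  - apply Ck_ext with (fun z => d2 f z * g z + f z * d2 g z); [|apply Ck_plus; now apply IH]. intros [p q] Hz. symmetry.
    exact (Derive_mult (fun s => f (p, s)) (fun s => g (p, s)) q (proj2 (Fx _ Hz)) (proj2 (Gx _ Hz))).
Qed.

Lemma Ck_const (k : nat) : forall c : R, Ck_up_to_boundary k (fun _ => c).
Proof.
  induction k as [|k IH]; intros c; (split; [apply extends_const|]); [exact I|].
  split; [|split].
  - intros z _. split; exists 0; apply (derive_const c).
  - apply Ck_ext with (fun _ => 0); auto. intros w _. symmetry. exact (Derive_const c (Re w)).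
  - apply Ck_ext with (fun _ => 0); auto. intros w _. symmetry. exact (Derive_const c (Im w)).
Qed.

Definition smooth (f : C -> R) : Prop := forall k, Ck_up_to_boundary k f.

Lemma smooth_d1 (f : C -> R) : smooth f -> smooth (d1 f).
Proof. intros Hf k. apply (Hf (S k)). Qed.

Lemma smooth_d2 (f : C -> R) : smooth f -> smooth (d2 f).
Proof. intros Hf k. apply (Hf (S k)). Qed.

Lemma smooth_plus (f g : C -> R) : smooth f -> smooth g -> smooth (fun z => f z + g z).
Proof. intros Hf Hg k. now apply Ck_plus. Qed.

Lemma smooth_mult (f g : C -> R) : smooth f -> smooth g -> smooth (fun z => f z * g z).
Proof. intros Hf Hg k. now apply Ck_mult. Qed.

Lemma smooth_const (c : R) : smooth (fun _ => c).
Proof. intros k. apply Ck_const. Qed.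

Lemma smooth_is_derive_1 (f : C -> R) (p q : R) :
  smooth f -> unit_disk (p, q) -> is_derive (fun s : R => f (s, q)) p (d1 f (p, q)).
Proof. intros Hf Hz. destruct (Hf 1%nat) as [_ [Hx _]]. apply (Derive_correct (fun s => f (s, q))), (Hx (p, q) Hz). Qed.

Lemma smooth_is_derive_2 (f : C -> R) (p q : R) :
  smooth f -> unit_disk (p, q) -> is_derive (fun s : R => f (p, s)) q (d2 f (p, q)).
Proof. intros Hf Hz. destruct (Hf 1%nat) as [_ [Hx _]]. apply (Derive_correct (fun s => f (p, s))), (Hx (p, q) Hz). Qed.

Lemma smooth_continuous (f : C -> R) (p q : R) :
  smooth f -> unit_disk (p, q) -> continuity_2d_pt (fun u v => f (u, v)) p q.
Proof.
  intros Hf Hz. destruct (Hf 0%nat) as [[g [Hg Cg]] _].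
  apply continuity_2d_pt_ext_loc with (fun u v => g (u, v)).
  { destruct (disk_open_2d p q Hz) as [d Hd]. exists d. intros; apply Hg, Hd; auto. }
  apply continuity_2d_pt_filterlim.
  apply filterlim_ext with g. { intros [? ?]; reflexivity. }
  intros P HP. specialize (Cg (p, q) (Rlt_le _ _ Hz) P HP).
  pose proof (proj1 (locally_2d_locally _ p q) (disk_open_2d p q Hz)) as Hloc.
  unfold filtermap, within in *. generalize (filter_and _ _ Cg Hloc). apply filter_imp.
  intros [u v] [H1 H2]. apply H1. left. apply H2.
Qed.

Lemma smooth_d12 (f : C -> R) (z : C) : smooth f -> unit_disk z -> d1 (d2 f) z = d2 (d1 f) z.
Proof.
  intros Hf Hz. destruct z as [p q].
  pose proof (smooth_d1 f Hf) as H1. pose proof (smooth_d2 f Hf) as H2.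
  apply (Schwarz (fun u v => f (u, v)) p q).
  - destruct (disk_open_2d p q Hz) as [d Hd]. exists d. intros u v Hu Hv. specialize (Hd u v Hu Hv).
    repeat split.
    + eexists; now apply smooth_is_derive_1.
    + eexists; now apply smooth_is_derive_2.
    + eexists; apply (smooth_is_derive_1 (d2 f) u v H2 Hd).
    + eexists; apply (smooth_is_derive_2 (d1 f) u v H1 Hd).
  - apply (smooth_continuous (d1 (d2 f)) p q); auto. now apply smooth_d1.
  - apply (smooth_continuous (d2 (d1 f)) p q); auto. now apply smooth_d2.
Qed.

Lemma smooth_differentiable (f : C -> R) (p q : R) :
  smooth f -> unit_disk (p, q) ->
  differentiable_pt_lim (fun u v => f (u, v)) p q (d1 f (p, q)) (d2 f (p, q)).
Proof.
  intros Hf Hz. apply filterdiff_differentiable_pt_lim.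
  apply (is_derive_filterdiff (fun u v => f (u, v)) p q (fun u v => d1 f (u, v)) (d2 f (p, q))).
  - apply (proj1 (locally_2d_locally (fun u v => is_derive (fun z => f (z, v)) u (d1 f (u, v))) p q)).
    destruct (disk_open_2d p q Hz) as [d Hd]. exists d. intros u v Hu Hv. apply smooth_is_derive_1; auto.
  - now apply smooth_is_derive_2.
  - apply (proj1 (continuity_2d_pt_filterlim (fun u v => d1 f (u, v)) p q)).
    apply smooth_continuous; auto. now apply smooth_d1.
Qed.

(* Real and imaginary parts of [u_zz - u_z ^ 2]. *)
Definition hopf_re (u : C -> R) (z : C) : R :=
  (/ 4 * (d1 (d1 u) z + - 1 * d2 (d2 u) z)) + / 4 * (- 1 * (d1 u z * d1 u z) + d2 u z * d2 u z).
Definition hopf_im (u : C -> R) (z : C) : R :=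
  - / 2 * d2 (d1 u) z + / 2 * (d1 u z * d2 u z).

Lemma smooth_hopf_re (u : C -> R) : smooth u -> smooth (hopf_re u).
Proof.
  intros Hu. unfold hopf_re.
  repeat first [apply smooth_plus | apply smooth_mult | apply smooth_const | assumption | apply smooth_d1 | apply smooth_d2].
Qed.

Lemma smooth_hopf_im (u : C -> R) : smooth u -> smooth (hopf_im u).
Proof.
  intros Hu. unfold hopf_im.
  repeat first [apply smooth_plus | apply smooth_mult | apply smooth_const | assumption | apply smooth_d1 | apply smooth_d2].
Qed.

(** * Holomorphy of [u_zz - u_z^2] *)

Section Hopf.

Variable u : C -> R.
Hypothesis Hu : smooth u.
Hypothesis Hliou : forall z, unit_disk z -> - laplacian u z = exp (2 * u z).

Let S1 := smooth_d1 u Hu.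
Let S2 := smooth_d2 u Hu.
Let S11 := smooth_d1 _ S1.
Let S21 := smooth_d2 _ S1.
Let S22 := smooth_d2 _ S2.

Let lap (z : C) : unit_disk z -> d1 (d1 u) z + d2 (d2 u) z = - exp (2 * u z).
Proof. intros Hz. pose proof (Hliou z Hz) as H. unfold laplacian in H. lra. Qed.

Let lap_d1 (p q : R) : unit_disk (p, q) ->
  d1 (d1 (d1 u)) (p, q) + d1 (d2 (d2 u)) (p, q) = - 2 * d1 u (p, q) * exp (2 * u (p, q)).
Proof.
  intros Hz.
  assert (D : is_derive (fun s => d1 (d1 u) (s, q) + d2 (d2 u) (s, q)) p
    (d1 (d1 (d1 u)) (p, q) + d1 (d2 (d2 u)) (p, q))).
  { apply (is_derive_plus (fun s => d1 (d1 u) (s, q)) (fun s => d2 (d2 u) (s, q)));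
      now apply smooth_is_derive_1. }
  assert (D' : is_derive (fun s => d1 (d1 u) (s, q) + d2 (d2 u) (s, q)) p
    (- 2 * d1 u (p, q) * exp (2 * u (p, q)))).
  { apply is_derive_ext_loc with (fun s => - exp (2 * u (s, q))).
    - apply filter_imp with (2 := disk_open_h p q Hz). intros s Hs. symmetry. now apply lap.
    - apply (derive_opp_exp2 (fun s => u (s, q)) p). now apply smooth_is_derive_1. }
  apply is_derive_unique in D. apply is_derive_unique in D'. rewrite D in D'. auto.
Qed.

Let lap_d2 (p q : R) : unit_disk (p, q) ->
  d2 (d1 (d1 u)) (p, q) + d2 (d2 (d2 u)) (p, q) = - 2 * d2 u (p, q) * exp (2 * u (p, q)).
Proof.
  intros Hz.
  assert (D : is_derive (fun s => d1 (d1 u) (p, s) + d2 (d2 u) (p, s)) q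
    (d2 (d1 (d1 u)) (p, q) + d2 (d2 (d2 u)) (p, q))).
  { apply (is_derive_plus (fun s => d1 (d1 u) (p, s)) (fun s => d2 (d2 u) (p, s)));
      now apply smooth_is_derive_2. }
  assert (D' : is_derive (fun s => d1 (d1 u) (p, s) + d2 (d2 u) (p, s)) q
    (- 2 * d2 u (p, q) * exp (2 * u (p, q)))).
  { apply is_derive_ext_loc with (fun s => - exp (2 * u (p, s))).
    - apply filter_imp with (2 := disk_open_v p q Hz). intros s Hs. symmetry. now apply lap.
    - apply (derive_opp_exp2 (fun s => u (p, s)) q). now apply smooth_is_derive_2. }
  apply is_derive_unique in D. apply is_derive_unique in D'. rewrite D in D'. auto.
Qed.

Let hopf_re_d1 (p q : R) : unit_disk (p, q) ->
  d1 (hopf_re u) (p, q) = (d1 (d1 (d1 u)) (p, q) - d1 (d2 (d2 u)) (p, q)) / 4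
    - d1 u (p, q) * d1 (d1 u) (p, q) / 2 + d2 u (p, q) * d1 (d2 u) (p, q) / 2.
Proof.
  intros Hz.
  pose proof (smooth_is_derive_1 _ p q S1 Hz) as D1. pose proof (smooth_is_derive_1 _ p q S2 Hz) as D2.
  pose proof (smooth_is_derive_1 _ p q S11 Hz) as D11. pose proof (smooth_is_derive_1 _ p q S22 Hz) as D22.
  apply (is_derive_unique (fun s => hopf_re u (s, q)) p).
  apply is_derive_eq with (1 := derive_plus _ _ _ _ _
    (derive_mult _ _ _ _ _ (derive_const (/ 4) p)
      (derive_plus _ _ _ _ _ D11 (derive_mult _ _ _ _ _ (derive_const (- 1) p) D22)))
    (derive_mult _ _ _ _ _ (derive_const (/ 4) p)
      (derive_plus _ _ _ _ _ (derive_mult _ _ _ _ _ (derive_const (- 1) p) (derive_mult _ _ _ _ _ D1 D1))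
        (derive_mult _ _ _ _ _ D2 D2)))).
  cbv beta. field.
Qed.

Let hopf_re_d2 (p q : R) : unit_disk (p, q) ->
  d2 (hopf_re u) (p, q) = (d2 (d1 (d1 u)) (p, q) - d2 (d2 (d2 u)) (p, q)) / 4
    - d1 u (p, q) * d2 (d1 u) (p, q) / 2 + d2 u (p, q) * d2 (d2 u) (p, q) / 2.
Proof.
  intros Hz.
  pose proof (smooth_is_derive_2 _ p q S1 Hz) as D1. pose proof (smooth_is_derive_2 _ p q S2 Hz) as D2.
  pose proof (smooth_is_derive_2 _ p q S11 Hz) as D11. pose proof (smooth_is_derive_2 _ p q S22 Hz) as D22.
  apply (is_derive_unique (fun s => hopf_re u (p, s)) q).
  apply is_derive_eq with (1 := derive_plus _ _ _ _ _
    (derive_mult _ _ _ _ _ (derive_const (/ 4) q)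
      (derive_plus _ _ _ _ _ D11 (derive_mult _ _ _ _ _ (derive_const (- 1) q) D22)))
    (derive_mult _ _ _ _ _ (derive_const (/ 4) q)
      (derive_plus _ _ _ _ _ (derive_mult _ _ _ _ _ (derive_const (- 1) q) (derive_mult _ _ _ _ _ D1 D1))
        (derive_mult _ _ _ _ _ D2 D2)))).
  cbv beta. field.
Qed.

Let hopf_im_d1 (p q : R) : unit_disk (p, q) ->
  d1 (hopf_im u) (p, q) = - d1 (d2 (d1 u)) (p, q) / 2
    + d1 (d1 u) (p, q) * d2 u (p, q) / 2 + d1 u (p, q) * d1 (d2 u) (p, q) / 2.
Proof.
  intros Hz.
  pose proof (smooth_is_derive_1 _ p q S1 Hz) as D1. pose proof (smooth_is_derive_1 _ p q S2 Hz) as D2.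
  pose proof (smooth_is_derive_1 _ p q S21 Hz) as D21.
  apply (is_derive_unique (fun s => hopf_im u (s, q)) p).
  apply is_derive_eq with (1 := derive_plus _ _ _ _ _
    (derive_mult _ _ _ _ _ (derive_const (- / 2) p) D21)
    (derive_mult _ _ _ _ _ (derive_const (/ 2) p) (derive_mult _ _ _ _ _ D1 D2))).
  cbv beta. field.
Qed.

Let hopf_im_d2 (p q : R) : unit_disk (p, q) ->
  d2 (hopf_im u) (p, q) = - d2 (d2 (d1 u)) (p, q) / 2
    + d2 (d1 u) (p, q) * d2 u (p, q) / 2 + d1 u (p, q) * d2 (d2 u) (p, q) / 2.
Proof.
  intros Hz.
  pose proof (smooth_is_derive_2 _ p q S1 Hz) as D1. pose proof (smooth_is_derive_2 _ p q S2 Hz) as D2.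
  pose proof (smooth_is_derive_2 _ p q S21 Hz) as D21.
  apply (is_derive_unique (fun s => hopf_im u (p, s)) q).
  apply is_derive_eq with (1 := derive_plus _ _ _ _ _
    (derive_mult _ _ _ _ _ (derive_const (- / 2) q) D21)
    (derive_mult _ _ _ _ _ (derive_const (/ 2) q) (derive_mult _ _ _ _ _ D1 D2))).
  cbv beta. field.
Qed.

(** For [q = u_zz - u_z^2], four times the conjugate derivative of [q] is [(Lap u)_z - 2 u_z Lap u],
    which vanishes because [Lap u = - exp (2 u)]. This lemma and the next are its two real
    components. *)
Lemma hopf_cauchy_riemann_1 (z : C) : unit_disk z -> d2 (hopf_im u) z = d1 (hopf_re u) z.
Proof.
  intros Hz. destruct z as [p q]. rewrite hopf_im_d2, hopf_re_d1 by auto.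
  assert (E : d2 (d2 (d1 u)) (p, q) = d1 (d2 (d2 u)) (p, q)).
  { rewrite (smooth_d12 (d2 u)) by auto. apply d2_ext; auto. intros w Hw. symmetry. now apply smooth_d12. }
  rewrite E, (smooth_d12 u) by auto.
  pose proof (lap_d1 p q Hz) as A. pose proof (lap (p, q) Hz) as B.
  assert (d1 (d1 (d1 u)) (p, q) = - 2 * d1 u (p, q) * exp (2 * u (p, q)) - d1 (d2 (d2 u)) (p, q)) by lra.
  assert (d1 (d1 u) (p, q) = - exp (2 * u (p, q)) - d2 (d2 u) (p, q)) by lra.
  rewrite H, H0. field.
Qed.

Lemma hopf_cauchy_riemann_2 (z : C) : unit_disk z -> d2 (hopf_re u) z = - d1 (hopf_im u) z.
Proof.
  intros Hz. destruct z as [p q]. rewrite hopf_im_d1, hopf_re_d2 by auto.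
  rewrite (smooth_d12 (d1 u)), (smooth_d12 u) by auto.
  pose proof (lap_d2 p q Hz) as A. pose proof (lap (p, q) Hz) as B.
  assert (d2 (d2 (d2 u)) (p, q) = - 2 * d2 u (p, q) * exp (2 * u (p, q)) - d2 (d1 (d1 u)) (p, q)) by lra.
  assert (d1 (d1 u) (p, q) = - exp (2 * u (p, q)) - d2 (d2 u) (p, q)) by lra.
  rewrite H, H0. field.
Qed.

End Hopf.

(** * Polar coordinates *)

Lemma left_limit_le (f : R -> R) (d M : R) :
  continuous f 0 -> 0 < d -> (forall t, - d < t < 0 -> f t <= M) -> f 0 <= M.
Proof.
  intros Hf Hd H. apply Rnot_lt_le. intros N.
  assert (Hc : continuity_pt f 0) by now apply continuity_pt_filterlim.
  destruct (Hc (f 0 - M)) as [e [He Hc2]]; [lra|].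
  set (t := - (Rmin d e / 2)). assert (0 < Rmin d e) by now apply Rmin_pos.
  pose proof (Rmin_l d e). pose proof (Rmin_r d e).
  specialize (Hc2 t). simpl in Hc2. unfold R_dist in Hc2.
  assert (Ht : Rabs (f t - f 0) < f 0 - M).
  { apply Hc2. split. split; [exact I | unfold t; lra]. unfold t. apply Rabs_lt_between. lra. }
  apply Rabs_lt_between in Ht. specialize (H t ltac:(unfold t; lra)). lra.
Qed.

(** The mean value theorem at [t < 0] bounds the error of the linear approximation in [h] by
    continuity of [k], uniformly as [t] tends to 0; the bound survives in the limit. *)
Lemma bdry_dh (f k : R -> R -> R) :
  cont2 f -> cont2 k -> (forall t h, t < 0 -> is_derive (f t) h (k t h)) ->
  forall h, is_derive (f 0) h (k 0 h).
Proof.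
  intros Hf Hk D h. apply is_derive_Reals. intros eps He.
  assert (He2 : 0 < eps / 2) by lra.
  destruct (Hk 0 h (mkposreal _ He2)) as [d Hd]. simpl in Hd. exists d. intros e He0 Hed.
  assert (G : Rabs (f 0 (h + e) - f 0 h - k 0 h * e) <= eps / 2 * Rabs e).
  { apply (left_limit_le (fun t => Rabs (f t (h + e) - f t h - k 0 h * e)) d); [|apply cond_pos|].
    - apply (continuous_comp (fun t => f t (h + e) - f t h - k 0 h * e) Rabs); [|apply continuous_Rabs].
      apply (continuous_minus (fun t => f t (h + e) - f t h)); [|apply continuous_const].
      apply (continuous_minus (fun t => f t (h + e))); now apply cont2_line_t.
    - intros t Ht. destruct (MVT_gen (f t) h (h + e) (k t)) as [c [Hc1 Hc2]].
      + intros; apply D; lra.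
      + intros q _. apply continuity_pt_filterlim. now apply cont2_line_h.
      + rewrite Hc2. replace (k t c * (h + e - h) - k 0 h * e) with ((k t c - k 0 h) * e) by ring.
        rewrite Rabs_mult. apply Rmult_le_compat_r. apply Rabs_pos. left. apply Hd.
        * rewrite Rminus_0_r. apply Rabs_lt_between. lra.
        * apply Rle_lt_trans with (2 := Hed). revert Hc1. unfold Rmin, Rmax, Rabs.
          destruct (Rle_dec h (h + e)); repeat destruct (Rcase_abs _); lra. }
  replace ((f 0 (h + e) - f 0 h) / e - k 0 h) with ((f 0 (h + e) - f 0 h - k 0 h * e) / e) by (field; auto).
  unfold Rdiv. rewrite Rabs_mult, Rabs_inv. apply Rabs_pos_lt in He0.
  apply Rle_lt_trans with (eps / 2 * Rabs e * / Rabs e).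
  - apply Rmult_le_compat_r; auto. left. now apply Rinv_0_lt_compat.
  - replace (eps / 2 * Rabs e * / Rabs e) with (eps / 2) by (field; lra). lra.
Qed.

Lemma cyl_of_interior (f ft fh : R -> R -> R) :
  cont2 f -> cont2 ft -> cont2 fh -> (forall t h, f t (h + 2 * PI) = f t h) ->
  (forall t h, t < 0 -> is_derive (fun s => f s h) t (ft t h)) ->
  (forall t h, t < 0 -> is_derive (f t) h (fh t h)) -> cyl f ft fh.
Proof.
  intros Cf Ct Ch P Dt Dh. split; auto.
  intros t h Ht. destruct (Rle_lt_or_eq_dec t 0 Ht) as [H|H]; [now apply Dh | subst].
  now apply (bdry_dh f fh).
Qed.

(** Needed for identities that use the differential equation, known only in the open disk;
    continuity extends them to the circle. *)
Lemma cyl_eq_neg (f ft gt fh gh : R -> R -> R) :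
  cyl f ft fh -> cont2 gt -> cont2 gh ->
  (forall t h, t < 0 -> ft t h = gt t h) -> (forall t h, t < 0 -> fh t h = gh t h) -> cyl f gt gh.
Proof.
  intros [Cf Ct Ch P Dt Dh] Gt Gh Et Eh. apply cyl_of_interior; auto.
  - intros t h Ht. rewrite <- Et by auto. auto.
  - intros t h Ht. rewrite <- Eh by auto. apply Dh; lra.
Qed.

(** Integration from minus infinity, where [f] tends to 0: both [f + (C / k) exp (k t)] and
    [- f + (C / k) exp (k t)] are nondecreasing below [T]. *)
Lemma bigO_primitive (k : R) (f ft fh : R -> R -> R) :
  0 < k -> cyl f ft fh -> bigO k ft ->
  (forall eps, 0 < eps -> exists T, T <= 0 /\ forall t h, t <= T -> Rabs (f t h) <= eps) ->
  bigO k f.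
Proof.
  intros Hk Hf [C [T [HT [HC HO]]]] Hl. exists (C / k), T.
  assert (HCk : 0 <= C / k) by (apply Rdiv_le_0_compat; lra).
  repeat split; auto. intros t h Ht.
  assert (De : forall s, is_derive (fun s => C / k * exp (k * s)) s (C * exp (k * s))).
  { intros. auto_derive; auto. field. lra. }
  assert (Ce : forall s, continuous (fun s => C / k * exp (k * s)) s).
  { intros. apply (ex_derive_continuous (V := R_NormedModule) (fun s => C / k * exp (k * s))). eexists; apply De. }
  assert (Cf : forall s, continuous (fun s => f s h) s) by (intros; apply (cont2_line_t f), Hf).
  assert (M1 : forall s, s <= t -> f s h + C / k * exp (k * s) <= f t h + C / k * exp (k * t)).
  { intros s Hs. apply (incr_upto T (fun t => f t h + C / k * exp (k * t)) (fun t => ft t h + C * exp (k * t))); try lra.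
    - intros q _. now apply (continuous_plus (fun s => f s h)).
    - intros q Hq. apply (is_derive_plus (fun s => f s h)); auto. apply (cyl_dt _ _ _ Hf). lra.
    - intros q Hq. specialize (HO q h (Rlt_le _ _ Hq)). apply Rabs_le_between in HO. lra. }
  assert (M2 : forall s, s <= t -> - f s h + C / k * exp (k * s) <= - f t h + C / k * exp (k * t)).
  { intros s Hs. apply (incr_upto T (fun t => - f t h + C / k * exp (k * t)) (fun t => - ft t h + C * exp (k * t))); try lra.
    - intros q _. apply (continuous_plus (fun s => - f s h)); auto. now apply (continuous_opp (fun s => f s h)).
    - intros q Hq. apply (is_derive_plus (fun s => - f s h)); auto. apply (is_derive_opp (fun s => f s h)).
      apply (cyl_dt _ _ _ Hf). lra.
    - intros q Hq. specialize (HO q h (Rlt_le _ _ Hq)). apply Rabs_le_between in HO. lra. }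
  apply le_epsilon. intros eps He. destruct (Hl eps He) as [S [HS HlS]].
  pose proof (Rmin_l S t) as m1. pose proof (Rmin_r S t) as m2.
  specialize (HlS (Rmin S t) h m1). apply Rabs_le_between in HlS.
  specialize (M1 _ m2). specialize (M2 _ m2).
  assert (0 <= C / k * exp (k * Rmin S t)) by (apply Rmult_le_pos; [auto | left; apply exp_pos]).
  apply Rabs_le. lra.
Qed.

(** * Lifting functions on the disk to the half-cylinder *)

Definition polar (t h : R) : C := (exp t * cos h, exp t * sin h).

(* Real and imaginary parts of [z], clipped to the closed disk so as to be defined for all [t]. *)
Definition ec (t h : R) : R := exp (Rmin t 0) * cos h.
Definition es (t h : R) : R := exp (Rmin t 0) * sin h.

Lemma ec_es (t h : R) : t <= 0 -> (ec t h, es t h) = polar t h.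
Proof. intros Ht. unfold ec, es, polar. now rewrite Rmin_left. Qed.

Lemma ec_es_sq (t h : R) : t <= 0 -> ec t h ^ 2 + es t h ^ 2 = exp t ^ 2.
Proof.
  intros Ht. unfold ec, es. rewrite Rmin_left by auto.
  pose proof (sin2_cos2 h) as E. unfold Rsqr in E.
  replace ((exp t * cos h) ^ 2 + (exp t * sin h) ^ 2) with (exp t ^ 2 * (sin h * sin h + cos h * cos h)) by ring.
  rewrite E. ring.
Qed.

Lemma polar_disk (t h : R) : t < 0 -> unit_disk (polar t h).
Proof.
  intros Ht. apply Cmod_lt_1. rewrite <- ec_es by lra. cbn [fst snd]. rewrite ec_es_sq by lra.
  pose proof (exp_pos t). assert (exp t < 1) by (rewrite <- exp_0; now apply exp_increasing). nra.
Qed.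

Lemma clip_disk (t h : R) : closed_disk (ec t h, es t h).
Proof.
  apply Cmod_le_1. cbn [fst snd].
  change (ec (t) h ^ 2 + es t h ^ 2 <= 1).
  replace (ec t h) with (ec (Rmin t 0) h) by (unfold ec; now rewrite (Rmin_left (Rmin t 0)) by apply Rmin_r).
  replace (es t h) with (es (Rmin t 0) h) by (unfold es; now rewrite (Rmin_left (Rmin t 0)) by apply Rmin_r).
  rewrite ec_es_sq by apply Rmin_r.
  pose proof (exp_pos (Rmin t 0)). pose proof (exp_le _ _ (Rmin_r t 0)) as E. rewrite exp_0 in E. nra.
Qed.

Lemma cont2_ec : cont2 ec.
Proof.
  apply cont2_mult. apply (cont2_clip (fun t _ => exp t)). cont2.
  apply (cont2_comp cos); [apply continuous_cos | apply cont2_snd].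
Qed.

Lemma cont2_es : cont2 es.
Proof.
  apply cont2_mult. apply (cont2_clip (fun t _ => exp t)). cont2.
  apply (cont2_comp sin); [apply continuous_sin | apply cont2_snd].
Qed.

Lemma cyl_ec : cyl ec ec (fun t h => - es t h).
Proof.
  apply cyl_of_interior; try apply cont2_ec; try apply cont2_opp, cont2_es.
  - intros t h. unfold ec. f_equal. rewrite cos_plus, cos_2PI, sin_2PI; ring.
  - intros t h Ht. apply is_derive_ext_loc with (fun s => exp s * cos h).
    + apply filter_imp with (2 := open_lt 0 t Ht). intros s Hs. unfold ec. rewrite Rmin_left; auto. lra.
    + unfold ec. rewrite Rmin_left by lra. auto_derive; auto. ring.
  - intros t h Ht. unfold ec, es. auto_derive; auto. ring.
Qed.

Lemma cyl_es : cyl es es ec.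
Proof.
  apply cyl_of_interior; try apply cont2_es; try apply cont2_ec.
  - intros t h. unfold es. f_equal. rewrite sin_plus, cos_2PI, sin_2PI; ring.
  - intros t h Ht. apply is_derive_ext_loc with (fun s => exp s * sin h).
    + apply filter_imp with (2 := open_lt 0 t Ht). intros s Hs. unfold es. rewrite Rmin_left; auto. lra.
    + unfold es. rewrite Rmin_left by lra. auto_derive; auto. ring.
  - intros t h Ht. unfold ec, es. auto_derive; auto. ring.
Qed.

Lemma bigO_ec : bigO 1 ec.
Proof.
  exists 1, 0. repeat split; try lra. intros t h Ht. unfold ec. rewrite Rmin_left by auto.
  rewrite Rabs_mult, Rabs_pos_eq by (left; apply exp_pos). rewrite !Rmult_1_l.
  pose proof (exp_pos t). pose proof (COS_bound h). assert (Rabs (cos h) <= 1) by (apply Rabs_le; lra). nra.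
Qed.

Lemma bigO_es : bigO 1 es.
Proof.
  exists 1, 0. repeat split; try lra. intros t h Ht. unfold es. rewrite Rmin_left by auto.
  rewrite Rabs_mult, Rabs_pos_eq by (left; apply exp_pos). rewrite !Rmult_1_l.
  pose proof (exp_pos t). pose proof (SIN_bound h). assert (Rabs (sin h) <= 1) by (apply Rabs_le; lra). nra.
Qed.

Lemma cont2_lift (g : C -> R) : continuous_on closed_disk g -> cont2 (fun t h => g (ec t h, es t h)).
Proof.
  intros Hg t h. apply continuity_2d_pt_filterlim.
  intros P HP. specialize (Hg _ (clip_disk t h) P HP). unfold filtermap, within in *.
  destruct Hg as [d Hd].
  destruct (cont2_ec t h d) as [d1 H1]. destruct (cont2_es t h d) as [d2 H2].
  exists (mkposreal _ (Rmin_pos d1 d2 (cond_pos d1) (cond_pos d2))). intros [s k] [Hs Hk]. simpl in *.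
  apply Hd; [|apply clip_disk].
  unfold ball in Hs, Hk; simpl in Hs, Hk; unfold AbsRing_ball, abs, minus, plus, opp in Hs, Hk; simpl in Hs, Hk.
  split.
  - apply H1; (eapply Rlt_le_trans; [eassumption | apply Rmin_l]).
  - apply H2; (eapply Rlt_le_trans; [eassumption | apply Rmin_r]).
Qed.

(** A derivative of [u] is meaningful only in the open disk, so [F] is tied to [f] for [t < 0] and
    continuity determines it on the circle. *)
Definition is_lift (f : C -> R) (F : R -> R -> R) : Prop :=
  cont2 F /\ (forall t h, F t (h + 2 * PI) = F t h) /\ (forall t h, t < 0 -> F t h = f (polar t h)).

Lemma lift_of_extension (f g : C -> R) :
  (forall z, unit_disk z -> g z = f z) -> continuous_on closed_disk g ->
  is_lift f (fun t h => g (ec t h, es t h)).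
Proof.
  intros E Hg. split; [now apply cont2_lift | split].
  - intros t h. now rewrite (cyl_per _ _ _ cyl_ec), (cyl_per _ _ _ cyl_es).
  - intros t h Ht. rewrite ec_es by lra. apply E. now apply polar_disk.
Qed.

Lemma lift_exists (f : C -> R) : smooth f -> exists F, is_lift f F.
Proof.
  intros Hf. destruct (Hf 0%nat) as [[g [E Hg]] _]. eexists. now apply (lift_of_extension f g).
Qed.

Lemma lift_ext (f g : C -> R) (F : R -> R -> R) :
  (forall z, unit_disk z -> f z = g z) -> is_lift f F -> is_lift g F.
Proof.
  intros E [C [P H]]. split; [|split]; auto. intros. rewrite <- E by now apply polar_disk. auto.
Qed.

Lemma lift_opp (f : C -> R) (F : R -> R -> R) :
  is_lift f F -> is_lift (fun z => - f z) (fun t h => - F t h).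
Proof.
  intros [C [P H]]. split; [|split]. cont2. intros; now rewrite P. intros; now rewrite H.
Qed.

Lemma lift_cyl (f : C -> R) (F F1 F2 : R -> R -> R) :
  smooth f -> is_lift f F -> is_lift (d1 f) F1 -> is_lift (d2 f) F2 ->
  cyl F (fun t h => ec t h * F1 t h + es t h * F2 t h) (fun t h => - es t h * F1 t h + ec t h * F2 t h).
Proof.
  intros Hf [CF [PF EF]] [C1 [_ E1]] [C2 [_ E2]].
  pose proof cont2_ec. pose proof cont2_es.
  assert (Dp : forall t h, t < 0 ->
    differentiable_pt_lim (fun u v => f (u, v)) (exp t * cos h) (exp t * sin h) (F1 t h) (F2 t h)).
  { intros t h Ht. rewrite E1, E2 by auto. apply smooth_differentiable; auto. now apply polar_disk. }
  apply cyl_of_interior; auto; try cont2.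
  - intros t h Ht. apply is_derive_ext_loc with (fun s => f (exp s * cos h, exp s * sin h)).
    { apply filter_imp with (2 := open_lt 0 t Ht). intros s Hs. symmetry. now apply EF. }
    apply is_derive_Reals. unfold ec, es. rewrite Rmin_left by lra.
    replace (exp t * cos h * F1 t h + exp t * sin h * F2 t h)
      with (F1 t h * (exp t * cos h) + F2 t h * (exp t * sin h)) by ring.
    apply (derivable_pt_lim_comp_2d (fun u v => f (u, v)) (fun s => exp s * cos h) (fun s => exp s * sin h) t); auto.
    + apply is_derive_Reals. auto_derive; auto. ring.
    + apply is_derive_Reals. auto_derive; auto. ring.
  - intros t h Ht. apply is_derive_ext with (fun s => f (exp t * cos s, exp t * sin s)).
    { intros s. symmetry. now apply EF. }
    apply is_derive_Reals. unfold ec, es. rewrite Rmin_left by lra.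
    replace (- (exp t * sin h) * F1 t h + exp t * cos h * F2 t h)
      with (F1 t h * - (exp t * sin h) + F2 t h * (exp t * cos h)) by ring.
    apply (derivable_pt_lim_comp_2d (fun u v => f (u, v)) (fun s => exp t * cos s) (fun s => exp t * sin s) h); auto.
    + apply is_derive_Reals. auto_derive; auto. ring.
    + apply is_derive_Reals. auto_derive; auto. ring.
Qed.

Lemma lift_at_origin (f : C -> R) (F : R -> R -> R) :
  smooth f -> is_lift f F ->
  forall eps, 0 < eps -> exists T, T <= 0 /\ forall t h, t <= T -> Rabs (F t h - f (0, 0)) <= eps.
Proof.
  intros Hf [_ [_ EF]] eps He.
  assert (Hz : unit_disk (0, 0)) by (apply Cmod_lt_1; simpl; lra).
  destruct (smooth_continuous f 0 0 Hf Hz (mkposreal eps He)) as [d Hd]. simpl in Hd.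
  exists (Rmin (- 1) (ln (d / 2))). split.
  - apply Rle_trans with (1 := Rmin_l _ _). lra.
  - intros t h Ht. assert (Ht1 : t <= - 1) by (apply Rle_trans with (1 := Ht), Rmin_l).
    assert (Ht2 : t <= ln (d / 2)) by (apply Rle_trans with (1 := Ht), Rmin_r).
    rewrite EF by lra. left. pose proof (cond_pos d) as Pd.
    apply exp_le in Ht2. rewrite exp_ln in Ht2 by lra. pose proof (exp_pos t).
    apply Hd; rewrite Rminus_0_r, Rabs_mult, (Rabs_pos_eq (exp t)) by lra.
    + pose proof (COS_bound h). assert (Rabs (cos h) <= 1) by (apply Rabs_le; lra). nra.
    + pose proof (SIN_bound h). assert (Rabs (sin h) <= 1) by (apply Rabs_le; lra). nra.
Qed.

Lemma lift_bigO (f : C -> R) (F : R -> R -> R) : smooth f -> is_lift f F -> bigO 0 F.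
Proof.
  intros Hf HF. destruct (lift_at_origin f F Hf HF 1 Rlt_0_1) as [T [HT H]].
  exists (Rabs (f (0, 0)) + 1), T. repeat split; auto. pose proof (Rabs_pos (f (0, 0))); lra.
  intros t h Ht. rewrite Rmult_0_l, exp_0, Rmult_1_r. specialize (H t h Ht).
  replace (F t h) with (f (0, 0) + (F t h - f (0, 0))) by ring. apply Rle_trans with (1 := Rabs_triang _ _). lra.
Qed.

(** * The theorem *)

Lemma bigO_mult_eq (j k l : R) (f g : R -> R -> R) :
  j + k = l -> bigO j f -> bigO k g -> bigO l (fun t h => f t h * g t h).
Proof. intros <-. apply bigO_mult. Qed.

(** Along the ray, [z - e z] has radius [r = 1 - e] and [t = ln r]. The mean value theorem in [r]
    and continuity of [D] up to [t = 0] identify the one-sided limit. *)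
Lemma normal_derivative_lift (u : C -> R) (F D : R -> R -> R) (h l : R) :
  (forall t, t <= 0 -> F t h = u (polar t h)) -> cont2 F -> cont2 D ->
  (forall t, t < 0 -> is_derive (fun s => F s h) t (D t h)) ->
  is_outer_normal_derive u (cos h, sin h) l -> l = D 0 h.
Proof.
  intros EF CF CD HD Hl. apply Rminus_diag_uniq. apply Rabs_eq_0, Rle_antisym; [|apply Rabs_pos].
  apply le_epsilon. intros eps He. rewrite Rplus_0_l.
  assert (He2 : 0 < eps / 2) by lra.
  destruct (Hl _ (locally_ball l (mkposreal _ He2))) as [d1 H1].
  assert (Cq : continuity_pt (fun r => D (ln r) h * / r) 1).
  { apply continuity_pt_filterlim. apply (continuous_mult (fun r => D (ln r) h) Rinv).
    - apply (continuous_comp ln (fun t => D t h)). apply continuous_ln; lra. now apply cont2_line_t.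
    - apply continuous_Rinv. lra. }
  destruct (Cq _ He2) as [d2 [Hd2 H2]].
  set (e := Rmin (Rmin d1 d2) 1 / 2).
  assert (Hm : 0 < Rmin (Rmin d1 d2) 1) by (repeat apply Rmin_pos; auto; [apply cond_pos | lra]).
  pose proof (Rmin_l (Rmin d1 d2) 1). pose proof (Rmin_r (Rmin d1 d2) 1). pose proof (Rmin_l d1 d2). pose proof (Rmin_r d1 d2).
  assert (He0 : 0 < e) by (unfold e; lra).
  assert (Hball : ball 0 d1 e).
  { unfold ball; simpl; unfold AbsRing_ball, abs, minus, plus, opp; simpl. apply Rabs_lt_between. unfold e; lra. }
  specialize (H1 e Hball He0). unfold ball in H1; simpl in H1; unfold AbsRing_ball, abs, minus, plus, opp in H1; simpl in H1.
  assert (E0 : u (cos h, sin h) = F (ln 1) h).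
  { rewrite ln_1, EF by lra. unfold polar. rewrite exp_0, !Rmult_1_l. reflexivity. }
  assert (E1 : u ((cos h, sin h) - RtoC e * (cos h, sin h))%C = F (ln (1 - e)) h).
  { rewrite EF. 2:{ rewrite <- ln_1. left. apply ln_increasing; unfold e; lra. }
    unfold polar. rewrite exp_ln by (unfold e; lra). f_equal. unfold Cminus, Cplus, Copp, Cmult, RtoC. simpl. f_equal; ring. }
  assert (Dr : forall r, 0 < r < 1 -> is_derive (fun r => F (ln r) h) r (D (ln r) h * / r)).
  { intros r Hr. eapply is_derive_eq. apply (is_derive_comp (fun s => F s h) ln).
    - apply HD. rewrite <- ln_1. apply ln_increasing; lra.
    - apply is_derive_Reals. apply derivable_pt_lim_ln. lra.
    - apply Rmult_comm. }
  destruct (MVT_gen (fun r => F (ln r) h) (1 - e) 1 (fun r => D (ln r) h * / r)) as [c [Hc1 Hc2]].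
  - rewrite Rmin_left, Rmax_right by lra. intros r Hr. apply Dr. unfold e in *; lra.
  - rewrite Rmin_left, Rmax_right by lra. intros r Hr. apply continuity_pt_filterlim.
    apply (continuous_comp ln (fun t => F t h)). apply continuous_ln; unfold e in *; lra. now apply cont2_line_t.
  - rewrite Rmin_left, Rmax_right in Hc1 by lra.
    rewrite E0, E1, Hc2 in H1.
    replace (D (ln c) h * / c * (1 - (1 - e)) / e) with (D (ln c) h * / c) in H1 by (field; unfold e in *; lra).
    assert (HD3 : Rabs (D (ln c) h * / c - D 0 h) < eps / 2).
    { destruct (Req_dec c 1) as [->|N].
      - rewrite ln_1, Rinv_1, Rmult_1_r, Rminus_diag, Rabs_R0. lra.
      - specialize (H2 c). simpl in H2. unfold R_dist in H2. rewrite ln_1, Rinv_1, Rmult_1_r in H2.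
        apply H2. split. split; [exact I | lra]. apply Rabs_lt_between. unfold e in *; lra. }
    apply Rabs_lt_between in H1. apply Rabs_lt_between in HD3. apply Rabs_le. lra.
Qed.

Lemma polar_system (lambda : R) (u : C -> R) :
  2 < lambda -> smooth_up_to_boundary u -> is_solution lambda u ->
  exists v a b x y x1 y1 x2 y2,
    liouville (lambda - 1) v a b x y x1 y1 x2 y2 /\
    (forall t h, t <= 0 -> v t h = u (polar t h) + t) /\
    (hopf_re u (0, 0) = 0 -> hopf_im u (0, 0) = 0 -> bigO 3 x /\ bigO 3 y).
Proof.
  intros Hlam [Hcont Hu] [Hpde Hbdry]. change (smooth u) in Hu.
  set (m := lambda - 1). assert (Hm : m <> 0) by (unfold m; lra).
  pose proof (smooth_d1 u Hu) as S1. pose proof (smooth_d2 u Hu) as S2.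
  pose proof (smooth_hopf_re u Hu) as SQ. pose proof (smooth_hopf_im u Hu) as SP.
  pose proof (smooth_d1 _ SQ) as SQ1. pose proof (smooth_d1 _ SP) as SP1.
  (* [u] has to be its own extension here, because the boundary condition refers to its actual
     values on the circle. *)
  pose proof (lift_of_extension u u (fun _ _ => eq_refl) Hcont) as LU.
  set (U := fun t h => u (ec t h, es t h)) in *.
  destruct (lift_exists _ S1) as [UX LUX]. destruct (lift_exists _ S2) as [UY LUY].
  destruct (lift_exists _ (smooth_d1 _ S1)) as [UXX LUXX]. destruct (lift_exists _ (smooth_d2 _ S1)) as [UXY LUXY].
  destruct (lift_exists _ (smooth_d2 _ S2)) as [UYY LUYY].
  assert (LUYX : is_lift (d1 (d2 u)) UXY).
  { apply (lift_ext (d2 (d1 u))); auto. intros; symmetry; now apply smooth_d12. }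
  destruct (lift_exists _ SQ) as [Q LQ]. destruct (lift_exists _ SP) as [P LP].
  destruct (lift_exists _ SQ1) as [Q1 LQ1]. destruct (lift_exists _ SP1) as [P1 LP1].
  destruct (lift_exists _ (smooth_d1 _ SQ1)) as [Q2 LQ2]. destruct (lift_exists _ (smooth_d1 _ SP1)) as [P2 LP2].
  assert (LQy : is_lift (d2 (hopf_re u)) (fun t h => - P1 t h)).
  { apply (lift_ext (fun z => - d1 (hopf_im u) z)). intros; symmetry; now apply hopf_cauchy_riemann_2. now apply lift_opp. }
  assert (LPy : is_lift (d2 (hopf_im u)) Q1).
  { apply (lift_ext (d1 (hopf_re u))); auto. intros; symmetry; now apply hopf_cauchy_riemann_1. }
  assert (LQ1y : is_lift (d2 (d1 (hopf_re u))) (fun t h => - P2 t h)).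
  { apply (lift_ext (fun z => - d1 (d1 (hopf_im u)) z)); [|now apply lift_opp].
    intros z Hz. rewrite <- smooth_d12 by auto.
    transitivity (d1 (fun z => - d1 (hopf_im u) z) z).
    - symmetry. apply (Derive_opp (fun s => d1 (hopf_im u) (s, Im z))).
    - apply d1_ext; auto. intros; symmetry; now apply hopf_cauchy_riemann_2. }
  assert (LP1y : is_lift (d2 (d1 (hopf_im u))) Q2).
  { apply (lift_ext (d1 (d1 (hopf_re u)))); auto.
    intros z Hz. rewrite <- smooth_d12 by auto. apply d1_ext; auto. intros; symmetry; now apply hopf_cauchy_riemann_1. }
  pose proof (lift_cyl _ _ _ _ Hu LU LUX LUY) as KU.
  pose proof (lift_cyl _ _ _ _ S1 LUX LUXX LUXY) as KX.
  pose proof (lift_cyl _ _ _ _ S2 LUY LUYX LUYY) as KY.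
  pose proof (lift_cyl _ _ _ _ SQ LQ LQ1 LQy) as KQ.
  pose proof (lift_cyl _ _ _ _ SP LP LP1 LPy) as KP.
  pose proof (lift_cyl _ _ _ _ SQ1 LQ1 LQ2 LQ1y) as KQ1.
  pose proof (lift_cyl _ _ _ _ SP1 LP1 LP2 LP1y) as KP1.
  pose proof cyl_ec as Kc. pose proof cyl_es as Ks.
  pose proof cont2_ec as Cc. pose proof cont2_es as Cs.
  pose proof (lift_bigO _ _ Hu LU) as OU.
  pose proof (lift_bigO _ _ S1 LUX) as OX. pose proof (lift_bigO _ _ S2 LUY) as OY.
  pose proof (lift_bigO _ _ SQ LQ) as OQ. pose proof (lift_bigO _ _ SP LP) as OP.
  pose proof (lift_bigO _ _ SQ1 LQ1) as OQ1. pose proof (lift_bigO _ _ SP1 LP1) as OP1.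
  pose proof bigO_ec as Oc. pose proof bigO_es as Os.
  destruct LU as [CU [_ EU]]. destruct LUX as [CX [_ EX]]. destruct LUY as [CY [_ EY]].
  destruct LUXX as [CXX [_ EXX]]. destruct LUXY as [CXY [_ EXY]]. destruct LUYY as [CYY [_ EYY]].
  pose proof LQ as LQ0. pose proof LP as LP0.
  destruct LQ as [CQ [_ EQ]]. destruct LP as [CP [_ EP]].
  destruct LQ1 as [CQ1 [_ EQ1]]. destruct LP1 as [CP1 [_ EP1]].
  destruct LQ2 as [CQ2 _]. destruct LP2 as [CP2 _].
  assert (HE : forall t h, t < 0 -> exp (2 * (U t h + t)) = - (ec t h ^ 2 + es t h ^ 2) * (UXX t h + UYY t h)).
  { intros t h Ht. rewrite ec_es_sq by lra.
    replace (2 * (U t h + t)) with (2 * U t h + t + t) by ring. rewrite !exp_plus, EU by auto.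
    rewrite <- (Hpde _ (polar_disk t h Ht)). unfold laplacian. rewrite EXX, EYY by auto. ring. }
  assert (HQ : forall t h, t < 0 -> Q t h = (UXX t h - UYY t h - UX t h ^ 2 + UY t h ^ 2) / 4).
  { intros t h Ht. rewrite EQ, EX, EY, EXX, EYY by auto. unfold hopf_re. field. }
  assert (HP : forall t h, t < 0 -> P t h = (UX t h * UY t h - UXY t h) / 2).
  { intros t h Ht. rewrite EP, EX, EY, EXY by auto. unfold hopf_im. field. }
  set (v := fun t h => U t h + t).
  set (a := fun t h => 1 + (ec t h * UX t h + es t h * UY t h)).
  set (b := fun t h => - es t h * UX t h + ec t h * UY t h).
  (* Real and imaginary parts of [z^2], [z^3] and [z^4]. *)
  set (z2r := fun t h => ec t h * ec t h - es t h * es t h). set (z2i := fun t h => 2 * (ec t h * es t h)).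
  set (z3r := fun t h => z2r t h * ec t h - z2i t h * es t h). set (z3i := fun t h => z2r t h * es t h + z2i t h * ec t h).
  set (z4r := fun t h => z2r t h * z2r t h - z2i t h * z2i t h). set (z4i := fun t h => 2 * (z2r t h * z2i t h)).
  (* With [q = u_zz - u_z^2] and derivatives taken by [z d/dz]: [p = - z^2 q / m],
     [p' = 2 p - z^3 q' / m], [p'' = 4 p - (5 z^3 q' + z^4 q'') / m]. *)
  set (x := fun t h => - / m * (z2r t h * Q t h - z2i t h * P t h)).
  set (y := fun t h => - / m * (z2r t h * P t h + z2i t h * Q t h)).
  set (x1 := fun t h => 2 * x t h + - / m * (z3r t h * Q1 t h - z3i t h * P1 t h)).
  set (y1 := fun t h => 2 * y t h + - / m * (z3r t h * P1 t h + z3i t h * Q1 t h)).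
  set (x2 := fun t h => 4 * x t h + - / m * (5 * (z3r t h * Q1 t h - z3i t h * P1 t h) + (z4r t h * Q2 t h - z4i t h * P2 t h))).
  set (y2 := fun t h => 4 * y t h + - / m * (5 * (z3r t h * P1 t h + z3i t h * Q1 t h) + (z4r t h * P2 t h + z4i t h * Q2 t h))).
  assert (Lv : cyl v a b).
  { eapply cyl_eq; [unfold v; cyl | |]; intros; unfold a, b; ring. }
  assert (Lx : cyl x x1 (fun t h => - y1 t h)).
  { eapply cyl_eq; [unfold x, z2r, z2i; cyl | |]; intros; unfold x1, y1, z3r, z3i, x, y, z2r, z2i; cbv beta; ring. }
  assert (Ly : cyl y y1 x1).
  { eapply cyl_eq; [unfold y, z2r, z2i; cyl | |]; intros; unfold x1, y1, z3r, z3i, x, y, z2r, z2i; cbv beta; ring. }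
  assert (Lx1 : cyl x1 x2 (fun t h => - y2 t h)).
  { eapply cyl_eq; [unfold x1, z3r, z3i, z2r, z2i; cyl | |]; intros;
      unfold x2, y2, x1, y1, z4r, z4i, z3r, z3i, x, y, z2r, z2i; cbv beta; ring. }
  assert (Ly1 : cyl y1 y2 x2).
  { eapply cyl_eq; [unfold y1, z3r, z3i, z2r, z2i; cyl | |]; intros;
      unfold x2, y2, x1, y1, z4r, z4i, z3r, z3i, x, y, z2r, z2i; cbv beta; ring. }
  assert (Cv : cont2 v) by apply Lv.
  assert (Ca : cont2 a) by (unfold a; cont2).
  assert (Cb : cont2 b) by (unfold b; cont2).
  assert (Cx : cont2 x) by apply Lx.
  assert (Cy : cont2 y) by apply Ly.
  assert (Chalf : forall f, cont2 f -> cont2 (fun t h => f t h / 2)).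
  { intros f Hf. apply (cont2_mult f (fun _ _ => / 2)); cont2. }
  assert (La : cyl a
    (fun t h => (- exp (2 * v t h) - 4 * m * x t h + a t h ^ 2 - b t h ^ 2 - 1) / 2)
    (fun t h => 2 * m * y t h + a t h * b t h)).
  { eapply cyl_eq_neg; [unfold a; cyl | apply Chalf; cont2 | cont2 | |]; intros t h Ht; cbv beta.
    - unfold v. rewrite HE by auto. unfold x, a, b, z2r, z2i. rewrite HQ, HP by auto. field. auto.
    - unfold y, a, b, z2r, z2i. rewrite HQ, HP by auto. field. auto. }
  assert (Lb : cyl b
    (fun t h => 2 * m * y t h + a t h * b t h)
    (fun t h => (- exp (2 * v t h) + 4 * m * x t h - a t h ^ 2 + b t h ^ 2 + 1) / 2)).
  { eapply cyl_eq_neg; [unfold b; cyl | cont2 | apply Chalf; cont2 | |]; intros t h Ht; cbv beta.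
    - unfold y, a, b, z2r, z2i. rewrite HQ, HP by auto. field. auto.
    - unfold v. rewrite HE by auto. unfold x, a, b, z2r, z2i. rewrite HQ, HP by auto. field. auto. }
  assert (Oz2r : bigO 2 z2r).
  { apply bigO_minus; apply (bigO_mult_eq 1 1); auto; lra. }
  assert (Oz2i : bigO 2 z2i).
  { apply (bigO_mult_eq 0 2 2 (fun _ _ => 2)); [lra | apply bigO_const | apply (bigO_mult_eq 1 1); auto; lra]. }
  assert (Oz3r : bigO 3 z3r).
  { apply bigO_minus; apply (bigO_mult_eq 2 1); auto; lra. }
  assert (Oz3i : bigO 3 z3i).
  { apply bigO_plus; apply (bigO_mult_eq 2 1); auto; lra. }
  assert (Osc : forall c k f, bigO k f -> bigO k (fun t h => c * f t h)).
  { intros c k f Hf. apply (bigO_mult_eq 0 k k (fun _ _ => c)); auto. lra. apply bigO_const. }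
  assert (Opq : forall k l f g p q, k + l = 2 \/ k + l = 3 -> bigO k f -> bigO k g -> bigO l p -> bigO l q ->
    bigO (k + l) (fun t h => f t h * p t h - g t h * q t h) /\ bigO (k + l) (fun t h => f t h * q t h + g t h * p t h)).
  { intros k l f g p q _ Hf Hg Hp Hq. split; [apply bigO_minus | apply bigO_plus]; now apply bigO_mult. }
  assert (Ox : bigO 2 x /\ bigO 2 y).
  { destruct (Opq 2 0 z2r z2i Q P) as [O1 O2]; auto. left; lra. replace (2 + 0) with 2 in O1, O2 by ring.
    split; now apply Osc. }
  assert (O3 : bigO 2 (fun t h => z3r t h * Q1 t h - z3i t h * P1 t h) /\ bigO 2 (fun t h => z3r t h * P1 t h + z3i t h * Q1 t h)).
  { destruct (Opq 3 0 z3r z3i Q1 P1) as [O1 O2]; auto. right; lra.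
    split; eapply bigO_weaken; [|apply O1| |apply O2]; lra. }
  exists v, a, b, x, y, x1, y1, x2, y2. split; [|split].
  - split; auto.
    + intros h. unfold v, U.
      assert (Ez : (ec 0 h, es 0 h) = (cos h, sin h)).
      { rewrite ec_es by lra. unfold polar. now rewrite exp_0, !Rmult_1_l. }
      rewrite Ez, Rplus_0_r.
      destruct (Hbdry (cos h, sin h)) as [l [Hl Hl2]].
      { unfold unit_circle, Cmod. cbn [fst snd]. pose proof (sin2_cos2 h) as E. unfold Rsqr in E.
        replace (cos h ^ 2 + sin h ^ 2) with 1 by lra. apply sqrt_1. }
      assert (El : l = a 0 h - 1).
      { apply (normal_derivative_lift u U (fun t h => a t h - 1) h l); auto.
        - intros t Ht. unfold U. now rewrite ec_es.
        - cont2.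
        - intros t Ht. apply is_derive_eq with (1 := cyl_dt _ _ _ KU t h Ht). unfold a; ring. }
      unfold m. lra.
    + apply bigO_ext with U; auto. intros; unfold v; ring.
    + apply bigO_ext with (fun t h => ec t h * UX t h + es t h * UY t h). intros; unfold a; ring.
      apply bigO_plus; apply (bigO_mult_eq 1 0); auto; lra.
    + apply bigO_plus; apply (bigO_mult_eq 1 0); auto; try lra. now apply bigO_opp.
    + apply Ox.
    + apply Ox.
    + apply bigO_plus; apply Osc; [apply Ox | apply O3].
    + apply bigO_plus; apply Osc; [apply Ox | apply O3].
  - intros t h Ht. unfold v, U. now rewrite ec_es.
  - intros Q0 P0.
    (* The vanishing of [q] at the origin supplies the third order of decay, beyond the factor
       [z^2]. *)
    assert (OQ1' : bigO 1 Q).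
    { eapply (bigO_primitive 1 Q); [lra | apply KQ | |].
      - apply bigO_plus; apply (bigO_mult_eq 1 0); auto; try lra. now apply bigO_opp.
      - intros eps He. destruct (lift_at_origin _ _ SQ LQ0 eps He) as [T [HT H]]. exists T. split; auto.
        intros t h Ht. specialize (H t h Ht). now rewrite Q0, Rminus_0_r in H. }
    assert (OP1' : bigO 1 P).
    { eapply (bigO_primitive 1 P); [lra | apply KP | |].
      - apply bigO_plus; apply (bigO_mult_eq 1 0); auto; lra.
      - intros eps He. destruct (lift_at_origin _ _ SP LP0 eps He) as [T [HT H]]. exists T. split; auto.
        intros t h Ht. specialize (H t h Ht). now rewrite P0, Rminus_0_r in H. }
    destruct (Opq 2 1 z2r z2i Q P) as [O1 O2]; auto. right; lra.
    replace (2 + 1) with 3 in O1, O2 by ring. split; now apply Osc.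
Qed.

(** * Back from the half-cylinder to the disk *)

Lemma polar_surj (z : C) : closed_disk z -> z <> (0, 0) -> exists t h, t <= 0 /\ z = polar t h.
Proof.
  intros Hz Hn. destruct z as [p q]. apply Cmod_le_1 in Hz. cbn [fst snd] in Hz.
  assert (Hr2 : 0 < p ^ 2 + q ^ 2).
  { destruct (Req_dec p 0) as [->|Np]; [destruct (Req_dec q 0) as [->|Nq]|].
    - now elim Hn.
    - assert (0 < q ^ 2) by now apply pow2_gt_0. nra.
    - assert (0 < p ^ 2) by now apply pow2_gt_0. pose proof (pow2_ge_0 q). lra. }
  set (r := sqrt (p ^ 2 + q ^ 2)).
  assert (Hr : 0 < r) by now apply sqrt_lt_R0.
  assert (Er : r ^ 2 = p ^ 2 + q ^ 2) by (apply pow2_sqrt; lra).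
  assert (Hr1 : r <= 1) by (unfold r; rewrite <- sqrt_1; now apply sqrt_le_1_alt).
  set (c := p / r). set (s := q / r).
  assert (Ecs : c ^ 2 + s ^ 2 = 1).
  { unfold c, s. replace ((p / r) ^ 2 + (q / r) ^ 2) with ((p ^ 2 + q ^ 2) / r ^ 2) by (field; lra). rewrite Er. field. lra. }
  assert (Hc : -1 <= c <= 1) by (split; nra).
  assert (Hh : exists h, cos h = c /\ sin h = s).
  { destruct (Rle_dec 0 s) as [Hs|Hs].
    - exists (acos c). split. now apply cos_acos. rewrite sin_acos by auto.
      replace (1 - c²) with (s ^ 2) by (unfold Rsqr; lra). now apply sqrt_pow2.
    - exists (- acos c). split. rewrite cos_neg. now apply cos_acos. rewrite sin_neg, sin_acos by auto.
      replace (1 - c²) with ((- s) ^ 2) by (unfold Rsqr; nra). rewrite sqrt_pow2; lra. }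
  destruct Hh as [h [E1 E2]]. exists (ln r), h. split.
  - rewrite <- ln_1. destruct (Rle_lt_or_eq_dec _ _ Hr1) as [L|L]. left; now apply ln_increasing. rewrite L; lra.
  - unfold polar. rewrite exp_ln, E1, E2 by auto. unfold c, s. f_equal; field; lra.
Qed.

Lemma continuity_2d_pt_line (f : R -> R -> R) (p q : R) :
  continuity_2d_pt f p q -> continuous (fun s => f s q) p.
Proof.
  intros Hf. apply continuity_pt_filterlim. intros eps He.
  destruct (Hf (mkposreal eps He)) as [d Hd].
  exists d; split; [apply cond_pos|]. intros x [_ Hx].
  unfold dist in *; simpl in *; unfold R_dist in *.
  apply Hd; auto. rewrite Rminus_diag, Rabs_R0. apply cond_pos.
Qed.

(** Polar coordinates miss the origin; the radial formula reaches it by continuity along the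
    positive real axis. *)
Lemma eq_at_0_of_eq_right (f g : R -> R) :
  continuous f 0 -> continuous g 0 -> (forall p, 0 < p <= 1 -> f p = g p) -> f 0 = g 0.
Proof.
  assert (G : forall f g : R -> R, continuous f 0 -> continuous g 0 ->
    (forall p, 0 < p <= 1 -> f p = g p) -> f 0 <= g 0).
  { clear f g. intros f g Hf Hg E. apply Rminus_le. rewrite <- Ropp_0 at 1 2.
    assert (Ho : continuous Ropp 0).
    { apply (continuous_opp (V := R_NormedModule) (fun x : R => x)), continuous_id. }
    apply (left_limit_le (fun s => f (- s) - g (- s)) 1); [|lra|].
    - apply (continuous_minus (fun s => f (- s))); apply (continuous_comp Ropp); auto; now rewrite Ropp_0.
    - intros s Hs. rewrite E by lra. lra. }
  intros Hf Hg E. apply Rle_antisym; apply G; auto. intros; symmetry; auto.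
Qed.

Lemma rotate_polar (alpha t h : R) : ((cos alpha, sin alpha) * polar t h)%C = polar t (alpha + h).
Proof.
  unfold polar, Cmult. cbn [fst snd]. rewrite cos_plus, sin_plus. f_equal; ring.
Qed.

Lemma polar_closed (t h : R) : t <= 0 -> closed_disk (polar t h).
Proof. intros Ht. rewrite <- ec_es by auto. apply clip_disk. Qed.

Lemma wirtinger_real (u : C -> R) (z : C) :
  wirtinger (fun z => RtoC (u z)) z = (/ 2 * d1 u z, - (/ 2 * d2 u z)).
Proof.
  unfold wirtinger, d1C, d2C.
  replace (d1 (fun w => Im (RtoC (u w))) z) with 0 by (symmetry; exact (Derive_const 0 (Re z))).
  replace (d2 (fun w => Im (RtoC (u w))) z) with 0 by (symmetry; exact (Derive_const 0 (Im z))).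
  change (d1 (fun w => Re (RtoC (u w))) z) with (d1 u z).
  change (d2 (fun w => Re (RtoC (u w))) z) with (d2 u z).
  unfold Cminus, Cplus, Copp, Cmult, RtoC, Ci. cbn [fst snd]. f_equal; field.
Qed.

Lemma hopf_wirtinger (u : C -> R) :
  smooth u ->
  let uC := fun z : C => RtoC (u z) in
  (wirtinger uC (RtoC 0) ^ 2 - wirtinger (wirtinger uC) (RtoC 0))%C
  = (- hopf_re u (0, 0), - hopf_im u (0, 0)).
Proof.
  intros Hu uC. unfold wirtinger at 2, d1C, d2C.
  replace (d1 (fun w => Re (wirtinger uC w)) (RtoC 0)) with (/ 2 * d1 (d1 u) (0, 0)).
  2:{ symmetry. transitivity (d1 (fun w => / 2 * d1 u w) (0, 0)).
      - apply Derive_ext. intros; unfold uC; now rewrite wirtinger_real.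
      - apply Derive_scal. }
  replace (d2 (fun w => Re (wirtinger uC w)) (RtoC 0)) with (/ 2 * d2 (d1 u) (0, 0)).
  2:{ symmetry. transitivity (d2 (fun w => / 2 * d1 u w) (0, 0)).
      - apply Derive_ext. intros; unfold uC; now rewrite wirtinger_real.
      - apply Derive_scal. }
  replace (d1 (fun w => Im (wirtinger uC w)) (RtoC 0)) with (- / 2 * d1 (d2 u) (0, 0)).
  2:{ symmetry. transitivity (d1 (fun w => - / 2 * d2 u w) (0, 0)).
      - apply Derive_ext. intros; unfold uC; rewrite wirtinger_real; apply Ropp_mult_distr_l.
      - apply Derive_scal. }
  replace (d2 (fun w => Im (wirtinger uC w)) (RtoC 0)) with (- / 2 * d2 (d2 u) (0, 0)).
  2:{ symmetry. transitivity (d2 (fun w => - / 2 * d2 u w) (0, 0)).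
      - apply Derive_ext. intros; unfold uC; rewrite wirtinger_real; apply Ropp_mult_distr_l.
      - apply Derive_scal. }
  assert (Hz : unit_disk (0, 0)) by (apply Cmod_lt_1; simpl; lra).
  rewrite (smooth_d12 u (0, 0) Hu Hz). unfold uC. rewrite wirtinger_real.
  change (RtoC 0) with ((0, 0) : C). unfold hopf_re, hopf_im.
  unfold Cminus, Cplus, Copp, Cpow, Cmult, RtoC, Ci. cbn [fst snd]. f_equal; field.
Qed.

Theorem theorem1p5 (lambda : R) (hlambda : 2 < lambda <= 3) (u : C -> R)
    (hsmooth : smooth_up_to_boundary u) (hu : is_solution lambda u) :
  exactly_one (radial_alternative lambda u) (nonradial_alternative u) /\
  (1 + sqrt 2 < lambda <= 3 -> nonradial_alternative u).
Proof.
  destruct (polar_system lambda u ltac:(lra) hsmooth hu)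
    as [v [a [b [x [y [x1 [y1 [x2 [y2 [L [Ev Hhopf]]]]]]]]]]].
  assert (Hsm : smooth u) by exact (proj2 hsmooth).
  assert (Hm : 1 < lambda - 1) by lra.
  assert (Hu0 : forall f, smooth f -> continuity_2d_pt (fun p q => f (p, q)) 0 0).
  { intros f Hf. apply smooth_continuous; auto. apply Cmod_lt_1; simpl; lra. }
  assert (Hrad : radial u -> radial_alternative lambda u).
  { intros Hr. split; auto.
    assert (Hb : forall t h, t <= 0 -> b t h = 0).
    { intros t h Ht. pose proof (cyl_dh _ _ _ (li_v _ _ _ _ _ _ _ _ _ _ L) t h Ht) as D.
      assert (D0 : is_derive (fun s => v t s) h 0).
      { apply is_derive_ext with (fun _ => v t 0); [|apply derive_const].
        intros s. rewrite !Ev by auto. f_equal. rewrite <- (Hr s (polar t 0)) by now apply polar_closed.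
        now rewrite rotate_polar, Rplus_0_r. }
      apply is_derive_unique in D. apply is_derive_unique in D0. rewrite D0 in D. auto. }
    destruct (radial_profile _ _ _ _ _ _ _ _ _ _ Hm L Hb) as [r [Hr0 [Hr1 Hr2]]].
    exists r. split; auto. split. replace (lambda - 2) with (lambda - 1 - 1) by ring. rewrite <- Hr1. ring.
    assert (Hpol : forall t h, t <= 0 -> u (polar t h) = ln (2 * r / (1 + r ^ 2 * exp t ^ 2))).
    { intros t h Ht. pose proof (Hr2 t h Ht) as E. rewrite Ev in E by auto. lra. }
    assert (Hmod : forall t h, Cmod (polar t h) = exp t).
    { intros t h. unfold Cmod, polar. cbn [fst snd]. pose proof (sin2_cos2 h) as E. unfold Rsqr in E.
      replace ((exp t * cos h) ^ 2 + (exp t * sin h) ^ 2) with (exp t ^ 2 * (sin h * sin h + cos h * cos h)) by ring.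
      rewrite E, Rmult_1_r. apply sqrt_pow2. left; apply exp_pos. }
    intros z Hz. destruct (Ceq_dec z (0, 0)) as [->|Nz].
    - replace (Cmod (0, 0)) with 0 by (symmetry; apply Cmod_0).
      apply (eq_at_0_of_eq_right (fun p => u (p, 0)) (fun p => ln (2 * r / (1 + r ^ 2 * p ^ 2)))).
      + apply (continuity_2d_pt_line (fun p q => u (p, q))). now apply Hu0.
      + apply (ex_derive_continuous (V := R_NormedModule) (fun p => ln (2 * r / (1 + r ^ 2 * p ^ 2)))).
        auto_derive. rewrite !Rmult_0_l, Rmult_0_r, Rplus_0_r. repeat split; try lra.
      + intros p Hp. rewrite <- (exp_ln p) at 2 by lra. rewrite <- (Hpol (ln p) 0).
        * unfold polar. rewrite exp_ln, cos_0, sin_0 by lra. f_equal. f_equal; ring.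
        * rewrite <- ln_1. destruct (Rle_lt_or_eq_dec p 1) as [Hl|Hl]; [lra| |].
          left; now apply ln_increasing. rewrite Hl; lra.
    - destruct (polar_surj z Hz Nz) as [t [h [Ht ->]]]. now rewrite Hmod, Hpol. }
  assert (Hnon : ~ radial u -> nonradial_alternative u).
  (* If the Hopf quantity vanished at 0, rigidity would give [v_h = 0] everywhere, so [u] would be
     invariant under rotations. *)
  { intros Hn. split; auto. intros uC HQ. unfold uC in HQ. rewrite (hopf_wirtinger u Hsm) in HQ.
    injection HQ as Q1 Q2. destruct Hhopf as [Ox Oy]; [lra | lra |].
    apply Hn. intros alpha z Hz. destruct (Ceq_dec z (0, 0)) as [->|Nz].
    - f_equal. unfold Cmult. cbn [fst snd]. f_equal; ring.
    - destruct (polar_surj z Hz Nz) as [t [h [Ht ->]]]. rewrite rotate_polar.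
      assert (Hm2 : 1 < lambda - 1 <= 2) by lra.
      destruct (MVT_gen (v t) h (alpha + h) (b t)) as [c [_ Hc]].
      + intros; now apply (cyl_dh _ _ _ (li_v _ _ _ _ _ _ _ _ _ _ L)).
      + intros q _. apply continuity_pt_filterlim. apply cont2_line_h. apply (li_v _ _ _ _ _ _ _ _ _ _ L).
      + rewrite (liouville_rigidity _ _ _ _ _ _ _ _ _ _ Hm2 L Ox Oy) in Hc by auto.
        rewrite !Ev in Hc by auto. lra. }
  destruct (classic (radial u)) as [Hr|Hn].
  - split.
    + left. split; auto. intros [Hn _]. auto.
    + intros Hl. exfalso. destruct (Hrad Hr) as [_ [r [_ [Hr1 _]]]].
      assert (S2 : sqrt 2 ^ 2 = 2) by (apply pow2_sqrt; lra). pose proof (sqrt_pos 2).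
      (* Completing the square: a real [r] requires [lambda (lambda - 2) <= 1], that is
         [lambda <= 1 + sqrt 2] in the present range. *)
      assert (D : ((lambda - 2) * r - 1) ^ 2 = 1 - lambda * (lambda - 2)).
      { replace (((lambda - 2) * r - 1) ^ 2) with ((lambda - 2) * ((lambda - 2) * r ^ 2 - 2 * r) + 1) by ring.
        replace ((lambda - 2) * r ^ 2 - 2 * r) with (- lambda) by lra. ring. }
      pose proof (pow2_ge_0 ((lambda - 2) * r - 1)). nra.
  - split; auto. right. split; auto. intros [Hr _]. auto.
Qed.
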